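(* Let $(n_r)_{r\ge1}$ be a subsequence of the positive integers. If $\gamma(a_{n_r}) \stackrel{cir}{\to} \lambda$ as $r\to\infty$ for some $\lambda \in (c^{-1}, 1]$, then for any $x > 0$ $$\lim_{r \to \infty} \mathbb{P} ( S_{n_r} / a_{n_r} \leq x ) = \mathbb{P} \left( (V_{h_\lambda(x)} )^{-\alpha} \leq x \right) =: H_\lambda(x), \qquad \text{where } h_\lambda(x) = \frac{\lambda x}{c^{\lceil \log_c (\lambda x) \rceil }}.$$ More generally, the following merging result holds: $$\lim_{n \to \infty} \sup_{x > 0} \left| \mathbb{P} ( S_n \geq a_n x) - \mathbb{P} ( V_{\gamma(a_n x)} \leq x^{-1/\alpha}) \right| = 0.$$
   Context: **Semistable laws.** Fix $\alpha\in(0,1)$, $c>1$, and a nonconstant function $M:(0,\infty)\to(0,\infty)$ with $M(c^{1/\alpha}x)=M(x)$ for all $x>0$ and such that $x\mapsto M(x)x^{-\alpha}$ is nonincreasing on $(0,\infty)$. For $\lambda>0$ put $R_\lambda(x)=-M(\lambda^{1/\alpha}x)/x^\alpha$, $x>0$, and let $V_\lambda$ be a nonnegative random variable with characteristic function $$\mathbb{E}e^{itV_\lambda}=\exp\left\{\int_0^\infty(e^{itx}-1)\,dR_\lambda(x)\right\}.$$ **Subsequence and position parameter.** Let $(k_n)_{n\ge1}$ be positive integers with $k_n<k_{n+1}$ for all $n\ge1$ and $\lim_{n\to\infty}k_{n+1}/k_n=c$. For $x>k_1$ let $\gamma(x)=x/k_n$, where $n$ is determined by $k_{n-1}<x\le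 k_n$; for $0<x\le k_1$ assign to $\gamma(x)$ an arbitrary value in $(c^{-1},1]$. A sequence $u_n$ converges circularly to $u\in(c^{-1},1]$, written $u_n\stackrel{cir}{\to}u$, if either $u\in(c^{-1},1)$ and $u_n\to u$ in the usual sense, or $u=1$ and the limit points of $(u_n)$ are $1$, or $c^{-1}$, or both (and no others). **Norming.** Let $\ell_1$ be a positive slowly varying function (at infinity), $A_n=n^{1/\alpha}\ell_1(n)$, and define $\ell$ by $x^{-\alpha}\ell(x)=\sup\{t:\ t^{-1/\alpha}\ell_1(1/t)>x\}$; then $\ell$ is slowly varying and $x^{1/\alpha}\ell_1(x)$ and $y^\alpha/\ell(y)$ are asymptotic inverses of each other. For $x$ large let $\delta(x)=x/A_{k_n}$, where $n$ is determined by $A_{k_n}\le x<A_{k_{n+1}}$. Let $a_n=n^\alpha/\ell(n)$, so that $a_n^{1/\alpha}\ell_1(a_n)\sim n$ (one may choose $a_n$, up to asymptotic equivalence, to be an integer sequence). **Renewal chain.** Let $(f_k)_{k\ge0}$ be a probability distribution with $\sum_k kf_k=\infty$, and let $(X_n)_{n\ge0}$ be the Markov chain on $\{0,1,2,\dots\}$ with $X_0=0$ and transition probabilities $p_{0,k}=f_k$ for $k\ge 0$, $p_{\ell,\ell-1}=1$ for $\ell\ge1$, and all others $0$. Let $S_n=\sum_{j=0}^{n-1}1_{\{X_j=0\}}$. The return time to $0$ is a random variable $\tau$ with $\mathbb{P}(\tau=k)=f_{k-1}$, $k\ge1$; let $F(x)=\mathbb{P}(\tau\le x)$ and $\overline F=1-F$.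 **Standing assumption on $F$.** For $x$ large, $$\overline F(x)=\frac{\ell(x)}{x^\alpha}\left[M(\delta(x))+h(x)\right],$$ where $h$ is a right-continuous function with $\lim_{n\to\infty}h(A_{k_n}x)=0$ for every continuity point $x>0$ of $M$. (This is equivalent to convergence in distribution of $A_{k_n}^{-1}\sum_{i=1}^{k_n}\tau_i$ to $V_1$, where $\tau_i$ are i.i.d. copies of $\tau$.) *)

(* Defs.v *)
From HB Require Import structures.
From mathcomp Require Import all_boot all_order all_algebra.
From mathcomp Require Import all_classical all_reals all_analysis.
From mathcomp Require Import complex.
Import Order.TTheory GRing.Theory Num.Theory.
Import numFieldNormedType.Exports.

Set Implicit Arguments.
Unset Strict Implicit.
Unset Printing Implicit Defensive.

Local Open Scope classical_set_scope.
Local Open Scope ring_scope.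

(* Index conventions: the informal sequences k_1, k_2, ... and n_1, n_2, ...
   are functions on nat shifted by one, so that [k 0] is k_1. *)

Section ComplexValued.
Context {R : realType}.
Local Notation C := (complex.complex R).

Definition cexp (z : C) : C :=
  Complex (expR (complex.Re z) * cos (complex.Im z))
                  (expR (complex.Re z) * sin (complex.Im z)).

Definition Cintegral d (T : measurableType d) (mu : {measure set T -> \bar R})
    (D : set T) (f : T -> C) : C :=
  Complex (\int[mu]_(x in D) complex.Re (f x))
                  (\int[mu]_(x in D) complex.Im (f x)).

Definition expi (s : R) : C := cexp (Complex 0 s).

Definition char_fun d (T : measurableType d) (P : probability T R)
    (X : {RV P >-> R}) (t : R) : C :=
  Cintegral P [set: T] (fun w => expi (t * X w)).

End ComplexValued.

Section Semistable.
Context {R : realType}.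

Definition semistable_modulus (alpha c : R) (M : R -> R) : Prop :=
  [/\ forall x : R, 0 < x -> 0 < M x,
      exists x y : R, [/\ 0 < x, 0 < y & M x <> M y],
      forall x : R, 0 < x -> M (c `^ alpha^-1 * x) = M x
    & forall x y : R, 0 < x -> x <= y -> M y * y `^ (- alpha) <= M x * x `^ (- alpha)].

Definition levy_tail (alpha : R) (M : R -> R) (lambda x : R) : R :=
  - (M (lambda `^ alpha^-1 * x) / x `^ alpha).

(* [nu] is the Lebesgue-Stieltjes measure dG on the open half-line, for G
   nondecreasing there. The library measure [lebesgue_stieltjes_measure] wants
   G right-continuous on the whole line, whereas the functions used here tend
   to -oo at 0. Right limits are taken because no right-continuity is assumed:
   nu ]a, b] = G(b+) - G(a+). *)
Definition stieltjes_on_pos (G : R -> R) (nu : {measure set R -> \bar R}) : Prop :=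
  forall a b : R, 0 < a -> a < b ->
    nu `]a, b]%classic = (lim (G x @[x --> b^'+]) - lim (G x @[x --> a^'+]))%:E.

Definition semistable_rv (alpha : R) (M : R -> R) (lambda : R)
    d (T : measurableType d) (P : probability T R) (X : {RV P >-> R}) : Prop :=
  (forall w, 0 <= X w) /\
  exists2 nu : {measure set R -> \bar R},
    stieltjes_on_pos (levy_tail alpha M lambda) nu &
    forall t : R, char_fun X t =
      cexp (Cintegral nu `]0, +oo[%classic (fun x => expi (t * x) - 1)).

End Semistable.

Section Position.
Context {R : realType}.

Definition position_parameter (c : R) (k : nat -> nat) (gamma : R -> R) : Prop :=
  (forall n (x : R), (k n)%:R < x -> x <= (k n.+1)%:R -> gamma x = x / (k n.+1)%:R) /\
  (forall x : R, 0 < x -> x <= (k 0)%:R -> c^-1 < gamma x /\ gamma x <= 1).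

Definition limit_points (u : nat -> R) : set R := cluster (u @ \oo).

Definition cvg_circular (c : R) (u : nat -> R) (l : R) : Prop :=
  (c^-1 < l /\ l < 1 /\ u @ \oo --> l) \/
  (l = 1 /\ [\/ limit_points u = [set 1],
               limit_points u = [set c^-1]
             | limit_points u = [set 1; c^-1]]).

End Position.

Section Norming.
Context {R : realType}.

Definition slowly_varying (l : R -> R) : Prop :=
  [/\ measurable_fun [set x : R | 0 < x] l,
      forall x : R, 0 < x -> 0 < l x
    & forall t : R, 0 < t -> l (t * x) / l x @[x --> +oo] --> (1 : R)].

Definition norming (alpha : R) (l1 : R -> R) (n : nat) : R :=
  n%:R `^ alpha^-1 * l1 n%:R.

(* x^{-alpha} ell(x) = sup {t > 0 : t^{-1/alpha} l1(1/t) > x}.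
   The set is nonempty when l1 is slowly varying; if it is unbounded then [sup]
   is 0 by convention. *)
Definition ell (alpha : R) (l1 : R -> R) (x : R) : R :=
  x `^ alpha * sup [set t : R | 0 < t /\ x < t `^ (- alpha^-1) * l1 t^-1].

Definition a_seq (alpha : R) (l1 : R -> R) (n : nat) : R :=
  n%:R `^ alpha / ell alpha l1 n%:R.

(* For x large there is exactly one n with A_n <= x < A_(n+1), where A is
   the norming sequence along k. *)
Definition delta_function (A : nat -> R) (delta : R -> R) : Prop :=
  \forall x \near +oo, forall n, A n <= x -> x < A n.+1 -> delta x = x / A n.

End Norming.

Section RenewalChain.
Context {R : realType}.

Definition prob_sequence (f : nat -> R) : Prop :=
  (forall k, 0 <= f k) /\ (\sum_(0 <= k <oo) (f k)%:E = 1)%E.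

Definition renewal_transition (f : nat -> R) (i j : nat) : R :=
  if i is l.+1 then (j == l)%:R else f j.

Definition markov_chain_from (x0 : nat) (p : nat -> nat -> R)
    d (T : measurableType d) (P : probability T R)
    (X : nat -> {RV P >-> nat}) : Prop :=
  P [set w | X 0%N w = x0] = 1%E /\
  forall (n : nat) (s : nat -> nat),
    P [set w | forall i, (i <= n.+1)%N -> X i w = s i] =
    (P [set w | forall i, (i <= n)%N -> X i w = s i] * (p (s n) (s n.+1))%:E)%E.

Definition visits d (T : measurableType d) (P : probability T R)
    (X : nat -> {RV P >-> nat}) (n : nat) (w : T) : nat :=
  (\sum_(j < n) (X j w == 0))%N.

End RenewalChain.

Definition h_position {R : realType} (c lambda x : R) : R :=
  lambda * x / c ^ Num.ceil (ln (lambda * x) / ln c).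

(* Main.v *)
(** Idea. The chain returns to 0 at the partial sums T_m of independent copies of
    tau, so [S_n > m] is the event [T_m <= n - 1]. Along m ~ lambda k_j and
    n ~ w A_(k_j), the characteristic function of T_m / n is
    (E exp(i t tau / n))^m, which converges to that of a rescaled V_lambda as
    soon as the tails m P(tau > n s) converge, off a countable set, to the Levy
    tail of V_lambda and are dominated by C (1 + s^-b) with b < 1: integrate by
    parts, after damping by exp(-eta x). Distribution functions are recovered from
    cosine transforms alone through 1 / (1 + y^2) = \int_0^oo e^-t cos(t y) dt and
    powers of it. The tail asymptotics rest on the uniform convergence theorem for
    slowly varying functions, and the merging statement follows by compactness,
    together with tightness for x near 0 and near infinity. *)

Require Import Defs.
From HB Require Import structures.
From mathcomp Require Import all_boot all_order all_algebra.
From mathcomp Require Import all_classical all_reals all_analysis.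
From mathcomp Require Import measurable_realfun.
From mathcomp Require Import ring lra complex.
Import Order.TTheory GRing.Theory Num.Theory.
Import numFieldNormedType.Exports.

Set Implicit Arguments.
Unset Strict Implicit.
Unset Printing Implicit Defensive.

Local Open Scope classical_set_scope.
Local Open Scope ring_scope.

(** * Distribution functions from cosine transforms *)

(** [M] may jump and need not be right-continuous, so the Levy measure sees only right limits of its
    tail, and tails converge only at continuity points of [M]; that is where the countable
    exceptional set comes from. Damping is forced because the derivative of cos (t x) is not
    absolutely integrable against the tail at infinity; the error is bounded by the integral of 1 -
    exp(-eta x), which integration by parts reaches again, so it is small uniformly. Cosines suffice
    because the sums and V_lambda are nonnegative. The limit laws have no atoms, since their
    characteristic functions are at most of order exp(-K t^alpha). The tail hypothesis says nothing
    about P(tau > A_(k_j) s) for tiny s, whence an exponent b strictly between alpha and 1: the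
    slack over alpha absorbs the slowly varying factor, and b < 1 keeps s^-b integrable at 0. As [M]
    is log-periodic, V_lambda and V_(c lambda) have the same law, so the limit points 1 and c^-1 of
    the position parameter yield one limit. The infinite mean excludes a tail that vanishes
    eventually, for which [ell] could degenerate to 0 through the convention on [sup]. *)

Section BoundedIntegrals.
Context d (T : measurableType d) (R : realType).
Variable P : probability T R.
Implicit Types f g : T -> R.

Lemma integrable_bounded f (C : R) :
  measurable_fun setT f -> (forall x, `|f x| <= C) ->
  P.-integrable setT (EFin \o f).
Proof.
move=> mf fC; apply: measurable_bounded_integrable => //.
  by rewrite (le_lt_trans (probability_le1 P measurableT))// ltry.
exists C; split; first exact: num_real.
by move=> M CM x _ /=; exact: le_trans (fC x) (ltW CM).
Qed.

Lemma Rintegral_bounded f (C : R) :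
  measurable_fun setT f -> (forall x, `|f x| <= C) ->
  `|\int[P]_x f x| <= C.
Proof.
move=> mf fC; have fi := integrable_bounded mf fC.
apply: le_trans (le_normr_Rintegral measurableT fi) _.
have -> : C = \int[P]_(x in setT) (cst C x).
  by rewrite Rintegral_cst// [X in fine X](@probability_setT _ _ _ P) mulr1.
apply: le_Rintegral => //.
  by apply: (@integrable_bounded (fun x => `|f x|) C) => [|x];
    [exact: measurableT_comp | rewrite normr_id].
by apply: (@integrable_bounded (cst C) `|C|).
Qed.

End BoundedIntegrals.

Section ExpKernel.
Context {R : realType}.
Notation leb := (@lebesgue_measure R).
Notation pdf := (exponential_pdf (1 : R)).

Lemma is_derive_cosM (z t : R) : is_derive t 1 (fun t : R => cos (z * t)) (- z * sin (z * t)).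
Proof.
have h : is_derive t 1 (fun t : R => z * t) z.
  by apply: (@is_derive_eq _ _ _ (z \*: id)); rewrite /GRing.scale /= mulr1.
have := @is_derive1_comp _ cos (fun t : R => z * t) t _ _ (is_derive_cos _) h.
by move/is_derive_eq; apply; rewrite mulrC mulrN mulNr.
Qed.

Lemma is_derive_sinM (z t : R) : is_derive t 1 (fun t : R => sin (z * t)) (z * cos (z * t)).
Proof.
have h : is_derive t 1 (fun t : R => z * t) z.
  by apply: (@is_derive_eq _ _ _ (z \*: id)); rewrite /GRing.scale /= mulr1.
have := @is_derive1_comp _ sin (fun t : R => z * t) t _ _ (is_derive_sin _) h.
by move/is_derive_eq; apply; rewrite mulrC.
Qed.

Lemma is_derive_expRNM (z t : R) :
  is_derive t 1 (fun t : R => expR (- (z * t))) (- z * expR (- (z * t))).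
Proof.
have h : is_derive t 1 (fun t : R => - (z * t)) (- z).
  by apply: (@is_derive_eq _ _ _ (- (z \*: id))); rewrite /GRing.scale /= mulr1.
have := @is_derive1_comp _ expR (fun t : R => - (z * t)) t _ _ (is_derive_expR _) h.
by move/is_derive_eq; apply; rewrite mulrC.
Qed.

Lemma is_derive_expcos (a z t : R) :
  is_derive t 1 (fun t : R => expR (- (a * t)) * cos (z * t))
    (- expR (- (a * t)) * (a * cos (z * t) + z * sin (z * t))).
Proof.
have := is_deriveM (is_derive_expRNM a t) (is_derive_cosM z t).
by move/is_derive_eq; apply; rewrite /GRing.scale /=; ring.
Qed.

Lemma is_derive_expsin (a z t : R) :
  is_derive t 1 (fun t : R => expR (- (a * t)) * sin (z * t))
    (expR (- (a * t)) * (z * cos (z * t) - a * sin (z * t))).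
Proof.
have := is_deriveM (is_derive_expRNM a t) (is_derive_sinM z t).
by move/is_derive_eq; apply; rewrite /GRing.scale /=; ring.
Qed.

Lemma pdfT (g : R -> R) : (\int[leb]_t (pdf t * g t)%:E = \int[leb]_(t in `[0%R, +oo[) (expR (- (1 * t)) * g t)%:E)%E.
Proof.
rewrite [RHS]integral_mkcond; apply: eq_integral => t _.
rewrite /exponential_pdf !patchE; case: ifPn => _ //; last by rewrite mul0r.
by rewrite !mul1r mulN1r.
Qed.

Lemma cvg_expR0 (a : R) (g : R -> R) (C : R) : 0 < a -> (forall t, `|g t| <= C) ->
  expR (- (a * t)) * g t @[t --> +oo] --> 0.
Proof.
move=> a0 gC.
have C0 : 0 <= C by apply: le_trans (gC 0).
have h : (expR (- (a * t)) * C) @[t --> +oo] --> (0 : R).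
  rewrite -[X in _ --> X](mul0r C); apply: cvgMl.
  apply: (@cvg_comp _ _ _ (fun t => a * t) (fun t => expR (- t)) _ (pinfty_nbhs R)); last exact: cvgr_expR.
  exact: gt0_cvgMry.
apply: norm_cvg0; apply: (squeeze_cvgr _ (cvg_cst 0) h).
near=> t; rewrite normr_ge0 normrM ger0_norm ?expR_ge0// ler_wpM2l ?expR_ge0//.
Unshelve. all: by end_near. Qed.

(** The 1 added to the cosine makes the integrand nonnegative, as the fundamental theorem on a
    half-line requires; [expo_kernel] subtracts it again. *)
Lemma expo_kernel_aux (z : R) : (\int[leb]_t (pdf t * (1 + cos (z * t)))%:E = (1 + (1 + z ^+ 2)^-1)%:E)%E.
Proof.
have z1 : 1 + z ^+ 2 != 0 by rewrite gt_eqF// ltr_pwDl// sqr_ge0.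
rewrite pdfT.
pose F t := (1 + z ^+ 2)^-1 * z * (expR (- (1 * t)) * sin (z * t)) - (1 + z ^+ 2)^-1 * (expR (- (1 * t)) * cos (z * t)) - expR (- (1 * t)).
have dF (t : R) : is_derive t 1 F (expR (- (1 * t)) * (1 + cos (z * t))).
  have h1 := is_deriveZ ((1 + z ^+ 2)^-1 * z) (is_derive_expsin 1 z t).
  have h2 := is_deriveZ (1 + z ^+ 2)^-1 (is_derive_expcos 1 z t).
  have := is_deriveB (is_deriveB h1 h2) (is_derive_expRNM 1 t).
  move/is_derive_eq; apply; rewrite /GRing.scale /=. by field.
have cF (t : R) : {for t, continuous F}.
  by apply: differentiable_continuous; apply/derivable1_diffP; case: (dF t).
rewrite (@ge0_continuous_FTC2y _ _ F 0 0).
- congr (_%:E). rewrite /F !mulr0 sin0 cos0 oppr0 expR0 mulr0 !mulr1. ring.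
- move=> x _; rewrite mulr_ge0 ?expR_ge0//; have := cos_geN1 (z * x); lra.
- apply: continuous_subspaceT => t.
  have -> : (fun x : R => expR (- (1 * x)) * (1 + cos (z * x))) =
      (fun t : R => expR (- (1 * t))) + (fun t : R => expR (- (1 * t)) * cos (z * t)).
    by apply/funext => x; rewrite mulrDr mulr1.
  apply: differentiable_continuous; apply/derivable1_diffP.
  by case: (is_deriveD (is_derive_expRNM 1 t) (is_derive_expcos 1 z t)).
- have -> : 0 = (1 + z ^+ 2)^-1 * z * 0 - (1 + z ^+ 2)^-1 * 0 - 0 * 1 :> R by rewrite !mulr0 mul0r !subr0.
  apply: cvgB; first apply: cvgB.
  + by apply: cvgMr; apply: (@cvg_expR0 _ _ 1) ; [exact: ltr01 |move=> t; rewrite ler_norml sin_geN1 sin_le1].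
  + by apply: cvgMr; apply: (@cvg_expR0 _ _ 1) ; [exact: ltr01 |move=> t; rewrite ler_norml cos_geN1 cos_le1].
  + rewrite mul0r; have := @cvg_expR0 1 (cst 1) 1 ltr01.
    under eq_fun do rewrite mulr1. apply. by move=> t; rewrite normr1.
- by move=> x _; case: (dF x).
- by apply: cvg_at_right_filter; exact: cF.
- by move=> x _; rewrite derive1E; case: (dF x).
Qed.
Lemma measurable_cosM (z : R) : measurable_fun setT (fun t : R => cos (z * t)).
Proof.
apply: continuous_measurable_fun => t; apply: differentiable_continuous.
by apply/derivable1_diffP; case: (is_derive_cosM z t).
Qed.

Lemma measurable_cos : measurable_fun setT (@cos R).
Proof. exact: continuous_measurable_fun (@continuous_cos R). Qed.

Lemma measurable_sin : measurable_fun setT (@sin R).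
Proof. exact: continuous_measurable_fun (@continuous_sin R). Qed.

Lemma normr_cos_le1 (t : R) : `|cos t| <= 1.
Proof. by rewrite ler_norml cos_geN1 cos_le1. Qed.

Lemma normr_sin_le1 (t : R) : `|sin t| <= 1.
Proof. by rewrite ler_norml sin_geN1 sin_le1. Qed.

Lemma integrable_pdfM (g : R -> R) (C : R) : measurable_fun setT g ->
  (forall t, `|g t| <= C) ->
  leb.-integrable setT (EFin \o (fun t => pdf t * g t)).
Proof.
move=> mg gC.
have C0 : 0 <= C by apply: le_trans (gC 0).
apply: (@le_integrable _ _ _ leb setT measurableT _ (EFin \o (fun t => C * pdf t))).
- by apply/measurable_EFinP; apply: measurable_funM => //; exact: measurable_exponential_pdf.
- move=> t _; rewrite /= lee_fin !normrM mulrC [`|pdf t|]ger0_norm ?exponential_pdf_ge0//.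
  by rewrite (ger0_norm C0) ler_wpM2r ?exponential_pdf_ge0.
- have := integrableZl measurableT C (integrable_exponential_pdf (@ltr01 R)).
  by apply: eq_integrable => // t _ /=; rewrite EFinM.
Qed.

Lemma Rintegral_pdf : \int[leb]_t pdf t = 1.
Proof. by rewrite /Rintegral integral_exponential_pdf. Qed.

Lemma expo_kernel (z : R) : \int[leb]_t (pdf t * cos (t * z)) = (1 + z ^+ 2)^-1.
Proof.
have -> : (fun t => pdf t * cos (t * z)) = fun t => pdf t * (1 + cos (z * t)) - pdf t.
  by apply/funext => t; rewrite (mulrC t); ring.
rewrite RintegralB//; last exact: integrable_exponential_pdf.
  by rewrite Rintegral_pdf [X in X - _ = _](_ : _ = fine (1 + (1 + z ^+ 2)^-1)%:E) /=;
    [ring | rewrite /Rintegral expo_kernel_aux].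
apply: (@integrable_pdfM _ 2).
  by apply: measurable_funD => //; exact: measurable_cosM.
move=> t; rewrite (le_trans (ler_normD _ _))// normr1.
by have := normr_cos_le1 (z * t); lra.
Qed.

(** Pointwise convergence may fail at t = 0: there a cosine transform is the total mass 1, which
    does not tend to 0 in the criterion for the absence of atoms. *)
Lemma expo_dct (f_ : nat -> R -> R) (f : R -> R) (C : R) :
  (forall n, measurable_fun setT (f_ n)) -> measurable_fun setT f ->
  (forall n t, `|f_ n t| <= C) ->
  (forall t, t != 0 -> f_ n t @[n --> \oo] --> f t) ->
  \int[leb]_t (pdf t * f_ n t) @[n --> \oo] --> \int[leb]_t (pdf t * f t).
Proof.
move=> mf_ mf fC ff.
have C0 : 0 <= C by apply: le_trans (fC 0%N 0).
have Cpi : leb.-integrable setT (EFin \o (fun t => C * pdf t)).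
  have := integrableZl measurableT C (integrable_exponential_pdf (@ltr01 R)).
  by apply: eq_integrable => // t _ /=; rewrite EFinM.
have [|||||i _ h] := @dominated_convergence _ _ _ leb setT measurableT
  (fun n t => (pdf t * f_ n t)%:E) (fun t => (pdf t * f t)%:E) (EFin \o (fun t => C * pdf t)).
- by move=> n; apply/measurable_EFinP; apply: measurable_funM; [exact: measurable_exponential_pdf|exact: mf_].
- by apply/measurable_EFinP; apply: measurable_funM; [exact: measurable_exponential_pdf|exact: mf].
- exists [set 0]; split => //; first exact: lebesgue_measure_set1.
  move=> t /= h; apply: contrapT => /eqP t0; apply: h => _.
  by apply/fine_cvgP; split; [exact: nearW | apply: cvgMr; exact: ff].
- exact: Cpi.
- apply: aeW => t n _; rewrite lee_fin normrM ger0_norm ?exponential_pdf_ge0//.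
  by rewrite mulrC ler_wpM2r ?exponential_pdf_ge0.
apply: fine_cvg; move: h; rewrite fineK//.
exact: integrable_fin_num i.
Qed.

Context d (T : measurableType d) (P : probability T R).

(** Averaging cos (t X) over an exponential time t gives 1 / (1 + X^2), so a factor of this form can
    be traded for cosine transforms. The weight [g] lets the exchange be repeated. *)
Lemma expo_fubini (X g : T -> R) (C : R) :
  measurable_fun setT X -> measurable_fun setT g -> (forall w, `|g w| <= C) ->
  measurable_fun setT (fun t : R => \int[P]_w (g w * cos (t * X w))) /\
  \int[P]_w (g w * (1 + X w ^+ 2)^-1) =
  \int[leb]_t (pdf t * \int[P]_w (g w * cos (t * X w))).
Proof.
move=> mX mg gC.
have mt : measurable_fun setT (fun z : T * R => g z.1 * cos (z.2 * X z.1)).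
  apply: measurable_funM; first exact: measurableT_comp.
  apply: measurableT_comp; first exact: measurable_cos.
  by apply: measurable_funM => //; exact: measurableT_comp.
have bt w t : `|g w * cos (t * X w)| <= C.
  rewrite normrM -[X in _ <= X]mulr1 ler_pM//; exact: normr_cos_le1.
have it t : P.-integrable setT (EFin \o (fun w => g w * cos (t * X w))).
  apply: (@integrable_bounded _ _ _ _ _ C) => //.
  exact: (measurableT_comp mt (measurable_pair2 t)).
split.
  (* Adding the bound [C] makes the integrand nonnegative, so that Tonelli's theorem yields
     measurability in [t]. *)
  have -> : (fun t : R => \int[P]_w (g w * cos (t * X w))) =
      (fun t => fine (\int[P]_w (C + g w * cos (t * X w))%:E) - C).
    apply/funext => t.
    transitivity (\int[P]_w (C + g w * cos (t * X w)) - C) => //.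
    rewrite (@RintegralD _ _ _ P setT (cst C) _ measurableT _ (it t)).
      rewrite Rintegral_cst// [X in fine X](@probability_setT _ _ _ P).
      by rewrite mulr1 addrC addKr.
    exact: (@integrable_bounded _ _ _ _ (cst C) `|C|).
  apply: measurable_funB => //.
  apply: measurableT_comp => //.
  apply: (@measurable_fun_fubini_tonelli_G _ _ T R R P (fun z => (C + g z.1 * cos (z.2 * X z.1))%:E)).
    by apply/measurable_EFinP; exact: measurable_funD.
  by move=> z; rewrite lee_fin; have := bt z.1 z.2; rewrite ler_norml; lra.
pose F (z : T * R) := (pdf z.2 * (g z.1 * cos (z.2 * X z.1)))%:E.
have mF : measurable_fun setT F.
  apply/measurable_EFinP; apply: measurable_funM => //.
  by apply: measurableT_comp => //; exact: measurable_exponential_pdf.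
have C0 : 0 <= C by apply: le_trans (bt point 0).
have iF : (P \x leb)%E.-integrable setT F.
  apply/integrable12ltyP => //.
  apply: (@le_lt_trans _ _ (\int[P]_w (C%:E))%E); last first.
    by rewrite integral_cst//= [X in (_ * X)%E](@probability_setT _ _ _ P) mule1 ltry.
  apply: ge0_le_integral => //.
  - by move=> w _; exact: integral_ge0.
  - apply: (@measurable_fun_fubini_tonelli_F _ _ _ _ _ leb (fun z => `|F z|%E)).
      exact: measurableT_comp.
    by move=> z; exact: abse_ge0.
  - move=> w _; have -> : C%:E = (\int[leb]_t (C%:E * (pdf t)%:E))%E.
      by rewrite integralZl ?integral_exponential_pdf ?mule1//; exact: integrable_exponential_pdf.
    apply: ge0_le_integral => //.
    + by apply: measurableT_comp => //; exact: (measurableT_comp mF (measurable_pair1 w)).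
    + by apply: measurable_funeM; apply/measurable_EFinP; exact: measurable_exponential_pdf.
    + move=> t _; rewrite /F /= lee_fin normrM ger0_norm ?exponential_pdf_ge0//.
      by rewrite mulrC ler_wpM2r ?exponential_pdf_ge0.
have := Fubini iF.
have -> : (\int[P]_w \int[leb]_t F (w, t) = \int[P]_w (g w * (1 + X w ^+ 2)^-1)%:E)%E.
  apply: eq_integral => w _.
  have ic : leb.-integrable setT (EFin \o (fun t => pdf t * cos (t * X w))).
    apply: (@integrable_pdfM _ 1); last by move=> t; exact: normr_cos_le1.
    by under eq_fun do rewrite mulrC; exact: measurable_cosM.
  rewrite -(expo_kernel (X w)) -RintegralZl// /Rintegral fineK /=; last first.
    apply: integrable_fin_num => //.
    by have := integrableZl measurableT (g w) ic; apply: eq_integrable.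
  by apply: eq_integral => t _; rewrite /F /=; congr (_%:E); ring.
have -> : (\int[leb]_t \int[P]_w F (w, t) = \int[leb]_t (pdf t * \int[P]_w (g w * cos (t * X w)))%:E)%E.
  apply: eq_integral => t _.
  rewrite -RintegralZl// /Rintegral fineK//.
  apply: integrable_fin_num => //.
  by have := integrableZl measurableT (pdf t) (it t); apply: eq_integrable.
by move=> h; rewrite /Rintegral h.
Qed.
End ExpKernel.

Section StepPolynomials.
Context {R : realType}.

Lemma bernoulli_ge (x : R) n : -1 <= x -> 1 + n%:R * x <= (1 + x) ^+ n.
Proof.
move=> x1; elim: n => [|n ih]; first by rewrite mul0r addr0 expr0.
rewrite exprS; apply: (@le_trans _ _ ((1 + x) * (1 + n%:R * x))).
  rewrite -natr1; have : 0 <= n%:R * x ^+ 2 by rewrite mulr_ge0 ?sqr_ge0.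
  by rewrite expr2; lra.
by rewrite ler_wpM2l//; lra.
Qed.

(* [(1 - u ^+ N) ^+ (2 ^ N)] tends to 1 for [u < 1/2] and to 0 for [u > 1/2]. *)
Lemma step_poly_ge (u : R) N : 0 <= u <= 1 ->
  1 - (2 * u) ^+ N <= (1 - u ^+ N) ^+ (2 ^ N).
Proof.
move=> /andP[u0 u1]; rewrite exprMn -natrX.
have uN : u ^+ N <= 1 by rewrite exprn_ile1.
have /(bernoulli_ge (2 ^ N)) : -1 <= - u ^+ N by lra.
by rewrite mulrN.
Qed.

Lemma step_poly_le (u : R) N : 0 < u <= 1 ->
  (1 - u ^+ N) ^+ (2 ^ N) <= ((2 * u) ^+ N)^-1.
Proof.
move=> /andP[u0 u1]; rewrite exprMn -natrX.
have uN : u ^+ N <= 1 by rewrite exprn_ile1// ltW.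
have uN0 : 0 < u ^+ N by rewrite exprn_gt0.
have k0 : 0 < (2 ^ N)%:R :> R by rewrite ltr0n expn_gt0.
rewrite -div1r ler_pdivlMr ?mulr_gt0//.
have /(bernoulli_ge (2 ^ N)) h : -1 <= u ^+ N by lra.
(* By Bernoulli the factor (1 + u^N)^(2^N) is at least (2 u)^N, and the product is (1 -
   u^(2N))^(2^N) <= 1. *)
apply: (@le_trans _ _ ((1 - u ^+ N) ^+ (2 ^ N) * (1 + u ^+ N) ^+ (2 ^ N))).
  rewrite ler_wpM2l ?exprn_ge0//; first by lra.
  lra.
rewrite -exprMn exprn_ile1//.
  by rewrite mulr_ge0; lra.
have : 0 <= (u ^+ N) ^+ 2 by rewrite sqr_ge0.
by rewrite expr2; lra.
Qed.

End StepPolynomials.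

Lemma inv1Dsq_bounds {R : realType} (x : R) : 0 < (1 + x ^+ 2)^-1 <= 1.
Proof.
have x0 : 0 <= x ^+ 2 by rewrite sqr_ge0.
by rewrite invr_gt0 ltr_pwDl//= invf_le1 ?lerDl// ltr_pwDl.
Qed.

Lemma measurable_inv1Dsq {R : realType} d (T : measurableType d) (Y : T -> R) :
  measurable_fun setT Y -> measurable_fun setT (fun w => (1 + Y w ^+ 2)^-1).
Proof.
move=> mY; apply: (measurableT_comp (f := fun x : R => (1 + x ^+ 2)^-1) _ mY).
apply: continuous_measurable_fun => x; apply: cvgV.
  by rewrite gt_eqF// ltr_pwDl// sqr_ge0.
by apply: cvgD; [exact: cvg_cst|exact: exprn_continuous].
Qed.

Section CosineConvergence.
Context {R : realType} d (T : measurableType d) d' (T' : measurableType d').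
Variables (P_ : nat -> probability T R) (P : probability T' R).
Variables (X_ : nat -> T -> R) (X : T' -> R).
Hypothesis mX_ : forall n, measurable_fun setT (X_ n).
Hypothesis mX : measurable_fun setT X.

Let u (x : R) := (1 + x ^+ 2)^-1.

(** Weights are carried along so that the class is closed under multiplication by [u] and under
    differences, hence under multiplication by polynomials in [u]. *)
Definition cos_cvg (g_ : nat -> T -> R) (g : T' -> R) :=
  [/\ forall n, measurable_fun setT (g_ n), measurable_fun setT g,
   exists C, (forall n w, `|g_ n w| <= C) /\ (forall w, `|g w| <= C) &
   forall t, \int[P_ n]_w (g_ n w * cos (t * X_ n w)) @[n --> \oo] -->
      \int[P]_w (g w * cos (t * X w))].

Let u01 x : 0 < u x <= 1. Proof. exact: inv1Dsq_bounds. Qed.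

Let mu_ d1 (T1 : measurableType d1) (Y : T1 -> R) : measurable_fun setT Y ->
  measurable_fun setT (fun w => u (Y w)).
Proof. exact: measurable_inv1Dsq. Qed.

Let bcos d1 (T1 : measurableType d1) (Y g : T1 -> R) (C t : R) w :
  (forall w, `|g w| <= C) -> `|g w * cos (t * Y w)| <= C.
Proof.
by move=> gC; rewrite normrM -[X in _ <= X]mulr1 ler_pM//; exact: normr_cos_le1.
Qed.

Let mcos d1 (T1 : measurableType d1) (Y g : T1 -> R) (t : R) :
  measurable_fun setT Y -> measurable_fun setT g ->
  measurable_fun setT (fun w => g w * cos (t * Y w)).
Proof.
move=> mY mg; apply: measurable_funM => //.
by apply: measurableT_comp; [exact: measurable_cos|exact: measurable_funM].
Qed.

Let prod_cos d1 (T1 : measurableType d1) (P1 : probability T1 R)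
    (Y g : T1 -> R) (C s t : R) :
  measurable_fun setT Y -> measurable_fun setT g -> (forall w, `|g w| <= C) ->
  \int[P1]_w (g w * cos (s * Y w) * cos (t * Y w)) =
  2^-1 * (\int[P1]_w (g w * cos ((s - t) * Y w)) + \int[P1]_w (g w * cos ((s + t) * Y w))).
Proof.
move=> mY mg gC.
have ib r : P1.-integrable setT (EFin \o (fun w => g w * cos (r * Y w))).
  by apply: (@integrable_bounded _ _ _ _ _ C); [exact: mcos | move=> w; exact: bcos].
rewrite -RintegralD// -RintegralZl//; last first.
  have := integrableD measurableT (ib (s - t)) (ib (s + t)).
  by apply: eq_integrable.
apply: eq_Rintegral => w _; rewrite mulrBl mulrDl cosB cosD; lra.
Qed.

(** [expo_fubini] writes the factor [u] as an exponential average of cosines, a product of two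
    cosines is a sum of cosines, and dominated convergence applies to the average over [t]. *)
Lemma cos_cvgMu g_ g : cos_cvg g_ g ->
  cos_cvg (fun n w => g_ n w * u (X_ n w)) (fun w => g w * u (X w)).
Proof.
move=> [mg_ mg [C [gC_ gC]] h]; split.
- by move=> n; apply: measurable_funM => //; exact: mu_.
- by apply: measurable_funM => //; exact: mu_.
- have ub x : `|u x| <= 1 by rewrite ger0_norm; have /andP[] := u01 x => // /ltW.
  by exists C; split => [n|] w; rewrite normrM -[X in _ <= X]mulr1 ler_pM.
move=> s.
have h_ n : \int[P_ n]_w (g_ n w * u (X_ n w) * cos (s * X_ n w)) =
    \int[lebesgue_measure]_t (exponential_pdf 1 t *
      \int[P_ n]_w (g_ n w * cos (s * X_ n w) * cos (t * X_ n w))).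
  rewrite -(expo_fubini (P_ n) (mX_ n) (mcos s (mX_ n) (mg_ n)) (fun w => bcos _ s w (gC_ n))).2.
  by apply: eq_Rintegral => w _; rewrite /u; ring.
have h0 : \int[P]_w (g w * u (X w) * cos (s * X w)) =
    \int[lebesgue_measure]_t (exponential_pdf 1 t *
      \int[P]_w (g w * cos (s * X w) * cos (t * X w))).
  rewrite -(expo_fubini P mX (mcos s mX mg) (fun w => bcos _ s w gC)).2.
  by apply: eq_Rintegral => w _; rewrite /u; ring.
rewrite h0; under eq_fun do rewrite h_.
apply: (@expo_dct _ _ _ C).
- by move=> n; exact: (expo_fubini (P_ n) (mX_ n) (mcos s (mX_ n) (mg_ n)) (fun w => bcos _ s w (gC_ n))).1.
- exact: (expo_fubini P mX (mcos s mX mg) (fun w => bcos _ s w gC)).1.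
- move=> n t; apply: Rintegral_bounded; first by do 2 apply: mcos => //.
  by move=> w; exact: (bcos _ t w (fun w => bcos _ s w (gC_ n))).
- move=> t _; rewrite (prod_cos P s t mX mg gC).
  under eq_fun do rewrite (prod_cos (P_ _) s t (mX_ _) (mg_ _) (gC_ _)).
  by apply: cvgMr; apply: cvgD; exact: h.
Qed.

Lemma cos_cvgB g_ g k_ k : cos_cvg g_ g -> cos_cvg k_ k ->
  cos_cvg (fun n w => g_ n w - k_ n w) (fun w => g w - k w).
Proof.
move=> [mg_ mg [C [gC_ gC]] h] [mk_ mk [D [kD_ kD]] h']; split.
- by move=> n; exact: measurable_funB.
- exact: measurable_funB.
- by exists (C + D); split => [n|] w; rewrite (le_trans (ler_normB _ _))// lerD.
move=> t.
have E d1 (T1 : measurableType d1) (P1 : probability T1 R) (Y g1 k1 : T1 -> R) :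
    measurable_fun setT Y -> measurable_fun setT g1 -> measurable_fun setT k1 ->
    (forall w, `|g1 w| <= C) -> (forall w, `|k1 w| <= D) ->
    \int[P1]_w ((g1 w - k1 w) * cos (t * Y w)) =
    \int[P1]_w (g1 w * cos (t * Y w)) - \int[P1]_w (k1 w * cos (t * Y w)).
  move=> mY mg1 mk1 gC1 kD1; rewrite -RintegralB//.
  - by apply: eq_Rintegral => w _; rewrite mulrBl.
  - by apply: (@integrable_bounded _ _ _ _ _ C); [exact: mcos | move=> w; exact: bcos].
  - by apply: (@integrable_bounded _ _ _ _ _ D); [exact: mcos | move=> w; exact: bcos].
rewrite (E _ _ P)//; under eq_fun do rewrite (E _ _ (P_ _))//.
by apply: cvgB; [exact: h|exact: h'].
Qed.

Lemma cos_cvgMstep g_ g N K : cos_cvg g_ g ->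
  cos_cvg (fun n w => g_ n w * (1 - u (X_ n w) ^+ N) ^+ K)
          (fun w => g w * (1 - u (X w) ^+ N) ^+ K).
Proof.
have hN g1_ g1 : cos_cvg g1_ g1 ->
    cos_cvg (fun n w => g1_ n w * u (X_ n w) ^+ N) (fun w => g1 w * u (X w) ^+ N).
  move=> hg; elim: N => [|N ih].
    by under [X in cos_cvg X]eq_fun do under eq_fun do rewrite expr0 mulr1;
       under [X in cos_cvg _ X]eq_fun do rewrite expr0 mulr1.
  have := cos_cvgMu ih.
  rewrite (_ : (fun n w => _) = (fun n w => g1_ n w * u (X_ n w) ^+ N.+1)); last first.
    by apply/funext => n; apply/funext => w; rewrite exprSr mulrA.
  by rewrite (_ : (fun w => _) = (fun w => g1 w * u (X w) ^+ N.+1))//;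
    apply/funext => w; rewrite exprSr mulrA.
move=> hg; elim: K => [|K ih].
  by under [X in cos_cvg X]eq_fun do under eq_fun do rewrite expr0 mulr1;
     under [X in cos_cvg _ X]eq_fun do rewrite expr0 mulr1.
have := cos_cvgB ih (hN _ _ ih).
rewrite (_ : (fun n w => _) = (fun n w => g_ n w * (1 - u (X_ n w) ^+ N) ^+ K.+1)); last first.
  by apply/funext => n; apply/funext => w; rewrite exprSr; ring.
by rewrite (_ : (fun w => _) = (fun w => g w * (1 - u (X w) ^+ N) ^+ K.+1))//;
  apply/funext => w; rewrite exprSr; ring.
Qed.

End CosineConvergence.

Section Sandwich.
Context {R : realType}.

Lemma Rintegral_indic d (T : measurableType d) (P : probability T R) (A : set T) :
  measurable A -> \int[P]_w \1_A w = fine (P A).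
Proof. by move=> mA; rewrite /Rintegral integral_indic// setIT. Qed.

Lemma integrable_indic_prob d (T : measurableType d) (P : probability T R) (A : set T) :
  measurable A -> P.-integrable setT (EFin \o \1_A).
Proof.
move=> mA; apply: (@integrable_bounded _ _ _ _ _ 1); first exact: measurable_indic.
by move=> w; rewrite indicE; case: (w \in A); rewrite ?normr1 ?normr0.
Qed.

Lemma Rintegral_prob_cst d (T : measurableType d) (P : probability T R) (r : R) :
  \int[P]_w r = r.
Proof.
by rewrite (@Rintegral_cst _ _ _ P setT)// [X in fine X](@probability_setT _ _ _ P) mulr1.
Qed.

Lemma measurable_norm_le d (T : measurableType d) (X : T -> R) (a : R) :
  measurable_fun setT X -> measurable [set w | `|X w| <= a].
Proof.
move=> mX.
have := (measurableT_comp (@normr_measurable R setT) mX) measurableT _ (measurable_itv `]-oo, a]).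
rewrite setTI; congr measurable; apply/seteqP; split=> w /=; by rewrite in_itv.
Qed.

(** Here 1 - [q] is a smoothed indicator: up to [e] it lies above that of [A] and below that of
    [B]. *)
Lemma prob_le_integral d (T : measurableType d) (P : probability T R) (A B : set T)
    (q : T -> R) (e : R) :
  measurable A -> measurable B -> measurable_fun setT q -> (forall w, `|q w| <= 1) ->
  (forall w, A w -> q w <= e) -> (forall w, ~ B w -> 1 - e <= q w) -> 0 <= e ->
  (forall w, 0 <= q w) ->
  fine (P A) <= 1 - \int[P]_w q w + e /\ 1 - \int[P]_w q w <= fine (P B) + e.
Proof.
move=> mA mB mq q1 qA qB e0 q0.
have iq : P.-integrable setT (EFin \o q) by exact: integrable_bounded q1.
have ic r : P.-integrable setT (EFin \o (cst r : T -> R)).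
  exact: (@integrable_bounded _ _ _ _ _ `|r|).
have i1q : P.-integrable setT (EFin \o (fun w => 1 - q w)).
  by have := integrableB measurableT (ic 1) iq; apply: eq_integrable.
have -> : 1 - \int[P]_w q w = \int[P]_w (1 - q w).
  by rewrite (@RintegralB _ _ _ _ _ (cst 1))// Rintegral_prob_cst.
rewrite -!Rintegral_indic//; split.
  rewrite -[e in leRHS](Rintegral_prob_cst P) -RintegralD//; last exact: ic.
  apply: le_Rintegral => //; first exact: integrable_indic_prob.
    by have := integrableD measurableT i1q (ic e); apply: eq_integrable.
  move=> w _; have := q1 w; rewrite ler_norml indicE => /andP[_ qw].
  by have [/set_mem/qA|_] := boolP (w \in A) => /=; lra.
rewrite -[e in leRHS](Rintegral_prob_cst P) -RintegralD//; last 2 first.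
  exact: integrable_indic_prob.
  exact: ic.
apply: le_Rintegral => //.
  by have := integrableD measurableT (integrable_indic_prob P mB) (ic e); apply: eq_integrable.
move=> w _; have := q0 w; rewrite indicE => qw.
have [_|/negP wB] := boolP (w \in B) => /=; first lra.
by have := qB w (fun h => wB (mem_set h)); lra.
Qed.

Context d (T : measurableType d) d' (T' : measurableType d').
Variables (P_ : nat -> probability T R) (P : probability T' R).
Variables (X_ : nat -> T -> R) (X : T' -> R).
Hypothesis mX_ : forall n, measurable_fun setT (X_ n).
Hypothesis mX : measurable_fun setT X.
Hypothesis hcos : forall t, \int[P_ n]_w cos (t * X_ n w) @[n --> \oo] -->
      \int[P]_w cos (t * X w).

(** Rescaling by some [m] in ]a, b[ puts the threshold u = 1/2 of the step polynomials at |x| = m. A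
    polynomial with a large exponent then separates |x| <= a from |x| > b, and its means converge
    because the cosine transforms do. *)
Lemma cos_cvg_sandwich (a b e : R) : 0 < a -> a < b -> 0 < e ->
  \forall n \near \oo,
    fine (P_ n [set w | `|X_ n w| <= a]) <= fine (P [set w | `|X w| <= b]) + e /\
    fine (P [set w | `|X w| <= a]) <= fine (P_ n [set w | `|X_ n w| <= b]) + e.
Proof.
move=> a0 ab e0.
have [m [m0 am mb]] : exists m, [/\ 0 < m, a < m & m < b].
  by exists ((a + b) / 2); split; lra.
pose u (x : R) := (1 + (x / m) ^+ 2)^-1.
have d0 x : 0 < 1 + (x / m) ^+ 2 by rewrite ltr_pwDl// sqr_ge0.
have u01 x : 0 < u x <= 1 by exact: inv1Dsq_bounds.
have ule x y : `|x| <= `|y| -> u y <= u x.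
  move=> xy; rewrite /u lef_pV2 ?posrE ?ltr_pwDl ?sqr_ge0// lerD2l.
  rewrite -(real_normK (num_real (x / m))) -(real_normK (num_real (y / m))).
  rewrite ler_pXn2r ?nnegrE// !normrM; apply: ler_pM => //.
have ua : 1 < 2 * u a.
  rewrite /u ltr_pdivlMr// mul1r.
  have h1 : a / m < 1 by rewrite ltr_pdivrMr// mul1r.
  have h0 : 0 <= a / m by rewrite divr_ge0// ltW.
  have h2 : (a / m) ^+ 2 < 1 by rewrite expr_lt1.
  lra.
have ub : 2 * u b < 1.
  rewrite /u ltr_pdivrMr// mul1r.
  have h1 : 1 < b / m by rewrite ltr_pdivlMr// mul1r.
  have : 1 < (b / m) ^+ 2 by rewrite expr_gt1// ltW// (lt_trans ltr01).
  by lra.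
have e3 : 0 < e / 3 by lra.
have [N [Na Nb]] : exists N, ((2 * u a) ^+ N)^-1 <= e / 3 /\ (2 * u b) ^+ N <= e / 3.
  have h1 : (2 * u a)^-1 ^+ n @[n --> \oo] --> (0 : R).
    apply: cvg_expr; rewrite ger0_norm ?invr_ge0; last lra.
    by rewrite invf_lt1//; lra.
  have h2 : (2 * u b) ^+ n @[n --> \oo] --> (0 : R).
    by apply: cvg_expr; rewrite ger0_norm//; have /andP[] := u01 b; lra.
  have [N _ hN] := filterI ((cvgr0Pnorm_le _).1 h1 _ e3) ((cvgr0Pnorm_le _).1 h2 _ e3).
  exists N; have [/= n1 n2] := hN N (leqnn N).
  by rewrite -exprVn; split; apply: le_trans (ler_norm _) _.
have c0 : cos_cvg P_ P (fun n w => X_ n w / m) (fun w => X w / m) (fun _ _ => 1) (fun _ => 1).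
  split => //; first by exists 1; split => *; rewrite normr1.
  move=> t.
  have E d1 (T1 : measurableType d1) (P1 : probability T1 R) (Y : T1 -> R) :
      \int[P1]_w (1 * cos (t * (Y w / m))) = \int[P1]_w cos (t / m * Y w).
    by apply: eq_Rintegral => w _; rewrite mul1r -mulrA [m^-1 * _]mulrC.
  by rewrite E; under eq_fun do rewrite E; exact: hcos.
(* At t = 0 the cosine factor is 1, which leaves the means of the step polynomial itself. *)
have [mq_ mq [C [_ _]] /(_ 0)] := cos_cvgMstep
  (fun n => measurable_funM (mX_ n) (measurable_cst m^-1)) (measurable_funM mX (measurable_cst m^-1))
  N (2 ^ N) c0.
rewrite -/(u _).
pose q x := (1 - u x ^+ N) ^+ (2 ^ N).
have simp d1 (T1 : measurableType d1) (P1 : probability T1 R) (Y : T1 -> R) :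
  \int[P1]_w (1 * (1 - (1 + (Y w / m) ^+ 2)^-1 ^+ N) ^+ (2 ^ N) * cos (0 * (Y w / m))) = \int[P1]_w q (Y w).
  by apply: eq_Rintegral => w _; rewrite mul0r cos0 mul1r mulr1.
rewrite simp; under eq_fun do rewrite simp.
move=> hq.
have q01 x : 0 <= q x <= 1.
  have /andP[h1 h2] := u01 x.
  have u1 : u x ^+ N <= 1 by rewrite exprn_ile1// ltW.
  have u0 : 0 <= u x ^+ N by rewrite exprn_ge0// ltW.
  by rewrite /q exprn_ge0 ?exprn_ile1//; lra.
have qb x : `|q x| <= 1 by have /andP[h1 h2] := q01 x; rewrite ger0_norm.
have qa x : `|x| <= a -> q x <= e / 3.
  move=> xa; have ux : u a <= u x by apply: ule; rewrite (gtr0_norm a0).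
  apply: le_trans (step_poly_le _ (u01 x)) _; apply: le_trans Na.
  rewrite lef_pV2 ?posrE ?exprn_gt0//; try lra.
  by rewrite lerXn2r ?nnegrE//; lra.
have qB x : ~ `|x| <= b -> 1 - e / 3 <= q x.
  move=> /negP; rewrite -ltNge => bx.
  have /andP[h1 h2] := u01 x.
  have ux : u x <= u b by apply: ule; rewrite gtr0_norm ?(ltW bx)// (lt_trans a0).
  apply: le_trans (step_poly_ge _ _); last by rewrite h2 ltW.
  rewrite lerB// (le_trans _ Nb)// lerXn2r ?nnegrE//; lra.
have mqX n : measurable_fun setT (fun w => q (X_ n w)).
  by have := mq_ n; under eq_fun do rewrite mul1r.
have mqX' : measurable_fun setT (fun w => q (X w)).
  by move: mq; under eq_fun do rewrite mul1r.
have [h1 h2] := prob_le_integral P (measurable_norm_le a mX) (measurable_norm_le b mX) mqX'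
  (fun w => qb _) (fun w => @qa _) (fun w => @qB _) (ltW e3) (fun w => (andP (q01 _)).1).
near=> n.
have [h3 h4] := prob_le_integral (P_ n) (measurable_norm_le a (mX_ n)) (measurable_norm_le b (mX_ n)) (mqX n)
  (fun w => qb _) (fun w => @qa _) (fun w => @qB _) (ltW e3) (fun w => (andP (q01 _)).1).
have : `|\int[P]_w q (X w) - \int[P_ n]_w q (X_ n w)| <= e / 3.
  by near: n; apply: (cvgrPdist_le _ _).1 hq _ e3.
by rewrite ler_norml => /andP[h5 h6]; split; lra.
Unshelve. all: by end_near. Qed.

Lemma cos_cvg_prob_le (a : R) : 0 < a -> P [set w | `|X w| = a] = 0%E ->
  fine (P_ n [set w | `|X_ n w| <= a]) @[n --> \oo] --> fine (P [set w | `|X w| <= a]).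
Proof.
move=> a0 Pa.
(* These shells decrease to the null event |X| = a, so some shell has small mass; the sandwich is
   then used on both sides of [a]. *)
pose F n := [set w | `|X w| <= a + n.+1%:R^-1] `\` [set w | `|X w| <= a - n.+1%:R^-1].
have mF n : measurable (F n) by apply: measurableD; exact: measurable_norm_le.
have F0 : P (F n) @[n --> \oo] --> (0 : \bar R)%E.
  have capF : \bigcap_n F n = [set w | `|X w| = a].
    apply/seteqP; split => w /=; last first.
      move=> wa n _; split => /=; rewrite wa; first by rewrite lerDl.
      by apply/negP; rewrite -ltNge ltrBlDr ltrDl.
    move=> h; apply: contrapT => /eqP; rewrite neq_lt => /orP[|] /ltr_add_invr[n] hn.
      have [_ /=] := h n I; apply.
      by rewrite lerBrDr ltW.
    by have [/= + _] := h n I; rewrite leNgt hn.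
  rewrite -Pa -capF.
  apply: nonincreasing_cvg_mu => //.
  - by rewrite -ge0_fin_numE// fin_num_measure.
  - exact: bigcap_measurable.
  - move=> i j ij; apply/subsetPset => w [/= h1 h2]; split => /=.
      by rewrite (le_trans h1)// lerD2l lef_pV2 ?posrE ?ltr0n// ler_nat !ltnS.
    apply: contra_not h2 => h2; rewrite (le_trans h2)// lerB//.
    by rewrite lef_pV2 ?posrE ?ltr0n// ler_nat !ltnS.
apply/cvgrPdist_le => e e0.
have e2 : 0 < e / 2 by lra.
have hF : \forall n \near \oo, fine (P (F n)) <= e / 2.
  have := (cvgr0Pnorm_le _).1 (fine_cvg F0) _ e2.
  move=> H; near=> n; apply: le_trans (ler_norm _) _; near: n; exact: H.
have h0 : \forall n \near \oo, n.+1%:R^-1 < a.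
  by near=> n; near: n; apply: near_infty_natSinv_lt (PosNum a0).
have [n _ hn] := filterI hF h0.
have [/= {}hF {}h0] := hn n (leqnn n).
have n0 : 0 < n.+1%:R^-1 :> R by rewrite invr_gt0.
have a'0 : 0 < a - n.+1%:R^-1 by rewrite subr_gt0.
set b := a + n.+1%:R^-1 in hF.
set a' := a - n.+1%:R^-1 in a'0.
have aa' : a' < a by rewrite /a' gtrBl.
have ab : a < b by rewrite /b ltrDl.
have Fab : fine (P [set w | `|X w| <= b]) <= fine (P [set w | `|X w| <= a']) + e / 2.
  rewrite (measureDI P (measurable_norm_le b mX) (measurable_norm_le a' mX)).
  rewrite fineD ?fin_num_measure//; last 2 first.
  - by apply: measurableD; exact: measurable_norm_le.
  - by apply: measurableI; exact: measurable_norm_le.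
  rewrite addrC lerD// fine_le ?fin_num_measure//.
  - by apply: measurableI; exact: measurable_norm_le.
  - exact: measurable_norm_le.
  - apply: le_measure; rewrite ?inE; last exact: subIsetr.
      by apply: measurableI; exact: measurable_norm_le.
    exact: measurable_norm_le.
have mono x y : x <= y -> fine (P [set w | `|X w| <= x]) <= fine (P [set w | `|X w| <= y]).
  move=> xy; rewrite fine_le ?fin_num_measure//; try exact: measurable_norm_le.
  apply: le_measure; rewrite ?inE; try exact: measurable_norm_le.
  by move=> w /= /le_trans; apply.
have m1 := mono _ _ (ltW aa'); have m2 := mono _ _ (ltW ab).
near=> k.
have [h1 _] : fine (P_ k [set w | `|X_ k w| <= a]) <= fine (P [set w | `|X w| <= b]) + e / 2 /\
    fine (P [set w | `|X w| <= a]) <= fine (P_ k [set w | `|X_ k w| <= b]) + e / 2.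
  by near: k; exact: cos_cvg_sandwich.
have [_ h2] : fine (P_ k [set w | `|X_ k w| <= a']) <= fine (P [set w | `|X w| <= a]) + e / 2 /\
    fine (P [set w | `|X w| <= a']) <= fine (P_ k [set w | `|X_ k w| <= a]) + e / 2.
  by near: k; exact: cos_cvg_sandwich.
by rewrite ler_norml; apply/andP; split; lra.
Unshelve. all: by end_near. Qed.

End Sandwich.

(** The indicator of Z = 0 is at most 1 / (1 + (n Z)^2), whose mean is an exponential average of
    cosine transforms of n Z and tends to 0. *)
Lemma no_atom_of_cos_cvg0 {R : realType} d (T : measurableType d)
    (P : probability T R) (Z : T -> R) :
  measurable_fun setT Z ->
  (forall t, t != 0 -> \int[P]_w cos (t * (n%:R * Z w)) @[n --> \oo] --> 0) ->
  P [set w | Z w = 0] = 0%E.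
Proof.
move=> mZ h.
have m0 : measurable [set w | Z w = 0].
  have := mZ measurableT _ (measurable_set1 0).
  by rewrite setTI.
have mnZ n : measurable_fun setT (fun w => n%:R * Z w) by exact: measurable_funM.
have b1 (w : T) : `|cst (1 : R) w| <= 1 by rewrite normr1.
have E n : \int[P]_w (1 * (1 + (n%:R * Z w) ^+ 2)^-1) =
    \int[lebesgue_measure]_t (exponential_pdf 1 t * \int[P]_w (1 * cos (t * (n%:R * Z w)))).
  exact: (expo_fubini P (mnZ n) (@measurable_cst _ _ _ _ setT (1 : R)) b1).2.
have mc n : measurable_fun setT (fun t : R => \int[P]_w (1 * cos (t * (n%:R * Z w)))).
  exact: (expo_fubini P (mnZ n) (@measurable_cst _ _ _ _ setT (1 : R)) b1).1.
have D : \int[lebesgue_measure]_t (exponential_pdf 1 t * \int[P]_w (1 * cos (t * (n%:R * Z w))))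
    @[n --> \oo] --> \int[lebesgue_measure]_t (exponential_pdf (1 : R) t * 0).
  apply: (@expo_dct _ _ (cst 0) 1) => //.
  - move=> n t; apply: Rintegral_bounded.
      apply: measurable_funM => //; apply: measurableT_comp; first exact: measurable_cos.
      exact: measurable_funM.
    by move=> w; rewrite mul1r; exact: normr_cos_le1.
  - move=> t t0; under eq_fun do under eq_Rintegral do rewrite mul1r.
    exact: h.
have z0 : \int[lebesgue_measure]_t (exponential_pdf (1 : R) t * 0) = 0.
  by under eq_Rintegral do rewrite mulr0; rewrite Rintegral_cst// mul0r.
rewrite z0 in D.
rewrite -[LHS]fineK ?fin_num_measure//; congr (_%:E); apply/eqP; rewrite eq_le fine_ge0// andbT.
apply: (@cvgr_to_ge _ _ _ _ _ _ _ D); apply: nearW => n.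
rewrite -E -Rintegral_indic//; apply: le_Rintegral => //.
- exact: integrable_indic_prob.
- apply: (@integrable_bounded _ _ _ _ _ 1).
    by under eq_fun do rewrite mul1r; exact: measurable_inv1Dsq.
  move=> w; have /andP[u0 u1] := inv1Dsq_bounds (n%:R * Z w).
  by rewrite mul1r gtr0_norm.
- move=> w _; rewrite mul1r indicE; have [/set_mem/= ->|_] := boolP (_ \in _).
    by rewrite mulr0 expr0n addr0 invr1.
  by have /andP[/ltW] := inv1Dsq_bounds (n%:R * Z w).
Qed.

(** * Integration by parts against a tail *)

Section PowerIntegrability.
Context {R : realType}.
Notation leb := (@lebesgue_measure R).

Lemma integrable_powRN (b : R) : b < 1 ->
  leb.-integrable `]0, 1] (EFin \o (fun s => s `^ (- b))).
Proof.
move=> b1.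
have m0 : measurable_fun `](0 : R), 1] (EFin \o (fun s : R => s `^ (- b))).
  by apply/measurable_EFinP; apply: measurable_funTS; exact: measurable_powR.
apply/integrableP; split => //.
(* With n + 2 instead of n + 1 the interval is nondegenerate already for n = 0. *)
pose F (n : nat) := `[n.+2%:R^-1, (1 : R)]%classic.
have UF : (`](0 : R), 1] = \bigcup_n F n :> set R)%classic.
  apply/seteqP; split => x /=; last first.
    move=> [n _]; rewrite /F /= !in_itv /= => /andP[h ->]; rewrite andbT.
    by rewrite (lt_le_trans _ h)// invr_gt0.
  rewrite in_itv /= => /andP[x0 x1].
  have [n hn] := ltr_add_invr x0; exists n => //; rewrite /F /= in_itv /= x1 andbT.
  apply: ltW; apply: le_lt_trans hn; rewrite add0r lef_pV2 ?posrE ?ltr0n//.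
  by rewrite ler_nat.
have ndF : nondecreasing_seq F.
  move=> m n mn; apply/subsetPset => x; rewrite /F /= !in_itv /= => /andP[h ->].
  by rewrite andbT (le_trans _ h)// lef_pV2 ?posrE ?ltr0n// ler_nat !ltnS.
have mF n : measurable (F n) by exact: measurable_itv.
have hF n : (\int[leb]_(x in F n) `|(x `^ (- b))%:E| = ((1 - n.+2%:R^-1 `^ (1 - b)) / (1 - b))%:E)%E.
  have n1 : n.+2%:R^-1 < 1 :> R by rewrite invf_lt1// ltr1n.
  have n0 : 0 < n.+2%:R^-1 :> R by rewrite invr_gt0.
  pose G (s : R) := (1 - b)^-1 * s `^ (1 - b).
  have dG (s : R) : 0 < s -> is_derive s 1 G (s `^ (- b)).
    move=> s0; have := is_deriveZ (1 - b)^-1 (is_derive1_powR (1 - b) s0).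
    move/is_derive_eq; apply; rewrite /GRing.scale /= mulrA mulVf ?mul1r; last by rewrite gt_eqF//; lra.
    by congr (_ `^ _); lra.
  have cG (s : R) : 0 < s -> {for s, continuous G}.
    by move=> /dG h; apply: differentiable_continuous; apply/derivable1_diffP; case: h.
  transitivity (\int[leb]_(x in F n) (x `^ (- b))%:E)%E.
    by apply: eq_integral => x _; rewrite /= ger0_norm// powR_ge0.
  rewrite (@continuous_FTC2 _ _ G)//.
  - by rewrite -EFinB; congr (_%:E); rewrite /G powR1 -mulrBr mulrC.
  - apply: continuous_in_subspaceT => s; rewrite inE /= in_itv /= => /andP[h _].
    have s0 : 0 < s by exact: lt_le_trans h.
    apply: differentiable_continuous; apply/derivable1_diffP.
    by case: (is_derive1_powR (- b) s0).
  - split.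
    + by move=> x; rewrite in_itv /= => /andP[h _]; case: (dG x (lt_trans n0 h)).
    + by apply: cvg_at_right_filter; exact: cG.
    + by apply: cvg_at_left_filter; exact: cG.
  - by move=> x; rewrite in_itv /= => /andP[h _]; rewrite derive1E; case: (dG x (lt_trans n0 h)).
have mf n : measurable_fun (F n) (fun s : R => `|(s `^ (- b))%:E|%E).
  apply: measurableT_comp => //; apply/measurable_EFinP; apply: measurable_funTS.
  exact: measurable_powR.
have h : (\int[leb]_(x in F i) `|(x `^ (- b))%:E| @[i --> \oo] -->
    \int[leb]_(x in \bigcup_i F i) `|(x `^ (- b))%:E|)%E.
  by apply: ge0_nondecreasing_set_cvg_integral => // i x _; exact: abse_ge0.
rewrite UF; apply: (@le_lt_trans _ _ ((1 - b)^-1)%:E); last by rewrite ltry.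
rewrite -(cvg_lim _ h)//; apply: lime_le; first by apply/cvg_ex; eexists; exact: h.
apply: nearW => n; rewrite hF lee_fin.
by rewrite ler_pdivrMr ?subr_gt0// mulVf ?gt_eqF ?subr_gt0// gerBl powR_ge0.
Qed.

Lemma integrable_expRN (a : R) : 0 < a ->
  leb.-integrable `]0, +oo[ (EFin \o (fun s => expR (- (a * s)))).
Proof.
move=> a0.
have h : leb.-integrable `]0, +oo[ (EFin \o (fun s => a^-1 * exponential_pdf a s)).
  apply: (@integrableS _ _ _ _ setT) => //.
  have := integrableZl measurableT a^-1 (integrable_exponential_pdf a0).
  by apply: eq_integrable => // t _ /=; rewrite EFinM.
move: h; apply: eq_integrable => //= s; rewrite inE /= in_itv /= andbT => s0.
by rewrite exponential_pdfE ?ltW// mulrA mulVf ?mul1r ?mulNr// gt_eqF.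
Qed.

Lemma integrable_expRN_powRN (a b : R) : 0 < a -> 0 <= b < 1 ->
  leb.-integrable `]0, +oo[ (EFin \o (fun s => expR (- (a * s)) * (1 + s `^ (- b)))).
Proof.
move=> a0 /andP[b0 b1].
have me : measurable_fun [set: R] (fun s : R => expR (- (a * s))).
  apply: measurableT_comp; first exact: measurable_expR.
  by apply: measurable_funN; exact: measurable_funM.
have mp : measurable_fun [set: R] (fun s : R => s `^ (- b)) by exact: measurable_powR.
pose p1 (s : R) := s `^ (- b) * \1_(`]0, 1]%classic) s.
have ip : leb.-integrable `]0, +oo[ (EFin \o p1).
  apply: (@integrableS _ _ _ _ setT) => //.
  have /integrable_mkcond h := integrable_powRN b1.
  have {}h := h (measurable_itv _).
  move: h; apply: eq_integrable => // s _ /=; rewrite patchE /p1 indicE.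
  by case: ifPn => _; rewrite ?mulr1 ?mulr0.
have i2 : leb.-integrable `]0, +oo[ (EFin \o (fun s => 2 * expR (- (a * s)) + p1 s)).
  have mI : measurable (`]0%R, +oo[%classic : set (measurableTypeR R)) by exact: measurable_itv.
  have := integrableD mI (integrableZl mI 2 (integrable_expRN a0)) ip.
  by apply: eq_integrable => // t _ /=; rewrite EFinD EFinM.
apply: (le_integrable _ _ _ i2) => //.
  apply/measurable_EFinP; apply: measurable_funTS.
  by apply: measurable_funM => //; exact: measurable_funD.
move=> s; rewrite /= in_itv /= andbT => s0; rewrite lee_fin.
have e0 := expR_gt0 (- (a * s)).
have e1 : expR (- (a * s)) <= 1 by rewrite expR_le1 oppr_le0 mulr_ge0 ?(ltW a0)// ltW.
have p0 : 0 <= s `^ (- b) by exact: powR_ge0.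
rewrite ger0_norm ?mulr_ge0 ?addr_ge0 ?(ltW e0)//.
rewrite ger0_norm; last by rewrite /p1 addr_ge0// mulr_ge0// ltW.
rewrite /p1 indicE; have [_|] := boolP (s \in _).
  rewrite mulr1 mulrDr mulr1 lerD//; first by lra.
  by rewrite -[leRHS]mul1r ler_wpM2r.
rewrite notin_setE /= in_itv /= s0 /= => /negP; rewrite -ltNge => s1.
rewrite mulr0 addr0 mulrC ler_wpM2r ?(ltW e0)//.
suff : s `^ (- b) <= 1 by lra.
by rewrite -(powRr0 s); apply: ler_powR; [exact: ltW|lra].
Qed.

(** Used as a factor, it keeps every integral over the whole line, where Fubini and dominated
    convergence are applied. *)
Definition pos (s : R) : R := (0 < s)%R%:R.

Lemma posE s : pos s = \1_(`](0 : R), +oo[%classic) s.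
Proof. by rewrite indicE mem_setE in_itv /= andbT. Qed.

Lemma measurable_pos : measurable_fun [set: R] pos.
Proof.
have -> : pos = \1_(`](0 : R), +oo[%classic) by apply/funext => s; exact: posE.
exact: measurable_indic.
Qed.

Lemma pos_ge0 s : 0 <= pos s. Proof. by rewrite /pos. Qed.

Lemma integrable_pos_dom (a b K : R) : 0 < a -> 0 <= b < 1 ->
  leb.-integrable setT (EFin \o (fun s => pos s * (K * (expR (- (a * s)) * (1 + s `^ (- b)))))).
Proof.
move=> a0 b01; have /integrable_mkcond h := integrable_expRN_powRN a0 b01.
have {}h := h (measurable_itv _).
have := integrableZl measurableT K h.
apply: eq_integrable => // s _ /=; rewrite patchE mem_setE in_itv /= andbT /pos.
by case: ifPn => _; [rewrite mul1r EFinM|rewrite mul0r mule0].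
Qed.

End PowerIntegrability.

(** * Integration by parts as an exchange of integrals *)

Section LayerCake.
Context {R : realType}.
Notation leb := (@lebesgue_measure R).
Context d (T : measurableType d) (mu : {sigma_finite_measure set T -> \bar R}).
Variables (Y : T -> R) (h : R -> R) (C b : R).
Hypothesis mY : measurable_fun setT Y.
Hypothesis hY : forall s, 0 < s -> mu [set w | s < Y w] = (h s)%:E.
Hypothesis b01 : 0 <= b < 1.
Hypothesis hD : forall s, 0 < s -> h s <= C * (1 + s `^ (- b)).

Let mtail s : measurable [set w | s < Y w].
Proof.
have := mY measurableT (measurable_itv `]s, +oo[).
by rewrite setTI; congr measurable; apply/seteqP; split => w /=; rewrite in_itv /= andbT.
Qed.

Let mk : measurable_fun setT (fun z : T * R => pos (Y z.1 - z.2)).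
Proof.
apply: measurableT_comp; first exact: measurable_pos.
apply: measurable_funB => //.
exact: measurableT_comp.
Qed.

Let intk s : (\int[mu]_w (pos (Y w - s)%R)%:E = mu [set w | (s < Y w)%R])%E.
Proof.
rewrite -[in RHS](setIT [set w | s < Y w]) -integral_indic//; apply: eq_integral => w _.
by rewrite /pos indicE subr_gt0 /= mem_setE.
Qed.

Let h0 s : 0 < s -> 0 <= h s.
Proof. by move=> s0; rewrite -lee_fin -hY. Qed.

Lemma measurable_tail : measurable_fun setT (fun s => pos s * h s).
Proof.
have m1 : measurable_fun setT (fun s : R => \int[mu]_w (pos (Y w - s)%R)%:E)%E.
  apply: (@measurable_fun_fubini_tonelli_G _ _ T R R mu (fun z => (pos (Y z.1 - z.2)%R)%:E)).
    exact/measurable_EFinP.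
  by move=> z; rewrite lee_fin pos_ge0.
have -> : (fun s => pos s * h s) =
    (fun s => pos s * fine (\int[mu]_w (pos (Y w - s)%R)%:E)%E).
  apply/funext => s; rewrite /pos; have [s0|_] := boolP (0 < s).
    by rewrite intk hY.
  by rewrite !mul0r.
by apply: measurable_funM; [exact: measurable_pos|exact: measurableT_comp].
Qed.

Variables (g g' : R -> R) (K a : R).
Hypothesis a0 : 0 < a.
Hypothesis mg' : measurable_fun setT g'.
Hypothesis g'K : forall s, 0 < s -> `|g' s| <= K * expR (- (a * s)).

Let C0 : 0 <= C.
Proof.
have := hD ltr01; have := h0 ltr01; rewrite powR1 => h1 h2.
by have := le_trans h1 h2; rewrite pmulr_lge0//; lra.
Qed.

Let K0 : 0 <= K.
Proof. by have := le_trans (normr_ge0 _) (g'K ltr01); rewrite pmulr_lge0// expR_gt0. Qed.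

Lemma layer_bound s : 0 < s ->
  `|g' s * h s| <= K * C * (expR (- (a * s)) * (1 + s `^ (- b))).
Proof.
move=> s0; rewrite normrM (ger0_norm (h0 s0)) mulrACA ler_pM//.
- exact: h0.
- exact: g'K.
- exact: hD.
Qed.

Let F (z : T * R) := (pos z.2 * g' z.2 * pos (Y z.1 - z.2)%R)%:E.

Let mF : measurable_fun setT F.
Proof.
apply/measurable_EFinP; apply: measurable_funM => //.
by apply: measurable_funM; apply: measurableT_comp => //; exact: measurable_pos.
Qed.

Let iD := integrable_pos_dom (K * C) a0 b01.

Let absF w s : (`|F (w, s)| = (pos s * `|g' s|)%:E * (pos (Y w - s)%R)%:E)%E.
Proof. by rewrite /F /= !normrM !(ger0_norm (pos_ge0 _)) EFinM. Qed.

Let intabsF s : (\int[mu]_w `|F (w, s)| = (pos s * (`|g' s| * h s))%:E)%E.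
Proof.
under eq_integral do rewrite absF.
rewrite ge0_integralZl//; last 3 first.
- apply/measurable_EFinP; apply: measurableT_comp; first exact: measurable_pos.
  exact: measurable_funB.
- by move=> w _; rewrite lee_fin pos_ge0.
- by rewrite lee_fin mulr_ge0 ?pos_ge0.
rewrite intk; have [s0|s0] := boolP (0 < s); last by rewrite /pos (negbTE s0) !mul0r mul0e.
by rewrite hY// -EFinM mulrA.
Qed.

Let iF : (mu \x leb)%E.-integrable setT F.
Proof.
apply/integrable21ltyP => //.
have [mD Dlty] := integrableP _ _ _ iD.
apply: le_lt_trans Dlty; apply: ge0_le_integral => //.
- by move=> s _; exact: integral_ge0.
- apply: (@measurable_fun_fubini_tonelli_G _ _ T R R mu (fun z => `|F z|%E)).
    exact: measurableT_comp.
  by move=> z; exact: abse_ge0.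
- exact: measurableT_comp.
move=> s _; rewrite intabsF /= lee_fin; apply: le_trans (ler_norm _).
have [s0|s0] := boolP (0 < s); last by rewrite /pos (negbTE s0) !mul0r.
apply: ler_wpM2l; first exact: pos_ge0.
by apply: le_trans (layer_bound s0); rewrite normrM (ger0_norm (h0 s0)).
Qed.

Let gg x := \int[leb]_s (pos s * g' s * pos (x - s)).

Let igg x : leb.-integrable setT (EFin \o (fun s => pos s * g' s * pos (x - s))).
Proof.
have iE := integrable_pos_dom K a0 (_ : 0 <= 0 < 1).
apply: (le_integrable measurableT _ _ (iE _)).
- apply/measurable_EFinP; apply: measurable_funM.
    by apply: measurable_funM => //; exact: measurable_pos.
  by apply: measurableT_comp; [exact: measurable_pos|exact: measurable_funB].
- move=> s _; rewrite /= lee_fin -!mulrA !normrM !(ger0_norm (pos_ge0 _)).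
  have [s0|s0] := boolP (0 < s); last by rewrite /pos (negbTE s0) !mul0r.
  apply: ler_wpM2l; first exact: pos_ge0.
  have n2 : `|1 + 1 : R| = 2 by rewrite ger0_norm.
  rewrite oppr0 powRr0 (ger0_norm K0) (ger0_norm (expR_ge0 _)) n2.
  apply: (@le_trans _ _ (`|g' s| * 1)).
    by apply: ler_wpM2l => //; rewrite /pos; case: (0 < _).
  rewrite mulr1 (le_trans (g'K s0))// ler_wpM2l// ler_peMr ?expR_ge0 ?ler1n//.
by rewrite lexx ltr01.
Qed.

(** [gg x] is the integral of [g'] over ]0, x[, so this is Fubini for g'(s) on the region 0 < s < Y.
    The measure may be infinite near Y = 0, as a Levy measure is; integrability comes from the tail
    bound s^-b with b < 1 at 0 and from the exponential decay of [g'] at infinity. *)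
Lemma layer_cake : mu.-integrable setT (EFin \o (gg \o Y)) /\
  \int[mu]_w gg (Y w) = \int[leb]_s (pos s * (g' s * h s)).
Proof.
have E1 w : (\int[leb]_s F (w, s) = (gg (Y w))%:E)%E.
  by rewrite /gg /Rintegral fineK//; apply: integrable_fin_num => //; exact: igg.
have E2 s : (\int[mu]_w F (w, s) = (pos s * (g' s * h s))%:E)%E.
  rewrite /F /=; have [s0|s0] := boolP (0 < s); last first.
    by under eq_integral do rewrite /pos (negbTE s0) !mul0r; rewrite integral0 /pos (negbTE s0) mul0r.
  under eq_integral do rewrite EFinM.
  rewrite integralZl//.
    by rewrite intk hY// -EFinM mulrA.
  apply/integrableP; split.
    apply/measurable_EFinP; apply: measurableT_comp; first exact: measurable_pos.
    exact: measurable_funB.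
  under eq_integral do rewrite gee0_abs ?lee_fin ?pos_ge0//.
  by rewrite intk hY// ltry.
split.
  have := integrable_fubini_F iF; apply: eq_integrable => // w _.
  by rewrite /fubini_F E1.
have := Fubini iF; under eq_integral do rewrite E1.
by under [in RHS]eq_integral do rewrite E2; rewrite /Rintegral => ->.
Qed.

End LayerCake.

Section LayerFTC.
Context {R : realType}.
Notation leb := (@lebesgue_measure R).

Lemma integral_pos_ftc (g g' : R -> R) (x : R) :
  (forall y : R, is_derive y 1 g (g' y)) -> continuous g' ->
  \int[leb]_s (pos s * g' s * pos (x - s)) = g (Num.max x 0) - g 0.
Proof.
move=> dg cg'.
have [x0|x0] := leP x 0.
  rewrite subrr (_ : (fun s => _) = cst 0) ?Rintegral_cst ?mul0r//.
  apply/funext => s; rewrite /pos subr_gt0; have [s0|_] := ltP 0 s; last by rewrite !mul0r.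
  by rewrite ltNge (le_trans x0 (ltW s0)) mulr0.
have cg (y : R) : {for y, continuous g}.
  by apply: differentiable_continuous; apply/derivable1_diffP; case: (dg y).
rewrite /Rintegral (_ : (\int[leb]_s _)%E = (\int[leb]_(s in `]0%R, x[) (g' s)%:E)%E); last first.
  rewrite [RHS]integral_mkcond; apply: eq_integral => s _; rewrite patchE mem_setE in_itv /=.
  by rewrite /pos subr_gt0; case: (0 < s); case: (s < x); rewrite /= ?mul0r ?mulr0 ?mul1r ?mulr1.
have mg' A : measurable_fun A g' by apply: measurable_funTS; exact: continuous_measurable_fun.
rewrite integral_itv_bndo_bndc; last exact/measurable_EFinP.
rewrite integral_itv_obnd_cbnd; last exact/measurable_EFinP.
rewrite (@continuous_FTC2 _ g' g 0 x)//.
- exact: continuous_subspaceT.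
- split.
  + by move=> y _; case: (dg y).
  + by apply: cvg_at_right_filter; exact: cg.
  + by apply: cvg_at_left_filter; exact: cg.
- by move=> y _; rewrite derive1E; case: (dg y).
Qed.

Lemma normr_cosB1_le (u : R) : `|cos u - 1| <= `|u|.
Proof.
have [u0|u0|->] := ltgtP u 0; last by rewrite cos0 subrr normr0.
- have [|c _ h] := @MVT _ cos (fun x => - sin x) _ _ u0 (fun x _ => is_derive_cos x).
    by apply: continuous_subspaceT => x; exact: continuous_cos.
  rewrite -normrN opprB; move: h; rewrite cos0 sub0r => ->.
  by rewrite normrM !normrN ler_piMl// normr_sin_le1.
- have [|c _ h] := @MVT _ cos (fun x => - sin x) _ _ u0 (fun x _ => is_derive_cos x).
    by apply: continuous_subspaceT => x; exact: continuous_cos.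
  move: h; rewrite cos0 subr0 => ->.
  by rewrite normrM !normrN ler_piMl// normr_sin_le1.
Qed.

Lemma normr_sin_le (u : R) : `|sin u| <= `|u|.
Proof.
have [u0|u0|->] := ltgtP u 0; last by rewrite sin0 normr0.
- have [|c _ h] := @MVT _ sin cos _ _ u0 (fun x _ => is_derive_sin x).
    by apply: continuous_subspaceT => x; exact: continuous_sin.
  rewrite -normrN; move: h; rewrite sin0 !sub0r => ->.
  by rewrite normrM normrN ler_piMl// normr_cos_le1.
- have [|c _ h] := @MVT _ sin cos _ _ u0 (fun x _ => is_derive_sin x).
    by apply: continuous_subspaceT => x; exact: continuous_sin.
  move: h; rewrite sin0 !subr0 => ->.
  by rewrite normrM ler_piMl// normr_cos_le1.
Qed.

(** Makes 1 - exp(-x) dominate cos (t x) - 1 and sin (t x) up to constants; its own integrability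
    comes from the layer-cake formula. *)
Lemma onem_expRN_ge (x : R) : 0 <= x -> Num.min x 1 <= 2 * (1 - expR (- x)).
Proof.
move=> x0; have e1 : expR (- x) <= (1 + x)^-1.
  rewrite expRN lef_pV2 ?posrE ?expR_gt0//; last by lra.
  exact: expR_ge1Dx.
suff : Num.min x 1 <= 2 * (1 - (1 + x)^-1) by lra.
have x1 : 0 < 1 + x by lra.
have -> : 1 - (1 + x)^-1 = x / (1 + x) by field; rewrite gt_eqF.
rewrite mulrA ler_pdivlMr//; have [h|h] := leP x 1; nra.
Qed.

Lemma normr_cosB1_le_expRN (t x : R) : 0 <= x ->
  `|cos (t * x) - 1| <= 2 * (2 + `|t|) * (1 - expR (- x)).
Proof.
move=> x0; have h := onem_expRN_ge x0.
have c1 : `|cos (t * x) - 1| <= 2.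
  by have := cos_geN1 (t * x); have := cos_le1 (t * x); rewrite ler_norml; lra.
have c2 : `|cos (t * x) - 1| <= `|t| * x.
  by rewrite (le_trans (normr_cosB1_le _))// normrM (ger0_norm x0).
have t0 := normr_ge0 t.
apply: (@le_trans _ _ ((2 + `|t|) * Num.min x 1)); last by nra.
by have [h'|h'] := leP x 1; nra.
Qed.

Lemma normr_sin_le_expRN (t x : R) : 0 <= x ->
  `|sin (t * x)| <= 2 * (2 + `|t|) * (1 - expR (- x)).
Proof.
move=> x0; have h := onem_expRN_ge x0.
have c1 := normr_sin_le1 (t * x).
have c2 : `|sin (t * x)| <= `|t| * x.
  by rewrite (le_trans (normr_sin_le _))// normrM (ger0_norm x0).
have t0 := normr_ge0 t.
apply: (@le_trans _ _ ((2 + `|t|) * Num.min x 1)); last by nra.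
by have [h'|h'] := leP x 1; nra.
Qed.

End LayerFTC.

(** * Convergence of Levy exponents *)

Section LevyFunctional.
Context {R : realType}.
Notation leb := (@lebesgue_measure R).

(* [I g] stands for the integral of [g] against a measure on the positive
   half-line with tail [H]; these are the only properties of it that the
   convergence of exponents uses. *)
Record levy_functional (I : (R -> R) -> R) (H : R -> R) : Prop := LevyFunctional {
  levy_tail_meas : measurable_fun setT (fun s => pos s * H s);
  levy_tail_ge0 : forall s, 0 < s -> 0 <= H s;
  levy_ftc : forall (g g' : R -> R) (K a : R), 0 < a ->
    (forall y : R, is_derive y 1 g (g' y)) -> continuous g' ->
    (forall s, 0 < s -> `|g' s| <= K * expR (- (a * s))) ->
    I (fun x => g x - g 0) = \int[leb]_s (pos s * (g' s * H s));
  levy_cos_damp : forall t a, 0 < a ->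
    `|I (fun x => cos (t * x) - 1) - I (fun x => expR (- (a * x)) * cos (t * x) - 1)|
      <= I (fun x => 1 - expR (- (a * x)));
  levy_sin_damp : forall t a, 0 < a ->
    `|I (fun x => sin (t * x)) - I (fun x => expR (- (a * x)) * sin (t * x))|
      <= I (fun x => 1 - expR (- (a * x)));
  levy_damp_cvg0 :
    I (fun x => 1 - expR (- (n.+1%:R^-1 * x))) @[n --> \oo] --> 0
}.

Section OfMeasure.
Context d (T : measurableType d) (mu : {sigma_finite_measure set T -> \bar R}).
Variables (Y : T -> R) (h : R -> R) (C b m : R).
Hypothesis mY : measurable_fun setT Y.
Hypothesis hY : forall s, 0 < s -> mu [set w | s < Y w] = (h s)%:E.
Hypothesis b01 : 0 <= b < 1.
Hypothesis hD : forall s, 0 < s -> h s <= C * (1 + s `^ (- b)).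
Hypothesis m0 : 0 <= m.

Let Yp w := Num.max (Y w) 0.

Let mYp : measurable_fun setT Yp.
Proof. exact: measurable_maxr. Qed.

Let Yp0 w : 0 <= Yp w. Proof. by rewrite /Yp le_max lexx orbT. Qed.

Let ftc (g g' : R -> R) (K a : R) : 0 < a ->
    (forall y : R, is_derive y 1 g (g' y)) -> continuous g' ->
    (forall s, 0 < s -> `|g' s| <= K * expR (- (a * s))) ->
  mu.-integrable setT (EFin \o (fun w => g (Yp w) - g 0)) /\
  \int[mu]_w (g (Yp w) - g 0) = \int[leb]_s (pos s * (g' s * h s)).
Proof.
move=> a0 dg cg' g'K.
have mg' : measurable_fun setT g' by exact: continuous_measurable_fun.
have [i1 i2] := layer_cake mY hY b01 hD a0 mg' g'K.
split.
  move: i1; apply: eq_integrable => // w _.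
  by rewrite /= (integral_pos_ftc (Y w) dg cg').
rewrite -i2; apply: eq_Rintegral => w _.
by rewrite (integral_pos_ftc (Y w) dg cg').
Qed.

Let cEc (a t : R) : continuous (fun s : R => - expR (- (a * s)) * (a * cos (t * s) + t * sin (t * s))).
Proof.
move=> s; apply: differentiable_continuous; apply/derivable1_diffP.
have := is_deriveM (is_deriveN (is_derive_expRNM a s))
  (is_deriveD (is_deriveZ a (is_derive_cosM t s)) (is_deriveZ t (is_derive_sinM t s))).
by case.
Qed.

Let damp_i (a : R) : 0 < a ->
  mu.-integrable setT (EFin \o (fun w => 1 - expR (- (a * Yp w)))).
Proof.
move=> a0.
have [|||i1 _] := @ftc (fun s => expR (- (a * s))) (fun s => - a * expR (- (a * s))) a a a0.
- by move=> y; exact: is_derive_expRNM.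
- move=> s; apply: differentiable_continuous; apply/derivable1_diffP.
  by case: (is_deriveZ (- a) (is_derive_expRNM a s)).
- by move=> s s0; rewrite normrM normrN (gtr0_norm a0) (ger0_norm (expR_ge0 _)).
have := integrableN i1; apply: eq_integrable => // w _ /=.
by rewrite mulr0 oppr0 expR0 opprB.
Qed.

Let meas_comp (g : R -> R) : continuous g -> measurable_fun setT (fun w => g (Yp w)).
Proof. by move=> cg; apply: measurableT_comp => //; exact: continuous_measurable_fun. Qed.

Let ccos (t : R) : continuous (fun x : R => cos (t * x)).
Proof.
move=> s; apply: differentiable_continuous; apply/derivable1_diffP.
by case: (is_derive_cosM t s).
Qed.

Let csin (t : R) : continuous (fun x : R => sin (t * x)).
Proof.
move=> s; apply: differentiable_continuous; apply/derivable1_diffP.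
by case: (is_derive_sinM t s).
Qed.

Let cexp (a : R) : continuous (fun x : R => expR (- (a * x))).
Proof.
move=> s; apply: differentiable_continuous; apply/derivable1_diffP.
by case: (is_derive_expRNM a s).
Qed.

Let dom_i (g : R -> R) (K : R) : continuous g ->
  (forall x, 0 <= x -> `|g x| <= K * (1 - expR (- x))) ->
  mu.-integrable setT (EFin \o (fun w => g (Yp w))).
Proof.
move=> cg gK.
have i1 : mu.-integrable setT (EFin \o (fun w => K * (1 - expR (- (1 * Yp w))))).
  have := integrableZl measurableT K (damp_i (@ltr01 R)).
  by apply: eq_integrable => // w _ /=; rewrite EFinM.
apply: (le_integrable measurableT _ _ i1).
  by apply/measurable_EFinP; exact: meas_comp.
move=> w _; rewrite /= lee_fin mul1r (le_trans (gK _ (Yp0 w)))//.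
exact: ler_norm.
Qed.

Let cos_i t : mu.-integrable setT (EFin \o (fun w => cos (t * Yp w) - 1)).
Proof.
apply: (@dom_i (fun x => cos (t * x) - 1) (2 * (2 + `|t|))).
  by move=> x; apply: cvgB; [exact: ccos|exact: cvg_cst].
by move=> x; exact: normr_cosB1_le_expRN.
Qed.

Lemma levy_cos_integrable (t : R) :
  mu.-integrable setT (EFin \o (fun w => cos (t * Num.max (Y w) 0) - 1)).
Proof. exact: cos_i. Qed.

Let sin_i t : mu.-integrable setT (EFin \o (fun w => sin (t * Yp w))).
Proof.
by apply: (@dom_i (fun x => sin (t * x)) (2 * (2 + `|t|))) => // x; exact: normr_sin_le_expRN.
Qed.

Let e01 (a x : R) : 0 < a -> 0 <= x -> 0 <= 1 - expR (- (a * x)).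
Proof. by move=> a0 x0; rewrite subr_ge0 expR_le1 oppr_le0 mulr_ge0// ltW. Qed.

Let damped_i (g : R -> R) a : 0 < a -> continuous g -> (forall x, `|g x| <= 1) ->
  mu.-integrable setT (EFin \o (fun w => g (Yp w) * (1 - expR (- (a * Yp w))))).
Proof.
move=> a0 cg g1; apply: (le_integrable measurableT _ _ (damp_i a0)).
  apply/measurable_EFinP; apply: measurable_funM; first exact: meas_comp.
  by apply: (meas_comp (g := fun x => 1 - expR (- (a * x)))) => x; apply: cvgB; [exact: cvg_cst|exact: cexp].
move=> w _; rewrite /= lee_fin normrM [leRHS]ger0_norm ?e01//.
by rewrite (ger0_norm (e01 a0 (Yp0 w))) ler_piMl// e01.
Qed.

Let damped_le (g : R -> R) a : 0 < a -> continuous g -> (forall x, `|g x| <= 1) ->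
  `|\int[mu]_w (g (Yp w) * (1 - expR (- (a * Yp w))))| <= \int[mu]_w (1 - expR (- (a * Yp w))).
Proof.
move=> a0 cg g1; have ig := damped_i a0 cg g1.
apply: le_trans (le_normr_Rintegral measurableT ig) _.
apply: le_Rintegral => //; [exact: integrable_abse ig|exact: damp_i|].
by move=> w _; rewrite normrM (ger0_norm (e01 a0 (Yp0 w))) ler_piMl// e01.
Qed.

(** One statement serves both a Levy measure, with m = 1, and [m] times the law of a scaled return
    time. In the damping bounds the difference of the two integrands is g (1 - exp(-a x)) with |g|
    <= 1. *)
Lemma levy_functional_measure :
  levy_functional (fun g => m * \int[mu]_w (g (Num.max (Y w) 0))) (fun s => m * h s).
Proof.
split.
- under eq_fun do rewrite mulrCA.
  by apply: measurable_funM => //; exact: (measurable_tail mY hY).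
- by move=> s s0; rewrite mulr_ge0// -lee_fin -hY.
- move=> g g' K a a0 dg cg' g'K; have [_ ->] := ftc a0 dg cg' g'K.
  have [iK _] : leb.-integrable setT (EFin \o (fun s => pos s * (g' s * h s))) /\ True.
    split=> //.
    have iD := integrable_pos_dom (K * C) a0 b01.
    apply: (le_integrable measurableT _ _ iD).
      apply/measurable_EFinP; under eq_fun do rewrite mulrCA.
      by apply: measurable_funM; [exact: continuous_measurable_fun|exact: (measurable_tail mY hY)].
    move=> s _; rewrite /= lee_fin normrM (ger0_norm (pos_ge0 _)).
    have [s0|s0] := boolP (0 < s); last by rewrite /pos (negbTE s0) !mul0r normr0.
    rewrite [leRHS]normrM (ger0_norm (pos_ge0 s)); apply: ler_wpM2l; first exact: pos_ge0.
    by apply: le_trans (layer_bound hY hD g'K s0) (ler_norm _).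
  rewrite -RintegralZl//; apply: eq_Rintegral => s _; ring.
- move=> t a a0; rewrite -mulrBr -RintegralB//; last first.
    have := integrableB measurableT (cos_i t) (damped_i a0 (@ccos t) (fun x => normr_cos_le1 _)).
    by apply: eq_integrable => // w _ /=; rewrite -/(Yp w) -EFinB; congr (_%:E); ring.
  rewrite normrM (ger0_norm m0) ler_wpM2l//.
  apply: le_trans (damped_le a0 (@ccos t) (fun x => normr_cos_le1 _)).
  by rewrite le_eqVlt; apply/orP; left; apply/eqP; congr (`|_|); apply: eq_Rintegral => w _; rewrite -/(Yp w); ring.
- move=> t a a0; rewrite -mulrBr -RintegralB//; last first.
    have := integrableB measurableT (sin_i t) (damped_i a0 (@csin t) (fun x => normr_sin_le1 _)).
    by apply: eq_integrable => // w _ /=; rewrite -/(Yp w) -EFinB; congr (_%:E); ring.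
  rewrite normrM (ger0_norm m0) ler_wpM2l//.
  apply: le_trans (damped_le a0 (@csin t) (fun x => normr_sin_le1 _)).
  by rewrite le_eqVlt; apply/orP; left; apply/eqP; congr (`|_|); apply: eq_Rintegral => w _; rewrite -/(Yp w); ring.
- rewrite -[X in _ --> X](mulr0 m); apply: cvgMr.
  have [|||||i _ H] := @dominated_convergence _ _ _ mu setT measurableT
    (fun n w => (1 - expR (- (n.+1%:R^-1 * Yp w)))%:E) (cst 0%E)
    (EFin \o (fun w => 1 - expR (- (1 * Yp w)))).
  + move=> n; apply/measurable_EFinP.
    by apply: (meas_comp (g := fun x => 1 - expR (- (n.+1%:R^-1 * x)))) => x; apply: cvgB; [exact: cvg_cst|exact: cexp].
  + exact: measurable_cst.
  + apply: aeW => w _; apply/fine_cvgP; split; first exact: nearW.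
    suff : (1 - expR (- (n.+1%:R^-1 * Yp w))) @[n --> \oo] --> 1 - expR (- (0 * Yp w)).
      by rewrite mul0r oppr0 expR0 subrr.
    apply: cvgB; first exact: cvg_cst.
    apply: continuous_cvg; first exact: continuous_expR.
    apply: cvgN; apply: cvgMl; exact: cvg_harmonic.
  + exact: damp_i.
  + apply: aeW => w n _; rewrite /= lee_fin ger0_norm ?e01//.
    rewrite lerB// ler_expR lerN2 ler_wpM2r//.
    by rewrite invf_le1// ler1n.
  have : fine (\int[mu]_w (1 - expR (- (n.+1%:R^-1 * Yp w)))%:E)%E @[n --> \oo] --> fine 0.
    apply: fine_cvg; move: H; rewrite integral0; exact.
  exact.
Qed.

End OfMeasure.

Section Convergence.
Variables (I_ : nat -> (R -> R) -> R) (H_ : nat -> R -> R) (I : (R -> R) -> R) (H : R -> R).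
Variables (C b : R) (N : set R).
Hypothesis LI_ : forall n, levy_functional (I_ n) (H_ n).
Hypothesis LI : levy_functional I H.
Hypothesis b01 : 0 <= b < 1.
Hypothesis H_D : forall n s, 0 < s -> H_ n s <= C * (1 + s `^ (- b)).
Hypothesis N0 : countable N.
Hypothesis H_H : forall s, 0 < s -> ~ N s -> H_ n s @[n --> \oo] --> H s.

Let cvg_ftc (g g' : R -> R) (K a : R) : 0 < a ->
    (forall y : R, is_derive y 1 g (g' y)) -> continuous g' ->
    (forall s, 0 < s -> `|g' s| <= K * expR (- (a * s))) ->
  I_ n (fun x => g x - g 0) @[n --> \oo] --> I (fun x => g x - g 0).
Proof.
move=> a0 dg cg' g'K.
rewrite (levy_ftc LI a0 dg cg' g'K).
under eq_fun do rewrite (levy_ftc (LI_ _) a0 dg cg' g'K).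
have mg' : measurable_fun setT g' by exact: continuous_measurable_fun.
have [|||||i _ h] := @dominated_convergence _ _ _ leb setT measurableT
    (fun n s => (pos s * (g' s * H_ n s))%:E) (fun s => (pos s * (g' s * H s))%:E)
    (EFin \o (fun s => pos s * (K * C * (expR (- (a * s)) * (1 + s `^ (- b)))))).
- move=> n; apply/measurable_EFinP; under eq_fun do rewrite mulrCA.
  apply: measurable_funM => //; exact: levy_tail_meas (LI_ n).
- apply/measurable_EFinP; under eq_fun do rewrite mulrCA.
  apply: measurable_funM => //; exact: levy_tail_meas LI.
- exists N; split; [exact: countable_measurable|exact: countable_lebesgue_measure0|].
  move=> s /= hs; apply: contrapT => Ns; apply: hs => _.
  apply/fine_cvgP; split; [exact: nearW|].
  have [s0|s0] := boolP (0 < s).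
    by apply: cvgMr; apply: cvgMr; exact: H_H.
  by rewrite /pos (negbTE s0) /= mul0r; under eq_fun do rewrite /= mul0r; exact: cvg_cst.
- exact: integrable_pos_dom.
- apply: aeW => s n _; rewrite lee_fin normrM (ger0_norm (pos_ge0 s)).
  have [s0|s0] := boolP (0 < s); last by rewrite /pos (negbTE s0) !mul0r.
  apply: ler_wpM2l; first exact: pos_ge0.
  rewrite normrM (ger0_norm (levy_tail_ge0 (LI_ n) s0)) mulrACA ler_pM//.
  + exact: levy_tail_ge0 (LI_ n) _ s0.
  + exact: g'K.
  + exact: H_D.
apply: fine_cvg; move: h; rewrite fineK//.
exact: integrable_fin_num i.
Qed.

Let damp_cvg (a : R) : 0 < a ->
  I_ n (fun x => 1 - expR (- (a * x))) @[n --> \oo] --> I (fun x => 1 - expR (- (a * x))).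
Proof.
move=> a0.
have E : (fun x : R => 1 - expR (- (a * x))) = (fun x => (- expR (- (a * x))) - (- expR (- (a * 0)))).
  by apply/funext => x; rewrite mulr0 oppr0 expR0 opprK addrC.
rewrite E; apply: (@cvg_ftc (fun x => - expR (- (a * x))) (fun s => a * expR (- (a * s))) a a) => //.
- move=> y; have := is_deriveN (is_derive_expRNM a y).
  by move/is_derive_eq; apply; rewrite mulNr opprK.
- move=> s; apply: differentiable_continuous; apply/derivable1_diffP.
  by case: (is_deriveZ a (is_derive_expRNM a s)).
- by move=> s s0; rewrite normrM (gtr0_norm a0) (ger0_norm (expR_ge0 _)).
Qed.

(** The rate [a] is chosen from the limit functional alone. For this fixed [a] the damping error of
    [I_ n] converges to that of [I], so it is eventually small as well; this supplies the uniformity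
    in n. *)
Let cvg_damped (g : R -> R) (ga : R -> R -> R) :
  (forall n a, 0 < a -> `|I_ n g - I_ n (ga a)| <= I_ n (fun x => 1 - expR (- (a * x)))) ->
  (forall a, 0 < a -> `|I g - I (ga a)| <= I (fun x => 1 - expR (- (a * x)))) ->
  (forall a, 0 < a -> I_ n (ga a) @[n --> \oo] --> I (ga a)) ->
  I_ n g @[n --> \oo] --> I g.
Proof.
move=> h_ h hc; apply/cvgrPdist_le => e e0.
have e4 : 0 < e / 4 by lra.
have [k _ hk] := (cvgr0Pnorm_le _).1 (levy_damp_cvg0 LI) _ e4.
have {hk} := hk k (leqnn k); set a := k.+1%:R^-1 => /= hk.
have a0 : 0 < a by rewrite invr_gt0.
have := h a a0 => h1.
near=> n.
have h2 := h_ n a a0.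
have h3 : `|I (ga a) - I_ n (ga a)| <= e / 4.
  by near: n; apply: (cvgrPdist_le _ _).1 (hc a a0) _ e4.
have h4 : `|I (fun x => 1 - expR (- (a * x))) - I_ n (fun x => 1 - expR (- (a * x)))| <= e / 4.
  by near: n; apply: (cvgrPdist_le _ _).1 (damp_cvg a0) _ e4.
move: hk h1 h2 h3 h4; rewrite !ler_norml; lra.
Unshelve. all: by end_near. Qed.

Lemma levy_cos_cvg t :
  I_ n (fun x => cos (t * x) - 1) @[n --> \oo] --> I (fun x => cos (t * x) - 1).
Proof.
apply: (@cvg_damped _ (fun a x => expR (- (a * x)) * cos (t * x) - 1)).
- by move=> n a; exact: levy_cos_damp (LI_ n) _ _.
- by move=> a; exact: levy_cos_damp LI _ _.
move=> a a0.
have E : (fun x : R => expR (- (a * x)) * cos (t * x) - 1) =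
  (fun x => expR (- (a * x)) * cos (t * x) - expR (- (a * 0)) * cos (t * 0)).
  by apply/funext => x; rewrite !mulr0 oppr0 expR0 cos0 mulr1.
rewrite E; apply: (@cvg_ftc (fun x => expR (- (a * x)) * cos (t * x))
  (fun s => - expR (- (a * s)) * (a * cos (t * s) + t * sin (t * s))) (a + `|t|) a) => //.
- by move=> y; exact: is_derive_expcos.
- move=> s; apply: differentiable_continuous; apply/derivable1_diffP.
  have := is_deriveM (is_deriveN (is_derive_expRNM a s))
    (is_deriveD (is_deriveZ a (is_derive_cosM t s)) (is_deriveZ t (is_derive_sinM t s))).
  by case.
- move=> s s0; rewrite normrM normrN (ger0_norm (expR_ge0 _)) mulrC ler_wpM2r ?expR_ge0//.
  rewrite (le_trans (ler_normD _ _))// lerD// normrM.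
    by rewrite (gtr0_norm a0) ler_piMr ?normr_cos_le1// ltW.
  by rewrite ler_piMr ?normr_sin_le1.
Qed.

Lemma levy_sin_cvg t :
  I_ n (fun x => sin (t * x)) @[n --> \oo] --> I (fun x => sin (t * x)).
Proof.
apply: (@cvg_damped _ (fun a x => expR (- (a * x)) * sin (t * x))).
- by move=> n a; exact: levy_sin_damp (LI_ n) _ _.
- by move=> a; exact: levy_sin_damp LI _ _.
move=> a a0.
have E : (fun x : R => expR (- (a * x)) * sin (t * x)) =
  (fun x => expR (- (a * x)) * sin (t * x) - expR (- (a * 0)) * sin (t * 0)).
  by apply/funext => x; rewrite !mulr0 oppr0 expR0 sin0 mulr0 subr0.
rewrite E; apply: (@cvg_ftc (fun x => expR (- (a * x)) * sin (t * x))
  (fun s => expR (- (a * s)) * (t * cos (t * s) - a * sin (t * s))) (`|t| + a) a) => //.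
- by move=> y; exact: is_derive_expsin.
- move=> s; apply: differentiable_continuous; apply/derivable1_diffP.
  have := is_deriveM (is_derive_expRNM a s)
    (is_deriveB (is_deriveZ t (is_derive_cosM t s)) (is_deriveZ a (is_derive_sinM t s))).
  by case.
- move=> s s0; rewrite normrM (ger0_norm (expR_ge0 _)) mulrC ler_wpM2r ?expR_ge0//.
  rewrite (le_trans (ler_normB _ _))// lerD// normrM.
    by rewrite ler_piMr ?normr_cos_le1.
  by rewrite (gtr0_norm a0) ler_piMr ?normr_sin_le1// ltW.
Qed.

End Convergence.
End LevyFunctional.

Lemma powR_continuous {R : realType} (x a : R) : 0 < x ->
  {for x, continuous (fun y => y `^ a)}.
Proof.
move=> x0; apply: differentiable_continuous; apply/derivable1_diffP.
by case: (is_derive1_powR a x0).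
Qed.

(** * Semistable laws *)

Section Modulus.
Context {R : realType}.
Variables (alpha c : R) (M : R -> R).
Hypothesis alpha_gt0 : 0 < alpha.
Hypothesis c_gt1 : 1 < c.
Hypothesis HM : semistable_modulus alpha c M.

Let p := c `^ alpha^-1.

Lemma period_gt1 : 1 < c `^ alpha^-1.
Proof.
have -> : 1 = 1 `^ alpha^-1 :> R by rewrite powR1.
by apply: gt0_ltr_powR; rewrite ?invr_gt0// ?nnegrE ?ltW// (lt_trans ltr01).
Qed.

Let p1 : 1 < p. Proof. exact: period_gt1. Qed.
Let p0 : 0 < p. Proof. exact: lt_trans p1. Qed.

(** This is - R_1. By [levy_tailE], - R_lambda (x) is lambda times its value at lambda^(1/alpha)
    x. *)
Definition ltail (x : R) : R := M x * x `^ (- alpha).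

Lemma ltail_ge0 x : 0 < x -> 0 <= ltail x.
Proof. by move=> x0; have [h _ _ _] := HM; rewrite mulr_ge0 ?powR_ge0// ltW// h. Qed.

Lemma ltail_le x y : 0 < x -> x <= y -> ltail y <= ltail x.
Proof. by move=> x0 xy; have [_ _ _ h] := HM; exact: h. Qed.

Lemma modulus_periodz (z : int) x : 0 < x -> M (p ^ z * x) = M x.
Proof.
have [_ _ h _] := HM.
have hn n y : 0 < y -> M (p ^+ n * y) = M y.
  elim: n y => [|n ih] y y0; first by rewrite expr0 mul1r.
  by rewrite exprSr -mulrA ih ?mulr_gt0// h.
move=> x0; case: z => n; first by rewrite -exprnP hn.
rewrite NegzE -exprnN -[in RHS](@mulVKf _ (p ^+ n.+1) _ x) ?expf_neq0 ?gt_eqF//.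
by rewrite mulrC hn ?divr_gt0 ?exprn_gt0// mulrC.
Qed.

Lemma period_bracket x : 0 < x -> exists z : int, 1 <= p ^ z * x < p.
Proof.
move=> x0; have lp : 0 < ln p by rewrite ln_gt0.
pose z := Num.floor (ln x / ln p).
have pE : p ^ (- z) = expR (- (z%:~R * ln p)).
  rewrite -(powR_intmul (- z) (ltW p0)) -[LHS]lnK ?posrE ?powR_gt0 ?(lt_trans ltr01 c_gt1)//.
  by rewrite ln_powR intrN mulNr.
have /andP[h1 h2] := floor_itv (ln x / ln p); rewrite -/z in h1 h2.
have xE : x = expR (ln x) by rewrite lnK.
have PE : p = expR (ln p) by rewrite lnK.
rewrite (ler_pdivlMr _ _ lp) in h1; rewrite (ltr_pdivrMr _ _ lp) intrD mulrDl mul1r in h2.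
exists (- z); rewrite pE [X in _ * X]xE -expRD [X in _ < X]PE.
rewrite ltr_expR -[X in X <= _]expR0 ler_expR.
move: h1 h2; move: (z%:~R * ln p) (ln x) (ln p) => u v w h1 h2; clear -h1 h2.
by apply/andP; split; lra.
Qed.

(** By periodicity it suffices to take x in [1, p[ with p = c^(1/alpha), where monotonicity of
    [ltail] compares M x with M 1 = M p at the cost of a factor at most p^alpha = c. *)
Lemma modulus_bounds : exists m0 m1, 0 < m0 /\
  forall x, 0 < x -> m0 <= M x <= m1.
Proof.
have [Mpos _ Mp _] := HM.
have M1 := Mpos 1 ltr01.
exists (M 1 / c), (M 1 * c); split; first by rewrite divr_gt0// (lt_trans ltr01).
move=> x x0; have [z /andP[z1 zp]] := period_bracket x0.
rewrite -(modulus_periodz z x0); set y := p ^ z * x in z1 zp *.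
have y0 : 0 < y by exact: lt_le_trans ltr01 z1.
have h1 := ltail_le ltr01 z1; have h2 := ltail_le y0 (ltW zp).
rewrite /ltail powR1 mulr1 in h1.
have ya : 0 < y `^ alpha by exact: powR_gt0.
have yc : y `^ alpha <= c.
  have -> : c = p `^ alpha by rewrite /p -powRrM mulVf ?gt_eqF// powRr1// ltW// (lt_trans ltr01).
  by apply: ge0_ler_powR => //; rewrite ?nnegrE ltW.
have y1 : 1 <= y `^ alpha.
  have -> : 1 = 1 `^ alpha :> R by rewrite powR1.
  by apply: ge0_ler_powR => //; rewrite ?nnegrE ?ltW.
have Mpp : M p = M 1 by rewrite -(Mp 1 ltr01) mulr1.
rewrite /ltail Mpp !powRN in h2.
have pc : p `^ alpha = c by rewrite /p -powRrM mulVf ?gt_eqF// powRr1// ltW// (lt_trans ltr01).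
rewrite pc in h2; apply/andP; split.
  apply: le_trans h2 _; rewrite ler_piMr ?(ltW (Mpos _ y0))//.
  by rewrite invf_le1.
rewrite powRN ler_pdivrMr// in h1; apply: le_trans h1 _.
by rewrite ler_wpM2l// ltW.
Qed.

(** The mass that the Stieltjes measure of R_1 gives to ]x, +oo[, also at points where [M] fails to
    be right-continuous. *)
Definition rtail (x : R) : R := lim (ltail y @[y --> x^'+]).

Lemma rtail_cvg x : 0 < x -> ltail y @[y --> x^'+] --> rtail x.
Proof.
move=> x0; apply: (@nonincreasing_at_right_is_cvgr _ ltail x).
  near=> y => s t; rewrite !in_itv /= => /andP[xs _] /andP[xt _] st.
  by apply: ltail_le st; exact: lt_trans xs.
near=> y; exists (ltail x); apply/ubP => _ [s /= + <-]; rewrite in_itv /= => /andP[xs _].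
by apply: ltail_le (ltW xs).
Unshelve. all: by end_near. Qed.

Lemma rtail_le x : 0 < x -> rtail x <= ltail x.
Proof.
move=> x0; apply: (@cvgr_to_le _ _ _ _ _ _ _ (rtail_cvg x0)).
by near=> y; apply: ltail_le => //; near: y; exact: nbhs_right_ge.
Unshelve. all: by end_near. Qed.

Lemma rtail_ge x y : 0 < x -> x < y -> ltail y <= rtail x.
Proof.
move=> x0 xy; apply: (@cvgr_to_ge _ _ _ _ _ _ _ (rtail_cvg x0)).
near=> z; apply: ltail_le; last by near: z; exact: nbhs_right_le.
by apply: lt_trans x0 _; near: z; exact: nbhs_right_gt.
Unshelve. all: by end_near. Qed.

Lemma rtail_ge0 x : 0 < x -> 0 <= rtail x.
Proof.
move=> x0; apply: le_trans (rtail_ge x0 (_ : x < x + 1)); last by rewrite ltrDl.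
by apply: ltail_ge0; rewrite addr_gt0.
Qed.

Lemma ltail_continuous x : 0 < x -> {for x, continuous M} -> {for x, continuous ltail}.
Proof.
move=> x0 cM; apply: cvgM; first exact: cM.
exact: powR_continuous.
Qed.

Lemma modulus_continuous x : 0 < x -> {for x, continuous ltail} -> {for x, continuous M}.
Proof.
move=> x0 cG.
have h : (ltail y * y `^ alpha) @[y --> x] --> ltail x * x `^ alpha.
  apply: cvgM; first exact: cG.
  exact: powR_continuous.
have E y : 0 < y -> ltail y * y `^ alpha = M y.
  by move=> y0; rewrite /ltail -mulrA powRN mulVf ?mulr1// gt_eqF// powR_gt0.
rewrite (E _ x0) in h; apply: cvg_trans h.
apply: near_eq_cvg; near=> y; rewrite E//.
by near: y; exact: lt_nbhsr.
Unshelve. all: by end_near. Qed.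

Lemma rtail_continuous x : 0 < x -> {for x, continuous M} ->
  rtail x = ltail x /\ {for x, continuous rtail}.
Proof.
move=> x0 /(ltail_continuous x0) cG.
have E : rtail x = ltail x.
  apply/cvg_lim => //; exact: cvg_at_right_filter.
split => //; apply/cvgrPdist_le => e e0; rewrite E.
have /= H := (cvgrPdist_le _ _).1 cG _ e0.
have [/= d d0 hd] := H.
near=> y.
have xy : `|x - y| < d by near: y; exists d.
have y0 : 0 < y by near: y; exact: lt_nbhsr.
have hy : \forall z \near y^'+, `|ltail x - ltail z| <= e.
  near=> z; apply: hd => /=.
  have yz : `|y - z| < d - `|x - y|.
    near: z; apply: (@cvgr_dist_lt _ _ _ _ _ id y); last by rewrite subr_gt0.
    exact: cvg_at_right_filter.
  by rewrite (le_lt_trans (ler_distD y _ _))// -ltrBrDl.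
have cd : `|ltail x - ltail z| @[z --> y^'+] --> `|ltail x - rtail y|.
  by apply: cvg_norm; apply: cvgB; [exact: cvg_cst|exact: rtail_cvg].
exact: (cvgr_to_le cd).
Unshelve. all: by end_near. Qed.

(** [M] and the monotone function [ltail] have the same continuity points, and a monotone function
    has only countably many jumps on each interval ]1/(n+1), n+1[. *)
Lemma countable_discontinuity :
  countable [set x | 0 < x /\ ~ {for x, continuous M}].
Proof.
pose F x := - ltail x.
pose D n := [set x : R | (x \in `](n.+1%:R^-1), (n.+1%:R)[) /\ discontinuity F x].
apply: (@sub_countable _ _ _ (\bigcup_n D n)); last first.
  apply: bigcup_countable => // n _; apply: discontinuity_countable.
  move=> s t; rewrite !in_itv /= => /andP[s0 _] _ st.
  by rewrite lerN2; apply: ltail_le => //; apply: lt_le_trans s0; rewrite invr_gt0.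
apply: subset_card_le => x [x0 ncx].
have [n1 hn1] := ltr_add_invr x0.
have [n2 hn2] : exists n, x < n%:R by exists (Num.truncn x).+1; exact: truncnS_gt.
exists (maxn n1 n2) => //; split.
  rewrite in_itv /=; apply/andP; split.
    apply: le_lt_trans hn1; rewrite add0r lef_pV2 ?posrE ?ltr0n// ler_nat ltnS.
    exact: leq_maxl.
  by apply: lt_le_trans hn2 _; rewrite ler_nat leqW// leq_maxr.
have cl : cvg (F y @[y --> x^'-]).
  apply: (@nondecreasing_at_left_is_cvgr _ F x).
    near=> y => s t; rewrite !in_itv /= => /andP[ys _] /andP[yt _] st.
    rewrite lerN2; apply: ltail_le st; apply: lt_trans ys; near: y; exact: nbhs_left_gt.
  near=> y; exists (- ltail x); apply/ubP => _ [s /= + <-]; rewrite in_itv /= => /andP[ys sx].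
  rewrite lerN2; apply: ltail_le (ltW sx); apply: lt_trans ys; near: y; exact: nbhs_left_gt.
have cr : F y @[y --> x^'+] --> - rtail x by apply: cvgN; exact: rtail_cvg.
split => //; first by apply/cvg_ex; eexists; exact: cr.
apply/eqP; rewrite (cvg_lim _ cr)// => lr; apply: ncx; apply: modulus_continuous => //.
have lx : ltail x = rtail x.
  apply/eqP; rewrite eq_le rtail_le// andbT -lerN2 -lr.
  apply: limr_le => //; near=> y; rewrite lerN2.
  by apply: ltail_le; [near: y; exact: nbhs_left_gt|near: y; exact: nbhs_left_le].
apply/left_right_continuousP; rewrite lx; split; last exact: rtail_cvg.
rewrite -[X in _ --> X]opprK -lr.
have -> : ltail = (fun y => - F y) by apply/funext => y; rewrite opprK.
exact: cvgN.
Unshelve. all: by end_near. Qed.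

End Modulus.

Lemma powRN_cvg0 {R : realType} (a : R) : 0 < a -> x `^ (- a) @[x --> +oo] --> (0 : R).
Proof.
move=> a0; apply/cvgrPdist_le => e e0; near=> x.
have x0 : 0 < x by near: x; exact: nbhs_pinfty_gt.
rewrite sub0r normrN ger0_norm ?powR_ge0// powRN -[e]invrK.
rewrite lef_pV2 ?posrE ?invr_gt0 ?powR_gt0//.
have -> : e^-1 = (e^-1 `^ a^-1) `^ a by rewrite -powRrM mulVf ?gt_eqF// powRr1// invr_ge0 ltW.
apply: ge0_ler_powR; rewrite ?nnegrE ?powR_ge0 ?(ltW x0) ?(ltW a0)//.
Unshelve. all: by end_near. Qed.

Section SemistableLaw.
Context {R : realType}.
Variables (alpha c : R) (M : R -> R).
Hypothesis alpha_gt0 : 0 < alpha.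
Hypothesis alpha_lt1 : alpha < 1.
Hypothesis c_gt1 : 1 < c.
Hypothesis HM : semistable_modulus alpha c M.
Local Notation ltail := (ltail alpha M).
Local Notation rtail := (rtail alpha M).

Lemma levy_tailE (lambda x : R) : 0 < lambda -> 0 < x ->
  levy_tail alpha M lambda x = - (lambda * ltail (lambda `^ alpha^-1 * x)).
Proof.
move=> l0 x0; rewrite /levy_tail /ltail; congr (- _).
have k0 : 0 < lambda `^ alpha^-1 by exact: powR_gt0.
rewrite powRM ?ltW// !powRN -powRrM mulVf ?gt_eqF// powRr1 ?ltW//.
by rewrite [RHS]mulrCA mulVKf ?gt_eqF.
Qed.

Lemma levy_tail_cvg (lambda b : R) : 0 < lambda -> 0 < b ->
  levy_tail alpha M lambda x @[x --> b^'+] --> - (lambda * rtail (lambda `^ alpha^-1 * b)).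
Proof.
move=> l0 b0; set k := lambda `^ alpha^-1; have k0 : 0 < k by exact: powR_gt0.
have kb : k * x @[x --> b^'+] --> (k * b)^'+.
  move=> A [/= e e0 H]; exists (e / k) => /=; first by rewrite divr_gt0.
  move=> x /= bx xb; apply: H => /=; last by rewrite ltr_pM2l.
  by rewrite -mulrBr normrM (gtr0_norm k0) mulrC -ltr_pdivlMr.
have h : (- (lambda * ltail (k * x))) @[x --> b^'+] --> - (lambda * rtail (k * b)).
  apply: cvgN; apply: cvgMr; apply: cvg_comp kb _.
  by apply: (rtail_cvg HM); rewrite mulr_gt0.
apply: cvg_trans h; apply: near_eq_cvg; near=> x.
rewrite levy_tailE//; apply: lt_trans b0 _; near: x; exact: nbhs_right_gt.
Unshelve. all: by end_near. Qed.

Lemma rtail_bound : exists m0 m1 : R, [/\ 0 < m0, 0 < m1,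
  forall x, 0 < x -> rtail x <= m1 * x `^ (- alpha) &
  forall x y, 0 < x -> x < y -> m0 * y `^ (- alpha) <= rtail x].
Proof.
have [m0 [m1 [m00 hm]]] := modulus_bounds alpha_gt0 c_gt1 HM.
have m10 : 0 < m1 by have /andP[h1 h2] := hm _ ltr01; exact: lt_le_trans (le_trans h1 h2).
exists m0, m1; split => //.
  move=> x x0; apply: le_trans (rtail_le HM x0) _.
  by rewrite /ltail ler_wpM2r ?powR_ge0//; have /andP[] := hm _ x0.
move=> x y x0 xy; apply: le_trans (rtail_ge HM x0 xy).
by rewrite /ltail ler_wpM2r ?powR_ge0//; have /andP[] := hm _ (lt_trans x0 xy).
Qed.

(** The masses of ]s, s + n + 1] increase to that of the half-line, and [rtail] vanishes at
    infinity, at least as fast as a multiple of x^-alpha. *)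
Lemma stieltjes_tail (lambda : R) (nu : {measure set R -> \bar R}) (s : R) :
  0 < lambda -> stieltjes_on_pos (levy_tail alpha M lambda) nu -> 0 < s ->
  nu [set x | s < x] = (lambda * rtail (lambda `^ alpha^-1 * s))%:E.
Proof.
move=> l0 hnu s0; set k := lambda `^ alpha^-1; have k0 : 0 < k by exact: powR_gt0.
pose F (n : nat) := `]s, s + n.+1%:R]%classic.
have UF : [set x | s < x] = \bigcup_n F n.
  apply/seteqP; split => x /=; last by move=> [n _]; rewrite /F /= in_itv /= => /andP[].
  move=> sx; exists (Num.truncn (x - s)) => //; rewrite /F /= in_itv /= sx /=.
  by rewrite -lerBlDl ltW// truncnS_gt.
have mF n : measurable (F n) by exact: measurable_itv.
have h1 : nu (F n) @[n --> \oo] --> nu [set x | s < x].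
  rewrite UF; apply: nondecreasing_cvg_mu => //; first exact: bigcup_measurable.
  move=> m n mn; apply/subsetPset => x; rewrite /F /= !in_itv /= => /andP[-> h] /=.
  by rewrite (le_trans h)// lerD2l ler_nat.
have [m0 [m1 [_ m10 hb _]]] := rtail_bound.
have h2 : nu (F n) @[n --> \oo] --> (lambda * rtail (k * s) - lambda * 0)%:E.
  have E n : nu (F n) = (lambda * rtail (k * s) - lambda * rtail (k * (s + n.+1%:R)))%:E.
    have sn : s < s + n.+1%:R by rewrite ltrDl.
    rewrite /F hnu// (cvg_lim _ (levy_tail_cvg l0 s0))//.
    rewrite (cvg_lim _ (levy_tail_cvg l0 (lt_trans s0 sn)))//.
    by rewrite opprK addrC.
  under eq_fun do rewrite E.
  apply/fine_cvgP; split; first exact: nearW.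
  apply: cvgB; first exact: cvg_cst.
  apply: cvgMr.
  have hc : m1 * (k * (s + n.+1%:R)) `^ (- alpha) @[n --> \oo] --> 0.
    rewrite -[X in _ --> X](mulr0 m1); apply: cvgMr.
    apply: (@cvg_comp _ _ _ (fun n : nat => k * (s + n.+1%:R)) (fun x => x `^ (- alpha)) _ (pinfty_nbhs R)); last exact: powRN_cvg0.
    apply/cvgryPge => B; near=> n.
    rewrite mulrC -ler_pdivrMr//; apply: (@le_trans _ _ n%:R).
      by near: n; exact: nbhs_infty_ger.
    by rewrite (@le_trans _ _ n.+1%:R) ?ler_nat// lerDr ltW.
  apply: (squeeze_cvgr _ (cvg_cst 0) hc); apply: nearW => n.
  have q0 : 0 < k * (s + n.+1%:R) by rewrite mulr_gt0// addr_gt0.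
  by rewrite (rtail_ge0 HM q0) hb.
rewrite mulr0 subr0 in h2.
exact: (cvg_unique _ h1 h2).
Unshelve. all: by end_near. Qed.


Section LevyMeasure.
Variables (nu : {measure set R -> \bar R}) (H : R -> R) (C : R).
Hypothesis nuH : forall s, 0 < s -> nu [set x | s < x] = (H s)%:E.
Hypothesis HC : forall s, 0 < s -> H s <= C * (1 + s `^ (- alpha)).
Variable y : R.
Hypothesis y0 : 0 < y.

Let mpos0 : measurable (`]0, +oo[%classic : set R). Proof. exact: measurable_itv. Qed.
(** [nu] is prescribed on the open half-line only, so it is restricted to it. The half-lines
    ]1/(n+1), +oo[ of finite mass, completed by the complement, now null, then show
    sigma-finiteness. *)
Let nup := mrestr nu mpos0.

Let nup_sfinite : sigma_finite setT nup.
Proof.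
exists (fun n => ~` `]0, +oo[%classic `|` [set x : R | n.+1%:R^-1 < x]).
  apply/seteqP; split => // x _; have [x0|x0] := ltP 0 x; last first.
    by exists 0%N => //; left; rewrite /= in_itv /= andbT; apply/negP; rewrite -leNgt.
  by have [n] := ltr_add_invr x0; rewrite add0r => hn; exists n => //; right.
move=> i; have m1 : measurable [set x : R | i.+1%:R^-1 < x].
  have -> : [set x : R | i.+1%:R^-1 < x] = `]i.+1%:R^-1, +oo[%classic.
    by apply/seteqP; split => x /=; rewrite in_itv /= andbT.
  exact: measurable_itv.
split; first by apply: measurableU => //; exact: measurableC.
rewrite /nup /mrestr setIUl setICl set0U.
apply: (@le_lt_trans _ _ (nu [set x : R | i.+1%:R^-1 < x])).
  by apply: le_measure; rewrite ?inE; [exact: measurableI|exact: m1|exact: subIsetl].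
by rewrite nuH// ltry.
Qed.

Let nus : {sigma_finite_measure set R -> \bar R} :=
  HB.pack (mrestr nu mpos0) (Measure_isSigmaFinite.Build _ _ _ (mrestr nu mpos0) nup_sfinite).

Let nus_tail s : 0 < s -> nus [set x | s < x / y] = (H (y * s))%:E.
Proof.
move=> s0; rewrite -nuH ?mulr_gt0// /nus /= /nup /mrestr; congr (nu _).
apply/seteqP; split => x /=; rewrite in_itv /= andbT ltr_pdivlMr// mulrC; first by case.
by move=> h; split => //; rewrite (lt_trans _ h)// mulr_gt0.
Qed.

Let C0 : 0 <= C.
Proof.
have h : 0 <= H 1 by rewrite -lee_fin -nuH.
by have := le_trans h (HC ltr01); rewrite powR1 pmulr_lge0.
Qed.

Let H_dom s : 0 < s -> H (y * s) <= C * (1 + y `^ (- alpha)) * (1 + s `^ (- alpha)).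
Proof.
move=> s0; apply: le_trans (HC (mulr_gt0 y0 s0)) _.
rewrite -mulrA ler_wpM2l// powRM ?(ltW y0) ?(ltW s0)//.
have := powR_ge0 y (- alpha); have := powR_ge0 s (- alpha).
by move: (y `^ _) (s `^ _) => u v hu hv; nra.
Qed.

Let integral_nus (g : R -> R) : g 0 = 0 ->
  \int[nu]_(x in `]0, +oo[) g (x / y) = \int[nus]_x g (Num.max (x / y) 0).
Proof.
move=> g0; transitivity (\int[nus]_(x in `]0, +oo[) g (x / y)).
  congr fine; apply: eq_measure_integral => A mA AD.
  by rewrite /nus /= /nup /mrestr (setIidl AD).
rewrite Rintegral_mkcond; apply: eq_Rintegral => x _; rewrite patchE mem_setE in_itv /= andbT.
have [x0|x0] := ltP 0 x.
  by rewrite max_l// divr_ge0// ltW.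
by rewrite max_r ?g0// ler_pdivrMr// mul0r.
Qed.

Lemma levy_measure_functional :
  levy_functional (fun g => 1 * \int[nus]_x g (Num.max (x / y) 0)) (fun s => 1 * H (y * s)).
Proof.
apply: (@levy_functional_measure _ _ _ nus (fun x => x / y) (fun s => H (y * s))
  (C * (1 + y `^ (- alpha))) alpha) => //.
- exact: measurable_funM.
- by rewrite ltW.
Qed.

Lemma levy_measure_cosE t : \int[nu]_(x in `]0, +oo[) (cos (t * (x / y)) - 1) =
  1 * \int[nus]_x (cos (t * Num.max (x / y) 0) - 1).
Proof. by rewrite mul1r (integral_nus (g := fun x => cos (t * x) - 1))// mulr0 cos0 subrr. Qed.

Lemma levy_measure_sinE t : \int[nu]_(x in `]0, +oo[) sin (t * (x / y)) =
  1 * \int[nus]_x sin (t * Num.max (x / y) 0).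
Proof. by rewrite mul1r (integral_nus (g := fun x => sin (t * x)))// mulr0 sin0. Qed.

(* On [b / t < x <= 1 / t] the integrand [1 - cos (t x)] is at least [1 - cos b]. *)
Lemma levy_measure_cos_le t b : 0 < t -> 0 < b < 1 -> y = 1 ->
  \int[nus]_x (cos (t * Num.max (x / y) 0) - 1) <= - ((1 - cos b) * (H (b / t) - H t^-1)).
Proof.
move=> t0 /andP[b0 b1] y1.
have bt : b / t <= t^-1 by rewrite ler_piMl// ltW// ?invr_gt0.
have t'0 : 0 < t^-1 by rewrite invr_gt0.
have bt0 : 0 < b / t by rewrite divr_gt0.
have ci : nus.-integrable setT (EFin \o (fun x => cos (t * Num.max (x / y) 0) - 1)).
  apply: (@levy_cos_integrable _ _ _ nus (fun x => x / y) (fun s => H (y * s))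
    (C * (1 + y `^ (- alpha))) alpha) => //; first exact: measurable_funM.
  by rewrite ltW.
pose A : set R := [set x | b / t < x] `\` [set x | t^-1 < x].
have mlt s : measurable [set x : R | s < x].
  have -> : [set x : R | s < x] = `]s, +oo[%classic.
    by apply/seteqP; split => x /=; rewrite in_itv /= andbT.
  exact: measurable_itv.
have mA : measurable A by exact: measurableD.
have nusA : nus A = (H (b / t) - H t^-1)%:E.
  have tail1 s : 0 < s -> nus [set x | s < x] = (H s)%:E.
    move=> s0; rewrite -nuH// /nus /= /nup /mrestr; congr (nu _).
    apply/seteqP; split => x /=; rewrite in_itv /= andbT; first by case.
    by move=> h; split => //; exact: lt_trans h.
  have sub : [set x | t^-1 < x] `<=` [set x | b / t < x].
    by move=> x /=; exact: le_lt_trans.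
  have f : (nus [set x | (b / t < x)%R] < +oo)%E by rewrite tail1// ltry.
  have := measureD (mlt (b / t)) (mlt t^-1) f; rewrite (setIidr sub) => E.
  by rewrite EFinB -!tail1.
have intA : (\int[nus]_x (\1_A x)%:E = (H (b / t) - H t^-1)%:E)%E.
  by rewrite integral_indic// setIT; exact: nusA.
have iA : nus.-integrable setT (EFin \o (fun x => - (1 - cos b) * \1_A x)).
  have h : nus.-integrable setT (EFin \o \1_A).
    apply/integrableP; split; first exact/measurable_EFinP/measurable_indic.
    under eq_integral do rewrite /= ger0_norm//.
    by rewrite intA ltry.
  have := integrableZl measurableT (- (1 - cos b)) h.
  by apply: eq_integrable => // x _ /=; rewrite EFinM.
apply: (@le_trans _ _ (\int[nus]_x (- (1 - cos b) * \1_A x))).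
  apply: le_Rintegral => // x _; rewrite indicE; have [|_] := boolP (x \in A); last first.
    by rewrite mulr0 subr_le0 cos_le1.
  rewrite inE => -[/= h1 /negP]; rewrite -leNgt => h2.
  rewrite mulr1 opprB lerD2r y1 divr1 max_l; last by rewrite (le_trans _ (ltW h1))// ltW.
  have bx : b <= t * x by rewrite mulrC -ler_pdivrMr// ltW.
  have x1 : t * x <= 1 by rewrite mulrC -ler_pdivlMr// mul1r.
  have p1 : 1 <= pi :> R by rewrite (le_trans _ (pi_ge2 R))// ler1n.
  move: bx; rewrite le_eqVlt => /predU1P[->//|bx].
  rewrite ltW// ltr_cos// in_itv /=.
    by rewrite (ltW b0) (le_trans (ltW b1) p1).
  by rewrite (le_trans (ltW b0) (ltW bx)) (le_trans x1 p1).
rewrite RintegralZl//; last first.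
  apply/integrableP; split; first exact/measurable_EFinP/measurable_indic.
  under eq_integral do rewrite /= ger0_norm//.
  by rewrite intA ltry.
by rewrite /Rintegral intA /= mulNr.
Qed.

End LevyMeasure.
End SemistableLaw.

Section SemistableVariable.
Context {R : realType}.
Variables (alpha c : R) (M : R -> R).
Hypothesis alpha_gt0 : 0 < alpha.
Hypothesis alpha_lt1 : alpha < 1.
Hypothesis c_gt1 : 1 < c.
Hypothesis HM : semistable_modulus alpha c M.

(* Levy tail of [V lambda / y]; right limits are taken since [M] need not be right-continuous. *)
Definition stail (lambda y s : R) : R :=
  lambda * rtail alpha M (lambda `^ alpha^-1 * (y * s)).

Let k0 (lambda : R) : 0 < lambda -> 0 < lambda `^ alpha^-1.
Proof. exact: powR_gt0. Qed.

Lemma powRN_scale (lambda u : R) : 0 < lambda -> 0 < u ->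
  (lambda `^ alpha^-1 * u) `^ (- alpha) = lambda^-1 * u `^ (- alpha).
Proof.
move=> l0 u0; rewrite powRM ?(ltW (k0 l0)) ?(ltW u0)//; congr (_ * _).
by rewrite powRN -powRrM mulVf ?gt_eqF// powRr1// ltW.
Qed.

Lemma stail_bound : exists2 m1 : R, 0 < m1 & forall lambda y s : R,
  0 < lambda -> 0 < y -> 0 < s -> stail lambda y s <= m1 * (y * s) `^ (- alpha).
Proof.
have [m0 [m1 [_ m10 hb _]]] := rtail_bound alpha_gt0 c_gt1 HM.
exists m1 => // lambda y s l0 y0 s0.
have ys0 : 0 < y * s by exact: mulr_gt0.
have h := hb _ (mulr_gt0 (k0 l0) ys0).
rewrite /stail -ler_pdivlMl//; apply: le_trans h _.
by rewrite powRN_scale// mulrCA.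
Qed.

(** Periodicity of [M] gives R_(c lambda) = R_lambda: the law of V_lambda depends on lambda only
    modulo powers of c, which is why circular convergence may identify 1 and c^-1. *)
Lemma stail_period (z : int) (lambda y s : R) : 0 < lambda -> 0 < y -> 0 < s ->
  stail (c ^ z * lambda) y s = stail lambda y s.
Proof.
move=> l0 y0 s0.
have c0 : 0 < c by exact: lt_trans ltr01 c_gt1.
have cl0 : 0 < c ^ z * lambda by rewrite mulr_gt0// exprz_gt0.
have ys0 : 0 < y * s by exact: mulr_gt0.
have h1 := levy_tail_cvg alpha_gt0 HM cl0 ys0.
have h2 := levy_tail_cvg alpha_gt0 HM l0 ys0.
suff h3 : levy_tail alpha M (c ^ z * lambda) x @[x --> (y * s)^'+] -->
    - (lambda * rtail alpha M (lambda `^ alpha^-1 * (y * s))).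
  by apply: oppr_inj; exact: (cvg_unique _ h1 h3).
apply: cvg_trans h2; apply: near_eq_cvg; near=> x.
have x0 : 0 < x by apply: lt_trans ys0 _; near: x; exact: nbhs_right_gt.
rewrite /levy_tail powRM ?(ltW l0)//; last by rewrite ltW// exprz_gt0.
have -> : (c ^ z) `^ alpha^-1 = (c `^ alpha^-1) ^ z.
  by rewrite -!powR_intmul ?powR_ge0 ?(ltW c0)// -!powRrM mulrC.
by rewrite -mulrA (modulus_periodz alpha_gt0 c_gt1 HM)// mulr_gt0// k0.
Unshelve. all: by end_near. Qed.

Lemma stail_cvg (l_ y_ : nat -> R) (lambda y s : R) : 0 < lambda -> 0 < y -> 0 < s ->
  l_ n @[n --> \oo] --> lambda -> y_ n @[n --> \oo] --> y ->
  {for lambda `^ alpha^-1 * (y * s), continuous M} ->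
  stail (l_ n) (y_ n) s @[n --> \oo] --> stail lambda y s.
Proof.
move=> l0 y0 s0 hl hy cM; apply: cvgM => //.
have q0 : 0 < lambda `^ alpha^-1 * (y * s) by rewrite !mulr_gt0// k0.
have [_ cr] := rtail_continuous HM q0 cM.
have h1 : l_ n `^ alpha^-1 @[n --> \oo] --> lambda `^ alpha^-1.
  by apply: (@cvg_comp _ _ _ l_ (fun x => x `^ alpha^-1) _ _ _ hl); exact: powR_continuous.
have h2 : y_ n * s @[n --> \oo] --> y * s by apply: cvgMl.
have h3 : l_ n `^ alpha^-1 * (y_ n * s) @[n --> \oo] --> lambda `^ alpha^-1 * (y * s).
  exact: cvgM.
exact: (@cvg_comp _ _ _ _ (rtail alpha M) _ _ _ h3).
Qed.

Lemma countable_stail_discontinuity (r : R) : 0 < r ->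
  countable [set s | 0 < s /\ ~ {for r * s, continuous M}].
Proof.
move=> r0; apply: (@sub_countable _ _ _ ((fun q => q / r) @` [set x | 0 < x /\ ~ {for x, continuous M}])).
  apply: subset_card_le => s [s0 ns]; exists (r * s); first by split => //; rewrite mulr_gt0.
  by rewrite mulrC mulKf// gt_eqF.
exact: (sub_countable (card_image_le _ _) (countable_discontinuity HM)).
Qed.

Lemma Re_expiB1 (s : R) : complex.Re (expi s - 1) = cos s - 1.
Proof. by rewrite /expi /cexp /= expR0 mul1r. Qed.

Lemma Im_expiB1 (s : R) : complex.Im (expi s - 1) = sin s.
Proof. by rewrite /expi /cexp /= expR0 mul1r oppr0 addr0. Qed.

Lemma char_funE d (T : measurableType d) (P : probability T R) (X : {RV P >-> R}) (t : R) :
  char_fun X t = Complex (\int[P]_w cos (t * X w)) (\int[P]_w sin (t * X w)).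
Proof.
rewrite /char_fun /Cintegral; congr Complex; apply: eq_Rintegral => w _;
by rewrite /expi /cexp /= expR0 mul1r.
Qed.

Context d (T : measurableType d) (P : probability T R) (X : {RV P >-> R}) (lambda : R).
Hypothesis l0 : 0 < lambda.
Hypothesis HX : semistable_rv alpha M lambda X.

(** The scaling by [y] turns the event V_lambda <= y into a fixed threshold 1 later on. The bound in
    the middle, for the unscaled variable, feeds the decay of the characteristic function. *)
Lemma semistable_char (y : R) : 0 < y ->
  exists I, [/\ levy_functional I (fun s => 1 * stail lambda y s),
  forall t b, 0 < t -> 0 < b < 1 -> y = 1 -> I (fun x => cos (t * x) - 1) <=
    - ((1 - cos b) * (stail lambda 1 (b / t) - stail lambda 1 t^-1)) &
  forall t : R,
   \int[P]_w cos (t * (X w / y)) = expR (I (fun x => cos (t * x) - 1)) * cos (I (fun x => sin (t * x))) /\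
   \int[P]_w sin (t * (X w / y)) = expR (I (fun x => cos (t * x) - 1)) * sin (I (fun x => sin (t * x)))].
Proof.
move=> y0; have [_ [nu hnu hchar]] := HX.
have [m1 m10 hb] := stail_bound.
pose H s := stail lambda 1 s.
have HE s : lambda * rtail alpha M (lambda `^ alpha^-1 * s) = H s by rewrite /H /stail mul1r.
have nuH s : 0 < s -> nu [set x | s < x] = (H s)%:E.
  by move=> s0; rewrite -HE; exact: (stieltjes_tail alpha_gt0 c_gt1 HM).
have HC s : 0 < s -> H s <= m1 * (1 + s `^ (- alpha)).
  move=> s0; apply: le_trans (hb _ _ _ l0 ltr01 s0) _; rewrite mul1r ler_wpM2l ?(ltW m10)//.
  by rewrite lerDr.
have hf := levy_measure_functional alpha_gt0 alpha_lt1 nuH HC y0.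
eexists; split.
- have -> : (fun s => 1 * stail lambda y s) = (fun s => 1 * H (y * s)).
    by apply/funext => s; rewrite /H /stail [1 * (y * s)]mul1r.
  exact: hf.
- move=> t b t0 b01 y1 /=; rewrite mul1r.
  exact: (levy_measure_cos_le alpha_gt0 alpha_lt1 nuH HC y0 t0 b01 y1).
- move=> t.
have ce := levy_measure_cosE nuH y0 t.
have se := levy_measure_sinE nuH y0 t.
have h := hchar (t / y); rewrite char_funE in h.
have cosE : \int[P]_w cos (t / y * X w) = \int[P]_w cos (t * (X w / y)).
  by apply: eq_Rintegral => x _; rewrite -mulrA [y^-1 * _]mulrC.
have sinE : \int[P]_w sin (t / y * X w) = \int[P]_w sin (t * (X w / y)).
  by apply: eq_Rintegral => x _; rewrite -mulrA [y^-1 * _]mulrC.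
rewrite cosE sinE in h.
have {}h : Complex (\int[P]_w cos (t * (X w / y))) (\int[P]_w sin (t * (X w / y))) =
  cexp (Complex (\int[nu]_(x in `]0, +oo[) (cos (t * (x / y)) - 1))
    (\int[nu]_(x in `]0, +oo[) sin (t * (x / y)))).
  rewrite h /Cintegral; congr cexp; congr Complex; apply: eq_Rintegral => x _.
    by rewrite Re_expiB1 -mulrA [y^-1 * _]mulrC.
  by rewrite Im_expiB1 -mulrA [y^-1 * _]mulrC.
rewrite ce se /cexp /= in h.
by case: h => -> ->.
Qed.


(** The modulus of the transform is the exponential of the real part of the exponent, to which the
    Levy mass of ]b/t, 1/t] contributes at most - (1 - cos b) t^alpha once [b] is small enough. *)
Let rho_cvg0 : exists rho : R -> R,
  (forall t, 0 < t -> `|\int[P]_w cos (t * X w)| <= rho t /\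
     `|\int[P]_w sin (t * X w)| <= rho t) /\
  rho t @[t --> +oo] --> 0.
Proof.
have [I [_ hb hc]] := semistable_char ltr01.
have [m0 [m1 [m00 m10 hu hl]]] := rtail_bound alpha_gt0 c_gt1 HM.
(* With this [r] the tail at b / t is at least (m1 + 1 + m0) t^alpha, which beats the upper bound m1
   t^alpha at 1 / t by more than t^alpha; the summand [m0] makes r > 1 evident. *)
pose r := (m1 + 1 + m0) / m0.
have r1 : 1 < r by rewrite ltr_pdivlMr// mul1r; lra.
have r0 : 0 < r by exact: lt_trans r1.
(* The factor 1/2 leaves room for the strict inequality in the lower bound of [rtail], which is a
   right limit. *)
pose b := r `^ (- alpha^-1) / 2.
have ra : r `^ (- alpha^-1) < 1.
  rewrite powRN invf_lt1 ?powR_gt0//.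
  have -> : 1 = 1 `^ alpha^-1 :> R by rewrite powR1.
  by apply: gt0_ltr_powR; rewrite ?invr_gt0 ?nnegrE ?ler01// ltW.
have rap : 0 < r `^ (- alpha^-1) by exact: powR_gt0.
have b01 : 0 < b < 1 by rewrite /b; apply/andP; split; lra.
have /andP[b0 b1] := b01.
have cb : 0 < 1 - cos b.
  rewrite subr_gt0 -(cos0 R) ltr_cos// in_itv /= ?lexx ?pi_ge0// (ltW b0) /=.
  by rewrite (le_trans (ltW b1))// (le_trans _ (pi_ge2 R))// ler1n.
have bound t : 0 < t -> t `^ alpha <= stail lambda 1 (b / t) - stail lambda 1 t^-1.
  move=> t0; have t'0 : 0 < t^-1 by rewrite invr_gt0.
  have bt0 : 0 < b / t by rewrite divr_gt0.
  have ta : (t^-1) `^ (- alpha) = t `^ alpha.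
    by rewrite -powR_inv1 ?ltW// -powRrM mulN1r opprK.
  have h1 : stail lambda 1 t^-1 <= m1 * t `^ alpha.
    rewrite /stail mul1r -ler_pdivlMl//.
    apply: le_trans (hu _ _) _; first by rewrite mulr_gt0// k0.
    by rewrite powRN_scale// ta mulrCA.
  have h2 : (m1 + 1 + m0) * t `^ alpha <= stail lambda 1 (b / t).
    rewrite /stail mul1r -ler_pdivrMl//.
    apply: le_trans (hl _ (lambda `^ alpha^-1 * (r `^ (- alpha^-1) / t)) _ _); last 2 first.
    - by rewrite mulr_gt0// k0.
    - rewrite ltr_pM2l ?k0// ltr_pM2r// /b; lra.
    rewrite powRN_scale ?divr_gt0// powRM ?(ltW rap) ?(ltW t'0)// ta.
    rewrite -powRrM mulrNN mulVf ?gt_eqF// powRr1 ?(ltW r0)//.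
    rewrite [leRHS](_ : _ = lambda^-1 * ((m1 + 1 + m0) * t `^ alpha))//.
    by rewrite /r; field; rewrite !gt_eqF.
  have := powR_ge0 t alpha; move: h1 h2; move: (t `^ alpha) => u; nra.
exists (fun t => expR (- ((1 - cos b) * t `^ alpha))); split.
  move=> t t0; have [hC hS] := hc t.
  have E (g : R -> R) : \int[P]_w g (t * (X w / 1)) = \int[P]_w g (t * X w).
    by apply: eq_Rintegral => w _; rewrite divr1.
  rewrite (E cos) in hC; rewrite (E sin) in hS.
  have le : expR (I (fun x => cos (t * x) - 1)) <= expR (- ((1 - cos b) * t `^ alpha)).
    rewrite ler_expR; apply: le_trans (hb t b t0 b01 erefl) _.
    by rewrite lerN2 ler_wpM2l ?(ltW cb)// bound.
  rewrite hC hS !normrM (ger0_norm (expR_ge0 _)); split.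
    by rewrite -[leRHS]mulr1 ler_pM ?expR_ge0// normr_cos_le1.
  by rewrite -[leRHS]mulr1 ler_pM ?expR_ge0// normr_sin_le1.
apply: (@cvg_comp _ _ _ (fun t => (1 - cos b) * t `^ alpha) (fun u => expR (- u)) _ (pinfty_nbhs R)); last exact: cvgr_expR.
apply/cvgryPge => B; near=> t.
rewrite mulrC -ler_pdivrMr//.
have t0 : 0 < t by near: t; exact: nbhs_pinfty_gt.
have Bt : `|B / (1 - cos b)| `^ alpha^-1 <= t.
  by near: t; apply: nbhs_pinfty_ge; exact: num_real.
apply: le_trans (ler_norm _) _.
have -> : `|B / (1 - cos b)| = (`|B / (1 - cos b)| `^ alpha^-1) `^ alpha.
  by rewrite -powRrM mulVf ?gt_eqF// powRr1.
by apply: ge0_ler_powR; rewrite ?nnegrE ?powR_ge0 ?(ltW t0) ?(ltW alpha_gt0).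
Unshelve. all: by end_near. Qed.

(** Shifting by [y] only rotates the characteristic function, so the cosine transform of n (X - y)
    is at most 2 rho(|t| n), which tends to 0. *)
Lemma semistable_no_atom (y : R) : P [set w | X w = y] = 0%E.
Proof.
have [rho [hr r0]] := rho_cvg0.
have mX : measurable_fun setT X by exact: measurable_funPT.
have -> : [set w | X w = y] = [set w | X w - y = 0].
  by apply/seteqP; split => w /= => [->|/eqP]; rewrite ?subrr// subr_eq0 => /eqP.
apply: no_atom_of_cos_cvg0; first exact: measurable_funB.
have mc (t : R) : P.-integrable setT (EFin \o (fun w => cos (t * X w))).
  apply: (@integrable_bounded _ _ _ _ _ 1); last by move=> w; exact: normr_cos_le1.
  by apply: measurableT_comp; [exact: measurable_cos|exact: measurable_funM].
have ms (t : R) : P.-integrable setT (EFin \o (fun w => sin (t * X w))).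
  apply: (@integrable_bounded _ _ _ _ _ 1); last by move=> w; exact: normr_sin_le1.
  by apply: measurableT_comp; [exact: measurable_sin|exact: measurable_funM].
have bnd (t : R) : 0 < t -> `|\int[P]_w cos (t * (X w - y))| <= 2 * rho t.
  move=> t0; have [h1 h2] := hr t t0.
  have -> : \int[P]_w cos (t * (X w - y)) =
      cos (t * y) * \int[P]_w cos (t * X w) + sin (t * y) * \int[P]_w sin (t * X w).
    rewrite -!RintegralZl// -RintegralD//.
    - by apply: eq_Rintegral => w _; rewrite mulrBr cosB; ring.
    - by have := integrableZl measurableT (cos (t * y)) (mc t); apply: eq_integrable.
    - by have := integrableZl measurableT (sin (t * y)) (ms t); apply: eq_integrable.
  rewrite (le_trans (ler_normD _ _))// !normrM mulrDl mul1r lerD//.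
    by rewrite (le_trans _ h1)// ler_piMl// normr_cos_le1.
  by rewrite (le_trans _ h2)// ler_piMl// normr_sin_le1.
have bnd' (t : R) : t != 0 -> `|\int[P]_w cos (t * (X w - y))| <= 2 * rho `|t|.
  move=> t0; apply: le_trans (bnd `|t| _); last by rewrite normr_gt0.
  have [tp|tn] := leP 0 t; first by rewrite (ger0_norm tp).
  rewrite (ltr0_norm tn); under [X in _ <= `|X|]eq_Rintegral do rewrite mulNr cosN.
  exact: lexx.
move=> t t0; apply: norm_cvg0.
have hc : 2 * rho (`|t| * n%:R) @[n --> \oo] --> 0.
  rewrite -[X in _ --> X](mulr0 2); apply: cvgMr.
  apply: (@cvg_comp _ _ _ (fun n : nat => `|t| * n%:R) rho _ (pinfty_nbhs R)); last exact: r0.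
  apply/cvgryPge => B; near=> n; rewrite mulrC -ler_pdivrMr ?normr_gt0//.
  by near: n; exact: nbhs_infty_ger.
apply: (squeeze_cvgr _ (cvg_cst 0) hc); near=> n.
have n0 : (0 < n)%N by near: n; exact: nbhs_infty_gt.
rewrite normr_ge0 /=; under eq_Rintegral do rewrite mulrA.
have -> : `|t| * n%:R = `|t * n%:R| by rewrite normrM normr_nat.
by apply: bnd'; rewrite mulf_neq0// pnatr_eq0 -lt0n.
Unshelve. all: by end_near. Qed.

End SemistableVariable.

(** * Convergence in law to semistable variables *)

Section SemistableLimit.
Context {R : realType}.
Variables (alpha c : R) (M : R -> R).
Hypothesis alpha_gt0 : 0 < alpha.
Hypothesis alpha_lt1 : alpha < 1.
Hypothesis c_gt1 : 1 < c.
Hypothesis HM : semistable_modulus alpha c M.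
Context dV (TV : measurableType dV) (Q : probability TV R) (V : R -> {RV Q >-> R}).
Hypothesis HV : forall lambda : R, 0 < lambda -> semistable_rv alpha M lambda (V lambda).

Definition vcdf (lambda y : R) : R := fine (Q [set v | V lambda v <= y]).

(** The premise on cosine transforms hides how they depend on the exponent: exactly through exp for
    semistable variables, and through an m-th power for partial sums. Convergence holds at every
    threshold because the limit law has no atoms. *)
Lemma semistable_limit d (T : measurableType d) (P_ : nat -> probability T R)
    (X_ : nat -> T -> R) (I_ : nat -> (R -> R) -> R) (H_ : nat -> R -> R)
    (C b lambda y : R) (N : set R) :
  (forall n, measurable_fun setT (X_ n)) ->
  (forall n, levy_functional (I_ n) (H_ n)) -> 0 <= b < 1 ->
  (forall n s, 0 < s -> H_ n s <= C * (1 + s `^ (- b))) -> countable N ->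
  (forall s, 0 < s -> ~ N s -> H_ n s @[n --> \oo] --> stail alpha M lambda y s) ->
  (forall t p q : R, I_ n (fun x => cos (t * x) - 1) @[n --> \oo] --> p ->
     I_ n (fun x => sin (t * x)) @[n --> \oo] --> q ->
     \int[P_ n]_w cos (t * X_ n w) @[n --> \oo] --> expR p * cos q) ->
  0 < lambda -> 0 < y ->
  fine (P_ n [set w | `|X_ n w| <= 1]) @[n --> \oo] --> vcdf lambda y.
Proof.
move=> mX_ LI_ b01 HD N0 HH hcos l0 y0.
have [V0 _] := HV l0.
have [I [LI _ hc]] := semistable_char alpha_gt0 alpha_lt1 c_gt1 HM l0 (HV l0) y0.
have HH' s : 0 < s -> ~ N s -> H_ n s @[n --> \oo] --> 1 * stail alpha M lambda y s.
  by rewrite mul1r; exact: HH.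
have mV : measurable_fun setT (fun v => V lambda v / y).
  by apply: measurable_funM => //; exact: measurable_funPT.
have -> : vcdf lambda y = fine (Q [set v | `|V lambda v / y| <= 1]).
  congr (fine (Q _)); apply/seteqP; split => v /=;
  by rewrite ger0_norm ?divr_ge0 ?(ltW y0)// ler_pdivrMr// mul1r.
apply: (cos_cvg_prob_le mX_ mV) => //.
  move=> t; rewrite (hc t).1; apply: hcos.
    exact: (levy_cos_cvg LI_ LI b01 HD N0 HH').
  exact: (levy_sin_cvg LI_ LI b01 HD N0 HH').
rewrite -(semistable_no_atom alpha_gt0 alpha_lt1 c_gt1 HM l0 (HV l0) y).
congr (Q _); apply/seteqP; split => v /=.
  by rewrite ger0_norm ?divr_ge0 ?(ltW y0)// => /(canRL (divfK _)) ->; rewrite ?mul1r// gt_eqF.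
by move=> ->; rewrite divff ?normr1// gt_eqF.
Qed.

(** Joint continuity in lambda and y, with the limit named by any representative c^z l; constant
    sequences then give periodicity in law. The lower bound [yl] keeps the tails dominated. *)
Lemma vcdf_cvg (l_ y_ : nat -> R) (lambda l y yl : R) (z : int) :
  0 < l -> 0 < y -> lambda = c ^ z * l -> 0 < yl ->
  (forall n, 0 < l_ n) -> (forall n, yl <= y_ n) ->
  l_ n @[n --> \oo] --> l -> y_ n @[n --> \oo] --> y ->
  vcdf (l_ n) (y_ n) @[n --> \oo] --> vcdf lambda y.
Proof.
move=> l0 y0 lE yl0 l_0 y_yl hl hy.
have c0 : 0 < c by exact: lt_trans ltr01 c_gt1.
have la0 : 0 < lambda by rewrite lE mulr_gt0// exprz_gt0.
have y_0 n : 0 < y_ n by exact: lt_le_trans yl0 (y_yl n).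
have [m1 m10 hb] := stail_bound alpha_gt0 c_gt1 HM.
have /choice[I_ hI] : forall n, exists I, levy_functional I (fun s => 1 * stail alpha M (l_ n) (y_ n) s) /\
    forall t : R, \int[Q]_w cos (t * (V (l_ n) w / y_ n)) =
      expR (I (fun x => cos (t * x) - 1)) * cos (I (fun x => sin (t * x))).
  move=> n; have [I [h1 _ h2]] := semistable_char alpha_gt0 alpha_lt1 c_gt1 HM (l_0 n) (HV (l_0 n)) (y_0 n).
  by exists I; split => // t; exact: (h2 t).1.
have E n : vcdf (l_ n) (y_ n) = fine (Q [set v | `|V (l_ n) v / y_ n| <= 1]).
  have [V0 _] := HV (l_0 n).
  congr (fine (Q _)); apply/seteqP; split => v /=;
  by rewrite ger0_norm ?divr_ge0 ?(ltW (y_0 n))// ler_pdivrMr// mul1r.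
under eq_fun do rewrite E.
pose N := [set s : R | 0 < s /\ ~ {for (l `^ alpha^-1 * y) * s, continuous M}].
apply: (@semistable_limit _ _ (fun _ => Q) (fun n w => V (l_ n) w / y_ n) I_
  (fun n s => 1 * stail alpha M (l_ n) (y_ n) s) (m1 * yl `^ (- alpha)) alpha _ _ N) => //.
- by move=> n; apply: measurable_funM => //; exact: measurable_funPT.
- by move=> n; exact: (hI n).1.
- by rewrite alpha_lt1 ltW.
- move=> n s s0; rewrite mul1r; apply: le_trans (hb _ _ _ (l_0 n) (y_0 n) s0) _.
  rewrite -mulrA ler_wpM2l ?(ltW m10)// powRM ?(ltW s0) ?(ltW (y_0 n))//.
  apply: ler_pM; rewrite ?powR_ge0 ?lerDr//.
  rewrite !powRN lef_pV2 ?posrE ?powR_gt0//.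
  by apply: ge0_ler_powR; rewrite ?nnegrE ?(ltW yl0) ?(ltW alpha_gt0) ?(ltW (y_0 n)).
- by apply: (countable_stail_discontinuity HM); rewrite mulr_gt0// powR_gt0.
- move=> s s0 Ns; under eq_fun do rewrite mul1r.
  rewrite lE (stail_period alpha_gt0 c_gt1 HM)//.
  apply: (stail_cvg HM) => //; apply: contrapT => h; apply: Ns; split => //.
  by rewrite -mulrA.
- move=> t p q hp hq; under eq_fun do rewrite (hI _).2.
  apply: cvgM.
    by apply: (@cvg_comp _ _ _ _ expR _ _ _ hp); exact: continuous_expR.
  by apply: (@cvg_comp _ _ _ _ cos _ _ _ hq); exact: continuous_cos.
Qed.

End SemistableLimit.

(** * Laws of partial sums *)

Section PolarLimit.
Context {R : realType}.

(* Real and imaginary parts of [(a + i b) ^ n]. *)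
Fixpoint cs_pow (a b : R) (n : nat) : R * R :=
  if n is n'.+1 then
    let z := cs_pow a b n' in (z.1 * a - z.2 * b, z.2 * a + z.1 * b)
  else (1, 0).

Lemma cs_pow_polar (r th : R) n :
  cs_pow (r * cos th) (r * sin th) n = (r ^+ n * cos (n%:R * th), r ^+ n * sin (n%:R * th)).
Proof.
elim: n => [|n ih] /=; first by rewrite mul0r cos0 sin0 expr0 mul1r mulr0.
rewrite ih /= -natr1 mulrDl mul1r cosD sinD exprSr; congr (_, _); ring.
Qed.

Lemma ln_bounds (u : R) : 0 < u -> 1 - u^-1 <= ln u <= u - 1.
Proof.
move=> u0; have h (v : R) : 0 < v -> ln v <= v - 1.
  move=> v0; have := expR_ge1Dx (ln v); rewrite lnK ?posrE//; lra.
rewrite h// andbT; have := h u^-1; rewrite invr_gt0 lnV ?posrE// => /(_ u0); lra.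
Qed.

(** The factor [k] from the mean value theorem is squeezed to 1 as x tends to 0, so [atan] may be
    replaced by its argument inside a product with a large integer. *)
Lemma atan_bounds (x : R) : exists k : R, atan x = x * k /\ (1 + x ^+ 2)^-1 <= k <= 1.
Proof.
have hk (y xi : R) : `|xi| <= `|y| -> (1 + y ^+ 2)^-1 <= (1 + xi ^+ 2)^-1 <= 1.
  move=> h; have /andP[_ ->] := inv1Dsq_bounds xi; rewrite andbT.
  rewrite lef_pV2 ?posrE ?ltr_pwDl ?sqr_ge0// lerD2l.
  by rewrite -(real_normK (num_real xi)) -(real_normK (num_real y)) ler_pXn2r ?nnegrE.
have ca (z : R) : {for z, continuous (@atan R)} by exact: continuous_atan.
have [x0|x0|->] := ltgtP x 0; last first.
- exists 1; rewrite atan0 mul0r; split => //.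
  by rewrite expr0n addr0 invr1 lexx.
- have [|xi /[!in_itv] /andP[h1 h2] h] := @MVT _ (@atan R) (fun z => (1 + z ^+ 2)^-1) _ _ x0 (fun z _ => is_derive1_atan z).
    exact: continuous_subspaceT.
  exists (1 + xi ^+ 2)^-1; split; first by move: h; rewrite atan0 !subr0 mulrC.
  by apply: hk; rewrite (gtr0_norm x0) (gtr0_norm h1) ltW.
- have [|xi /[!in_itv] /andP[h1 h2] h] := @MVT _ (@atan R) (fun z => (1 + z ^+ 2)^-1) _ _ x0 (fun z _ => is_derive1_atan z).
    exact: continuous_subspaceT.
  exists (1 + xi ^+ 2)^-1; split.
    by move: h; rewrite atan0 !sub0r mulrN => /oppr_inj ->; rewrite mulrC.
  by apply: hk; rewrite (ltr0_norm x0) (ltr0_norm h2) lerN2 ltW.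
Qed.

(** In polar form the power has modulus exp ((m/2) ln (a^2 + b^2)) and argument m atan (b / a),
    since eventually a > 0. To first order a^2 + b^2 - 1 is 2 (a - 1) and b / a is b, so both
    exponents converge. *)
Lemma cs_pow_cvg (m_ : nat -> nat) (a_ b_ : nat -> R) (p q : R) :
  (m_ n)%:R @[n --> \oo] --> (+oo : set_system R) ->
  (m_ n)%:R * (a_ n - 1) @[n --> \oo] --> p -> (m_ n)%:R * b_ n @[n --> \oo] --> q ->
  (cs_pow (a_ n) (b_ n) (m_ n)).1 @[n --> \oo] --> expR p * cos q.
Proof.
move=> hm hp hq.
have m0 : \forall n \near \oo, 0 < (m_ n)%:R :> R by exact: (cvgryPgt _).1 hm 0.
have mi : (m_ n)%:R^-1 @[n --> \oo] --> (0 : R).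
  exact: (gtr0_cvgV0 (f := fun n => (m_ n)%:R) m0).2 hm.
have ha : a_ n @[n --> \oo] --> (1 : R).
  have h : ((m_ n)%:R^-1 * ((m_ n)%:R * (a_ n - 1)) + 1) @[n --> \oo] --> (0 * p + 1 : R).
    by apply: cvgD; [exact: cvgM|exact: cvg_cst].
  rewrite mul0r add0r in h; apply: cvg_trans h; apply: near_eq_cvg.
  by near=> n; rewrite mulKf ?subrK// gt_eqF//; near: n.
have hb : b_ n @[n --> \oo] --> (0 : R).
  have h : ((m_ n)%:R^-1 * ((m_ n)%:R * b_ n)) @[n --> \oo] --> 0 * q by exact: cvgM.
  rewrite mul0r in h; apply: cvg_trans h; apply: near_eq_cvg.
  by near=> n; rewrite mulKf// gt_eqF//; near: n.
have a0 : \forall n \near \oo, 0 < a_ n by apply: (cvgr_gt _ ha); exact: ltr01.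
pose u n := a_ n ^+ 2 + b_ n ^+ 2.
have hu : u n @[n --> \oo] --> (1 : R).
  rewrite -[X in _ --> X](_ : 1 * 1 + 0 * 0 = 1); last by rewrite mulr1 mulr0 addr0.
  by rewrite /u; under eq_fun do rewrite !expr2; apply: cvgD; exact: cvgM.
have hmu : (m_ n)%:R * (u n - 1) @[n --> \oo] --> 2 * p.
  have -> : (fun n => (m_ n)%:R * (u n - 1)) =
      (fun n => (m_ n)%:R * (a_ n - 1) * (a_ n + 1) + (m_ n)%:R * b_ n * b_ n).
    by apply/funext => n; rewrite /u; ring.
  rewrite [X in _ --> X](_ : _ = p * (1 + 1) + q * 0); last by ring.
  apply: cvgD; apply: cvgM => //; apply: cvgD => //; exact: cvg_cst.
have hln : (m_ n)%:R * ln (u n) @[n --> \oo] --> 2 * p.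
  have h1 : ((m_ n)%:R * (u n - 1) * (u n)^-1) @[n --> \oo] --> 2 * p * 1^-1.
    by apply: cvgM => //; apply: cvgV => //; exact: oner_neq0.
  rewrite invr1 mulr1 in h1.
  apply: (squeeze_cvgr _ h1 hmu); near=> n.
  have u0 : 0 < u n by near: n; apply: (cvgr_gt _ hu); exact: ltr01.
  have /andP[l1 l2] := ln_bounds u0.
  have mn : 0 <= (m_ n)%:R :> R by [].
  rewrite -mulrA mulrBl mulfV ?gt_eqF// mul1r !ler_wpM2l//.
pose x n := b_ n / a_ n.
have hmx : (m_ n)%:R * x n @[n --> \oo] --> q.
  rewrite -[X in _ --> X](_ : q * 1^-1 = q); last by rewrite invr1 mulr1.
  rewrite /x; under eq_fun do rewrite mulrA.
  by apply: cvgM => //; apply: cvgV => //; exact: oner_neq0.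
have hx : x n @[n --> \oo] --> (0 : R).
  rewrite -[X in _ --> X](_ : 0 * 1^-1 = 0 :> R); last by rewrite mul0r.
  by apply: cvgM => //; apply: cvgV => //; exact: oner_neq0.
have /choice[k hk] : forall n, exists k, atan (x n) = x n * k /\ (1 + x n ^+ 2)^-1 <= k <= 1.
  by move=> n; exact: atan_bounds.
have hk1 : k n @[n --> \oo] --> (1 : R).
  have h1 : (1 + x n ^+ 2)^-1 @[n --> \oo] --> ((1 + 0 * 0)^-1 : R).
    apply: cvgV; first by rewrite mulr0 addr0 oner_neq0.
    by apply: cvgD; [exact: cvg_cst|under eq_fun do rewrite expr2; exact: cvgM].
  rewrite mulr0 addr0 invr1 in h1.
  by apply: (squeeze_cvgr _ h1 (cvg_cst (1 : R))); apply: nearW => n; exact: (hk n).2.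
have hth : (m_ n)%:R * atan (x n) @[n --> \oo] --> q.
  rewrite -[X in _ --> X]mulr1; under eq_fun do rewrite (hk _).1 mulrA.
  exact: cvgM.
have lim : expR (2^-1 * ((m_ n)%:R * ln (u n))) * cos ((m_ n)%:R * atan (x n)) @[n --> \oo] --> expR p * cos q.
  apply: cvgM.
    have h : 2^-1 * ((m_ n)%:R * ln (u n)) @[n --> \oo] --> p.
      by rewrite -[X in _ --> X](mulKf (_ : 2 != 0 :> R)) ?pnatr_eq0//; apply: cvgMr.
    by apply: (@cvg_comp _ _ _ _ expR _ _ _ h); exact: continuous_expR.
  by apply: (@cvg_comp _ _ _ _ cos _ _ _ hth); exact: continuous_cos.
apply: cvg_trans lim; apply: near_eq_cvg; near=> n.
have an : 0 < a_ n by near: n.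
set th := atan (x n).
have c0 : 0 < cos th by apply: cos_gt0_pihalf; rewrite atan_gtNpi2 atan_ltpi2.
pose r := a_ n / cos th.
have r0 : 0 < r by rewrite divr_gt0.
have aE : a_ n = r * cos th by rewrite /r divfK// gt_eqF.
have bE : b_ n = r * sin th.
  have -> : sin th = tan th * cos th by rewrite /tan divfK// gt_eqF.
  by rewrite /th atanK mulrCA -aE /x divfK// gt_eqF.
have uE : u n = r ^+ 2.
  by rewrite /u aE bE !exprMn -mulrDr cos2Dsin2 mulr1.
rewrite aE bE cs_pow_polar /=; congr (_ * _).
have -> : 2^-1 * ((m_ n)%:R * ln (u n)) = (m_ n)%:R * ln r.
  by rewrite uE lnXn// mulr2n; field.
by rewrite expRM_natl lnK.
Unshelve. all: by end_near. Qed.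

End PolarLimit.

Section AlmostSureEquality.
Context {R : realType} d (T : measurableType d) (P : probability T R) (S : set T).
Hypothesis mS : measurable S.
Hypothesis nS : P (~` S) = 0%E.

Lemma Rintegral_eq_on (f g : T -> R) :
  measurable_fun setT f -> measurable_fun setT g -> {in S, f =1 g} ->
  \int[P]_x f x = \int[P]_x g x.
Proof.
move=> mf mg fg; congr fine; apply: ae_eq_integral => //; try exact/measurable_EFinP.
exists (~` S); split => //; first exact: measurableC.
by move=> x /= h Sx; apply: h => _; rewrite fg// inE.
Qed.

Lemma prob_eq_on (A B : set T) : measurable A -> measurable B ->
  A `&` S = B `&` S -> P A = P B.
Proof.
have h (A' : set T) : measurable A' -> P A' = P (A' `&` S).
  move=> mA; rewrite -{1}(setUIDK A' S) measureU//; [|exact: measurableI|exact: measurableD|].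
    have h0 : P (A' `\` S) = 0%E.
      by apply: (subset_measure0 _ _ _ nS); [exact: measurableD|exact: measurableC|move=> x []].
    by rewrite [X in (_ + X)%E]h0 adde0.
  by rewrite setDE setIACA setICr setI0.
by move=> mA mB AB; rewrite h// AB -h.
Qed.

End AlmostSureEquality.

Lemma Rintegral_lin {R : realType} d (T : measurableType d) (P : probability T R)
    (u v : T -> R) (a b C : R) :
  measurable_fun setT u -> measurable_fun setT v ->
  (forall x, `|u x| <= C) -> (forall x, `|v x| <= C) ->
  \int[P]_x (a * u x + b * v x) = a * \int[P]_x u x + b * \int[P]_x v x.
Proof.
move=> mu mv uC vC.
have iZ (k : R) (w : T -> R) : measurable_fun setT w -> (forall x, `|w x| <= C) ->
    P.-integrable setT (EFin \o (fun y => k * w y)) /\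
    \int[P]_x (k * w x) = k * \int[P]_x w x.
  move=> mw wC; have iw := integrable_bounded P mw wC; split; last by rewrite RintegralZl.
  by have := @integrableZl _ _ _ P setT measurableT k _ iw; apply: eq_integrable.
have [i1 <-] := iZ a _ mu uC; have [i2 <-] := iZ b _ mv vC.
by rewrite RintegralD.
Qed.

Section SumLaw.
Context {R : realType}.
Local Notation RR := (measurableTypeR R).
Variable D : probability RR R.

(* [sum_law m] is the law of a sum of [m] independent variables of law [D]. *)
Definition addp (z : RR * RR) : RR := z.1 + z.2.

Lemma measurable_addp : measurable_fun setT addp.
Proof. exact: measurable_funD. Qed.

HB.instance Definition _ := isMeasurableFun.Build _ _ _ _ addp measurable_addp.

Fixpoint sum_law (m : nat) : probability RR R :=
  if m is m'.+1 then distribution (sum_law m' \x D)%E addp else dirac (0 : RR).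

Definition shift_mean (g : RR -> R) (x : RR) : R := \int[D]_y g ((x : R) + (y : R)).

Lemma sum_law_succ (m : nat) (g : RR -> R) (C : R) :
  measurable_fun setT g -> (forall x, `|g x| <= C) ->
  measurable_fun setT (shift_mean g) /\
  \int[sum_law m.+1]_x g x = \int[sum_law m]_x shift_mean g x.
Proof.
move=> mg gC.
have mgp : measurable_fun setT (g \o addp) by exact: (measurableT_comp mg measurable_addp).
have ip : (sum_law m \x D)%E.-integrable setT (EFin \o (g \o addp)).
  by apply: (@integrable_bounded _ _ _ _ _ C) => // z; exact: gC.
have iy (x : RR) : D.-integrable setT (EFin \o (fun y : RR => g ((x : R) + (y : R)))).
  apply: (@integrable_bounded _ _ _ _ _ C) => //.
  exact: (measurableT_comp mgp (measurable_pair1 x)).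
have E (x : RR) : (\int[D]_y (g ((x : R) + (y : R))%R)%:E = (shift_mean g x)%:E)%E.
  by rewrite /shift_mean /Rintegral fineK//; exact: (@integrable_fin_num _ _ _ _ _ measurableT _ (iy x)).
split.
  have := measurable_fubini_F ip; rewrite /fubini_F.
  have -> : (fun x => \int[D]_y (EFin \o (g \o addp)) (x, y))%E =
      EFin \o shift_mean g.
    by apply/funext => x; exact: E.
  by move/measurable_EFinP.
congr fine; rewrite [LHS](@integral_distribution _ _ _ _ _ (sum_law m \x D)%E addp (EFin \o g))//; last first.
  exact/measurable_EFinP.
rewrite -(integral12_prod_meas1 ip); apply: eq_integral => x _; exact: E.
Qed.

Lemma shift_mean_cos_sin (t : R) (x : RR) :
  shift_mean (fun y => cos (t * y)) x =
    cos (t * x) * \int[D]_y cos (t * y) - sin (t * x) * \int[D]_y sin (t * y) /\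
  shift_mean (fun y => sin (t * y)) x =
    sin (t * x) * \int[D]_y cos (t * y) + cos (t * x) * \int[D]_y sin (t * y).
Proof.
have mc : measurable_fun setT (fun y : RR => cos (t * y)) by exact: measurable_cosM.
have ms : measurable_fun setT (fun y : RR => sin (t * y)).
  by apply: (measurableT_comp measurable_sin); exact: measurable_funM.
have C1 (y : RR) := normr_cos_le1 (t * y); have S1 (y : RR) := normr_sin_le1 (t * y).
split.
  rewrite -mulNr -(Rintegral_lin D (cos (t * x)) (- sin (t * x)) mc ms C1 S1).
  by apply: eq_Rintegral => y _; rewrite mulrDr cosD mulNr.
rewrite -(Rintegral_lin D (sin (t * x)) (cos (t * x)) mc ms C1 S1).
by apply: eq_Rintegral => y _; rewrite mulrDr sinD.
Qed.

Lemma sum_law_cos_sin (t : R) m :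
  (\int[sum_law m]_x cos (t * x), \int[sum_law m]_x sin (t * x)) =
  cs_pow (\int[D]_y cos (t * y)) (\int[D]_y sin (t * y)) m.
Proof.
have mc : measurable_fun setT (fun y : RR => cos (t * y)) by exact: measurable_cosM.
have ms : measurable_fun setT (fun y : RR => sin (t * y)).
  by apply: (measurableT_comp measurable_sin); exact: measurable_funM.
elim: m => [|m ih].
  rewrite /= /Rintegral !integral_dirac//; try exact/measurable_EFinP.
  by rewrite !diracT !mul1e /= mulr0 cos0 sin0.
have C1 (y : RR) := normr_cos_le1 (t * y); have S1 (y : RR) := normr_sin_le1 (t * y).
have [_ ->] := sum_law_succ m mc C1.
have [_ ->] := sum_law_succ m ms S1.
have lin a b := Rintegral_lin (sum_law m) a b mc ms C1 S1.
rewrite /cs_pow -/cs_pow -ih /=; congr (_, _).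
  rewrite ![_ * \int[D]__ _]mulrC -mulNr -lin; apply: eq_Rintegral => x _.
  by rewrite (shift_mean_cos_sin t x).1 mulNr ![\int[D]__ _ * _]mulrC.
rewrite ![_ * \int[D]__ _]mulrC addrC -lin; apply: eq_Rintegral => x _.
by rewrite (shift_mean_cos_sin t x).2 addrC ![\int[D]__ _ * _]mulrC.
Qed.

Variable f : nat -> R.
Hypothesis Hf : prob_sequence f.
Hypothesis HD : forall j : nat, D [set j.+1%:R] = (f j)%:E.

Definition nats : set RR := range (fun j : nat => j%:R).
Definition pos_nats : set RR := \bigcup_(j : nat) [set j.+1%:R : R].

Lemma measurable_pt (x : R) : measurable ([set x] : set RR).
Proof. exact: measurable_set1. Qed.

Lemma measurable_pos_nats : measurable pos_nats.
Proof. by apply: bigcup_measurable => j _; exact: measurable_pt. Qed.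

Lemma measurable_nats : measurable nats.
Proof.
rewrite (_ : nats = \bigcup_(j : nat) [set j%:R : R]).
  by apply: bigcup_measurable => j _; exact: measurable_pt.
apply/seteqP; split => x; first by move=> [j _ <-]; exists j.
by move=> [j _ ->]; exists j.
Qed.

Lemma pos_nats_full : D (~` pos_nats) = 0%E.
Proof.
rewrite probability_setC; last exact: measurable_pos_nats.
have -> : D pos_nats = 1%E.
  have mF (i : nat) : setT i -> measurable ([set i.+1%:R : R] : set RR).
    by move=> _; exact: measurable_pt.
  have tF : trivIset setT (fun i : nat => [set i.+1%:R : R]).
    by move=> i i' _ _ [x [/= -> /eqP]]; rewrite eqr_nat => /eqP[].
  rewrite -Hf.2 [LHS](@measure_bigcup _ _ _ D setT _ mF tF).
  by rewrite eseries_mkcond; apply: eq_eseriesr => i _; rewrite in_setT; exact: HD.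
by rewrite subee.
Qed.

Lemma sum_law_nats m : sum_law m (~` nats) = 0%E.
Proof.
have mn := measurable_nats; have mnC : measurable (~` nats) by exact: measurableC.
elim: m => [|m ih].
  by rewrite /= diracE memNset//=; apply; exists 0%N.
have mi : measurable_fun setT (\1_(~` nats) : RR -> R) by exact: measurable_indic.
have bi (x : RR) : `|\1_(~` nats) x : R| <= 1.
  by rewrite indicE; case: (_ \in _); rewrite ?normr1 ?normr0.
have [ms h] := sum_law_succ m mi bi.
rewrite Rintegral_indic// in h.
rewrite -[LHS]fineK ?fin_num_measure// h (@Rintegral_eq_on _ _ _ (sum_law m) nats mn ih _ (fun=> 0))//.
  by rewrite Rintegral_prob_cst.
move=> x; rewrite inE => -[i _ <-].
rewrite /shift_mean (@Rintegral_eq_on _ _ _ D _ measurable_pos_nats pos_nats_full _ (fun=> 0))//.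
- by rewrite Rintegral_prob_cst.
- by apply: (measurableT_comp mi); exact: measurable_funD.
move=> y; rewrite inE => -[j _ ->].
by rewrite indicE memNset//=; apply; exists (i + j.+1)%N => //; rewrite natrD.
Qed.

(** Convolution with the law of one step: length j - i has mass f (j - i - 1), because P(tau = k) =
    f_(k-1). The return times of the chain obey the same recursion, which is how the two are
    identified. *)
Lemma sum_law_pmf m (j : nat) :
  fine (sum_law m.+1 [set j%:R]) = \sum_(i < j) fine (sum_law m [set i%:R]) * f (j - i.+1).
Proof.
have mi : measurable_fun setT (\1_[set j%:R] : RR -> R) by exact: measurable_indic.
have bi (x : RR) : `|\1_[set j%:R] x : R| <= 1.
  by rewrite indicE; case: (_ \in _); rewrite ?normr1 ?normr0.
have [ms h] := sum_law_succ m mi bi.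
rewrite Rintegral_indic// in h; rewrite h.
have mS (s : seq nat) : measurable_fun setT (fun x : RR => \sum_(i <- s) \1_[set i%:R] x * f (j - i.+1)).
  by apply: measurable_sum => i; apply: measurable_funM => //; exact: measurable_indic.
have iS (i : nat) : (sum_law m).-integrable setT (EFin \o (fun x : RR => \1_[set i%:R] x * f (j - i.+1))).
  have := @integrableZr _ _ _ (sum_law m) setT measurableT (f (j - i.+1)) _ (integrable_indic_prob (sum_law m) (measurable_pt i%:R)).
  by apply: eq_integrable.
(* Only the values on [nats], a set of full mass, matter; there the shifted mean is a finite
   combination of indicators. *)
rewrite (@Rintegral_eq_on _ _ _ (sum_law m) nats measurable_nats (sum_law_nats m) _ (fun x : RR => \sum_(i <- index_iota 0 j) \1_[set i%:R] x * f (j - i.+1)))//; last first.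
  move=> x; rewrite inE => -[i _ <-].
  have mi' : measurable_fun setT (fun y : RR => \1_[set j%:R] (i%:R + (y : R)) : R).
    by apply: (measurableT_comp mi); exact: measurable_funD.
  have [ij|ji] := ltnP i j.
    rewrite (bigD1_seq i) ?mem_index_iota ?iota_uniq//= big1 => [|i' /negbTE ii']; last first.
      by rewrite indicE memNset ?mul0r//= => /eqP; rewrite eqr_nat eq_sym ii'.
    rewrite indicE mem_set// mul1r addr0 /shift_mean.
    rewrite (@Rintegral_eq_on _ _ _ D setT measurableT _ _ (\1_[set (j - i.+1).+1%:R]))//.
    - by rewrite Rintegral_indic// [X in fine X]HD.
    - by rewrite setCT measure0.
    move=> y _; rewrite !indicE; congr (_ (nat_of_bool _)).
    have jE : j%:R = i%:R + (j - i.+1).+1%:R :> R by rewrite -natrD addnS -addSn subnKC.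
    by rewrite jE; apply/idP/idP; rewrite !inE /=; [move=> /addrI|move=> ->].
  rewrite big1_seq => [|i']; last first.
    rewrite mem_index_iota => /andP[_ ij].
    rewrite indicE memNset ?mul0r//= => /eqP; rewrite eqr_nat => /eqP ii'.
    by move: ij; rewrite -ii' ltnNge ji.
  rewrite /shift_mean (@Rintegral_eq_on _ _ _ D _ measurable_pos_nats pos_nats_full _ (fun=> 0))//.
    by rewrite Rintegral_prob_cst.
  move=> y; rewrite inE => -[l _ ->]; rewrite indicE memNset//= -natrD => /eqP.
  by rewrite eqr_nat => /eqP h'; move: ji; rewrite -h' -ltnS addnS ltnNge leq_addr.
rewrite -(big_mkord xpredT (fun i => fine (sum_law m [set i%:R]) * f (j - i.+1))).
suff : (sum_law m).-integrable setT (EFin \o (fun x : RR => \sum_(i <- index_iota 0 j) \1_[set i%:R] x * f (j - i.+1))) /\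
  \int[sum_law m]_x (\sum_(i <- index_iota 0 j) \1_[set i%:R] x * f (j - i.+1)) =
  \sum_(i <- index_iota 0 j) fine (sum_law m [set i%:R]) * f (j - i.+1) by case.
elim: (index_iota 0 j) => [|i s [ih1 ih2]].
  split; last by rewrite big_nil; under eq_Rintegral do rewrite big_nil; rewrite Rintegral_prob_cst.
  apply: (@integrable_bounded _ _ _ _ _ 0) => [|x]; first exact: mS.
  by rewrite big_nil normr0.
split.
  have := @integrableD _ _ _ (sum_law m) setT measurableT _ _ (iS i) ih1.
  by apply: eq_integrable => // x _; rewrite /= big_cons EFinD.
under eq_Rintegral do rewrite big_cons.
rewrite (RintegralD measurableT (iS i) ih1) ih2 big_cons; congr (_ + _).
rewrite RintegralZr//; last by apply: integrable_indic_prob; exact: measurable_pt.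
by rewrite Rintegral_indic//; exact: measurable_pt.
Qed.

Lemma sum_law0 (j : nat) : fine (sum_law 0 [set j%:R]) = (j == 0)%:R.
Proof.
rewrite (_ : sum_law 0 _ = \d_(0 : RR) [set j%:R : R])// diracE.
case: j => [|j] /=; first by rewrite mem_set.
by rewrite memNset// => /eqP; rewrite eq_sym pnatr_eq0.
Qed.

Lemma sum_law_le m (N : nat) :
  fine (sum_law m [set x : RR | `|x : R| <= N%:R]) =
  \sum_(j < N.+1) fine (sum_law m [set j%:R]).
Proof.
have mle (a : R) : measurable [set x : RR | `|x : R| <= a] by exact: measurable_norm_le.
elim: N => [|N ih].
  rewrite big_ord1; congr (fine (sum_law m _)); apply/seteqP; split => x /=.
    by rewrite normr_le0 => /eqP.
  by move=> ->; rewrite normr0.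
have fin (A : set RR) : measurable A -> sum_law m A \is a fin_num by exact: fin_num_measure.
have dis : [set x : RR | `|x : R| <= N%:R] `&` [set N.+1%:R] = set0.
  rewrite -subset0 => x /= [h xE].
  by move: h; rewrite xE ger0_norm// ler_nat ltnn.
have mp := measurable_pt N.+1%:R.
have mU := measureU (sum_law m) (mle N%:R) mp dis.
rewrite big_ord_recr /= -ih -(fineD (fin _ (mle _)) (fin _ mp)) -[in RHS]mU.
have mU' := measurableU _ _ (mle N%:R) mp.
congr fine; apply: (prob_eq_on measurable_nats (sum_law_nats m)) => //.
apply/seteqP; split => x /= [].
  move=> h [i _ xE]; split; last by exists i.
  have h' : `|i%:R : R| <= N.+1%:R by rewrite xE.
  rewrite ger0_norm// ler_nat leq_eqVlt in h'.
  case/orP: h' => [/eqP iN|iN]; first by right; rewrite -xE iN.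
  by left; rewrite -xE; have : `|i%:R : R| <= N%:R by rewrite ger0_norm// ler_nat.
move=> h [i _ xE]; split; last by exists i.
case: h => [h|->]; last by have : `|N.+1%:R : R| <= N.+1%:R by rewrite ger0_norm.
by apply: (le_trans h); rewrite ler_nat.
Qed.

End SumLaw.

Lemma prob_disjoint_ord {R : realType} d (T : measurableType d) (P : probability T R)
    (A : set T) (F : nat -> set T) n :
  (forall i, measurable (F i)) ->
  (forall w, A w <-> exists2 i, (i < n)%N & F i w) ->
  (forall w i j, (i < n)%N -> (j < n)%N -> F i w -> F j w -> i = j) ->
  measurable A /\ fine (P A) = \sum_(i < n) fine (P (F i)).
Proof.
move=> mF AE dF.
have -> : A = \big[setU/set0]_(i < n) F i.
  rewrite -bigcup_mkord; apply/seteqP; split => w /=.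
    by move=> /AE[i ni Fi]; exists i.
  by move=> [i ni Fi]; apply/AE; exists i.
split; first exact: bigsetU_measurable.
rewrite (@measure_semi_additive_ord_I _ _ _ P F n)//; last first.
- exact: bigsetU_measurable.
- by move=> i j /= ni nj [w [Fi Fj]]; exact: (dF w).
rewrite (eq_bigr (fun i : 'I_n => (fine (P (F i)))%:E)) ?sumEFin// => i _.
by rewrite fineK// fin_num_measure.
Qed.

(** * The renewal chain *)

Section RenewalVisits.
Context {R : realType} (f : nat -> R) d (T : measurableType d) (P : probability T R).
Variable X : nat -> {RV P >-> nat}.
Hypothesis HX : markov_chain_from 0 (renewal_transition f) X.
Local Notation p := (renewal_transition f).

(** Encodes that [A] depends only on the path up to time [n]; measurability is obtained in
    [markov_step]. *)
Definition determined_by n (A : set T) :=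
  forall w w', (forall i, (i <= n)%N -> X i w = X i w') -> A w -> A w'.

Lemma measurable_state i (v : nat) : measurable [set w | X i w = v].
Proof.
have := measurable_funPTI (X i) (_ : measurable [set v]).
by apply.
Qed.

Lemma measurable_cylinder n (s : nat -> nat) :
  measurable [set w | forall i, (i <= n)%N -> X i w = s i].
Proof.
rewrite (_ : [set _ | _] = \bigcap_(i in [set i | (i <= n)%N]) [set w | X i w = s i]).
  by apply: bigcap_measurable => [|i _]; [exists 0%N|exact: measurable_state].
by apply/seteqP; split => w /= h i; exact: h.
Qed.

Definition history n w : (n.+1).-tuple nat := [tuple X i w | i < n.+1].

Lemma historyP n w (t : (n.+1).-tuple nat) :
  history n w = t <-> forall i, (i <= n)%N -> X i w = nth 0%N t i.
Proof.
split=> [<- i ni|h].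
  by rewrite (_ : i = Ordinal (ni : (i < n.+1)%N))// -tnth_nth tnth_mktuple.
apply: eq_from_tnth => i; rewrite tnth_mktuple (tnth_nth 0%N) h//.
by rewrite -ltnS.
Qed.

(** The state space is countable, so there are countably many histories up to time [n]: [A] splits
    into cylinders, to each of which the defining property of the chain applies. *)
Lemma markov_step n (A : set T) (a b : nat) :
  determined_by n A -> (forall w, A w -> X n w = a) ->
  measurable A /\ P (A `&` [set w | X n.+1 w = b]) = (P A * (p a b)%:E)%E.
Proof.
move=> dA Aa.
pose F i := A `&` [set w | pickle (history n w) = i].
have AE : A = \bigcup_i F i.
  apply/seteqP; split => [w Aw|w [i _ []]//].
  by exists (pickle (history n w)).
have FE i : F i = set0 \/ exists s : nat -> nat, s n = a /\
    F i = [set w | forall j, (j <= n)%N -> X j w = s j].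
  have [F0|/set0P[w0 [A0 /= u0]]] := eqVneq (F i) set0; [by left|right].
  exists (fun j => X j w0); split; first exact: Aa.
  have h0 w : pickle (history n w) = i <-> forall j, (j <= n)%N -> X j w = X j w0.
    have w0E := (historyP w0 (history n w0)).1 erefl.
    rewrite -u0; split => [/(pcan_inj pickleK)/historyP h j jn|h]; first by rewrite h// w0E.
    by congr pickle; apply/historyP => j jn; rewrite h// w0E.
  apply/seteqP; split => w /=; first by move=> [_ /h0].
  by move=> h; split; [apply: dA A0 => j jn; rewrite h|exact/h0].
have mF i : measurable (F i).
  by have [->|[s [_ ->]]] := FE i => //; exact: measurable_cylinder.
have tF : trivIset setT F.
  by move=> i j _ _ [w [[_ /= <-] [_ /= <-]]].
have mb := measurable_state n.+1 b.
split; first by rewrite AE; exact: bigcupT_measurable.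
have FP i : P (F i `&` [set w | X n.+1 w = b]) = (P (F i) * (p a b)%:E)%E.
  have [->|[s [sa ->]]] := FE i; first by rewrite set0I !measure0 mul0e.
  pose s' j := if j == n.+1 then b else s j.
  have := HX.2 n s'; rewrite {3 4}/s' eqxx ltn_eqF// sa.
  rewrite (_ : [set w | forall i, (i <= n)%N -> X i w = s' i] =
    [set w | forall i, (i <= n)%N -> X i w = s i]); last first.
    by apply/seteqP; split => w /= h j jn; rewrite h// /s' ltn_eqF// ltnS.
  move=> <-; congr (P _); apply/seteqP; split => w /=.
    move=> [h1 h2] j; rewrite leq_eqVlt /s' => /orP[/eqP ->|jn]; first by rewrite eqxx.
    by rewrite ltn_eqF// h1.
  move=> h; split; last by rewrite h// /s' eqxx.
  by move=> j jn; rewrite h ?(leq_trans jn)// /s' ltn_eqF// ltnS.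
rewrite AE setI_bigcupl.
rewrite measure_semi_bigcup//; last first.
- by apply: bigcupT_measurable => i; exact: measurableI.
- by apply: trivIset_setIr.
- by move=> i; exact: measurableI.
transitivity (\sum_(0 <= i <oo) ((p a b)%:E * P (F i)))%E.
  by apply: eq_eseriesr => i _; rewrite muleC; exact: FP.
rewrite nneseriesZl// muleC; congr (_ * _)%E.
by rewrite measure_semi_bigcup//; exact: bigcupT_measurable.
Qed.

(** Transitions of probability 1 hold only almost surely; on this event of full mass the path is
    deterministic as long as it is away from 0. *)
Definition descends : set T := [set w | forall u, X u w <> 0%N -> X u.+1 w = (X u w).-1].

Lemma descends_full : measurable descends /\ P (~` descends) = 0%E.
Proof.
pose B u a b := if b == a then set0 else [set w | X u w = a.+1] `&` [set w | X u.+1 w = b].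
have BE : ~` descends = \bigcup_u \bigcup_a \bigcup_b B u a b.
  apply/seteqP; split => [w /= /existsNP[u /not_implyP[/eqP Xu h]]|w].
    exists u => //; exists (X u w).-1 => //; exists (X u.+1 w) => //.
    rewrite /B; case: eqP => [//|_]; split => //=; by rewrite prednK// lt0n.
  move=> [u _ [a _ [b _]]]; rewrite /B; case: eqP => // ba [/= h1 h2] /(_ u).
  by rewrite h1 h2 => h; apply: ba; exact: h.
have mB u a b : measurable (B u a b).
  by rewrite /B; case: eqP => // _; apply: measurableI; exact: measurable_state.
have mC : measurable (~` descends).
  rewrite BE; apply: bigcupT_measurable => u; apply: bigcupT_measurable => a.
  exact: bigcupT_measurable.
split; first by rewrite -(setCK descends); exact: measurableC.
apply/negligibleP => //; rewrite BE.
apply: negligible_bigcup => u; apply: negligible_bigcup => a; apply: negligible_bigcup => b.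
have hd : determined_by u [set w | X u w = a.+1] by move=> w w' h /= <-; rewrite h.
have [_ h] := @markov_step u _ a.+1 b hd (fun w h => h).
have := mB u a b; rewrite /B; case: eqP => [_ _|/eqP/negbTE ba mI].
  exact: negligible_set0.
by apply/negligibleP => //; apply: (eq_trans h); rewrite /= ba mule0.
Qed.

(** The event T_m = j for the m-th return time, with T_0 = 0: [visits] counts the times 0, ..., j -
    1, among them the start. *)
Definition renewal_event m j : set T := [set w | visits X j w = m /\ X j w = 0%N].

Lemma visits_eq j w w' : (forall i, (i < j)%N -> X i w = X i w') -> visits X j w = visits X j w'.
Proof. by move=> h; apply: eq_bigr => i _; rewrite h. Qed.

Lemma visitsS j w : visits X j.+1 w = (visits X j w + (X j w == 0%N))%N.
Proof. by rewrite /visits big_ord_recr. Qed.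

Lemma determined_renewal_event m j : determined_by j (renewal_event m j).
Proof.
move=> w w' h [h1 h2]; split; last by rewrite -h.
by rewrite -h1; apply/esym/visits_eq => i ij; rewrite h// ltnW.
Qed.

Lemma measurable_renewal_event m j : measurable (renewal_event m j).
Proof.
by have [] := @markov_step j _ 0%N 0%N (@determined_renewal_event m j) (fun w h => h.2).
Qed.

Definition excursion m i l b : set T := renewal_event m i `&`
  [set w | (forall u, (i < u <= i + l)%N -> X u w <> 0%N) /\ X (i + l).+1 w = b].

(** Almost surely the chain jumps from 0 to b + l at time i + 1 and then descends to b, so only the
    jump carries probability. The end state [b] stays general because the induction on [l] passes
    from (l, b + 1) to (l + 1, b). *)
Lemma excursion_prob m i l b :
  measurable (excursion m i l b) /\
  P (excursion m i l b) = (P (renewal_event m i) * (f (b + l))%:E)%E.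
Proof.
have det l' b' : determined_by (i + l').+1 (excursion m i l' b').
  move=> w w' h [h1 [h2 h3]]; split.
    by apply: determined_renewal_event h1 => u ui; apply: h; rewrite (leq_trans ui)// leqW// leq_addr.
  split; last by rewrite -h.
  by move=> u /andP[ui uil]; rewrite -h ?(leqW uil)//; apply: h2; rewrite ui.
have mE l' b' : measurable (excursion m i l' b').
  by have [] := @markov_step _ _ b' 0%N (det l' b') (fun w h => h.2.2).
split => //.
elim: l b => [|l ih] b.
  have [_ /= h] := @markov_step i _ 0%N b (@determined_renewal_event m i) (fun w h => h.2).
  rewrite addn0; apply: (eq_trans _ h); congr (P _); apply/seteqP; split => w /=.
    by move=> [h1 [_ h2]]; split=> //; rewrite addn0 in h2.
  move=> [h1 h2]; split => //; split; last by rewrite addn0.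
  by move=> u /andP[h3]; rewrite addn0 leqNgt h3.
have [mD nD] := descends_full.
have [_ h] := @markov_step _ _ b.+1 b (det l b.+1) (fun w h => h.2.2).
rewrite addnS -addSn -ih.
rewrite /= eqxx mule1 in h; rewrite -h.
(* On [descends], being nonzero at time i + l + 1 and at [b] one step later is the same as being at
   b + 1 and then at b. *)
apply: (prob_eq_on mD nD) => //.
  by apply: measurableI => //; exact: measurable_state.
apply/seteqP; split => w [].
  move=> [hr [hz hX]] hd; split=> //; split; last by move: hX; rewrite addnS.
  have hz' : X (i + l).+1 w <> 0%N by apply: hz; rewrite addnS ltnS leq_addr leqnn.
  split => //; split.
    by move=> u /andP[h1 h2]; apply: hz; rewrite h1 addnS leqW.
  by move: hX; rewrite addnS (hd _ hz') => <-; rewrite prednK// lt0n; exact/eqP.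
move=> [[hr [hz hX]] hX2] hd; split=> //; split=> //; split; last by rewrite addnS.
move=> u; rewrite addnS => /andP[h1]; rewrite leq_eqVlt => /orP[/eqP ->|h2].
  by rewrite hX.
by apply: hz; rewrite h1.
Qed.

(** Decomposition by the last visit [i] before [j], after which a single excursion leads back to 0
    at time [j]. *)
Lemma renewal_event_succ m j :
  fine (P (renewal_event m.+1 j)) =
  \sum_(i < j) fine (P (renewal_event m i)) * f (j - i.+1).
Proof.
rewrite (@prob_disjoint_ord _ _ _ _ _ (fun i => excursion m i (j - i.+1) 0) j _ _ _).2.
- apply: eq_bigr => i _; rewrite (excursion_prob _ _ _ _).2 fineM//.
  exact/fin_num_measure/measurable_renewal_event.
- by move=> i; have [] := excursion_prob m i (j - i.+1) 0.
- move=> w; split.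
    move=> [hv hj].
    have : exists i, (i < j)%N && (X i w == 0%N).
      apply: contrapT => h; move: hv; rewrite /visits big1// => i _.
      apply/eqP; rewrite eqb0; apply/negP => Xi; apply: h; exists i.
      by rewrite ltn_ord.
    move=> ex; case: (ex_maxnP ex (m := j) _) => [i /andP[/ltnW]//|i /andP[ij /eqP Xi] hi].
    have jE : (i + (j - i.+1)).+1 = j by rewrite -addSn subnKC.
    exists i => //; split; last first.
      rewrite jE; split => //; move=> u /andP[iu]; rewrite -ltnS jE => uj Xu.
      by have := hi u; rewrite uj Xu => /(_ isT); rewrite leqNgt iu.
    split => //; apply/eqP; rewrite -eqSS -hv; apply/eqP.
    rewrite -[in RHS]jE.
    have : (j - i.+1 <= j - i.+1)%N by [].
    elim: {1 3}(j - i.+1)%N => [|l ih] hl; first by rewrite addn0 visitsS Xi eqxx addn1.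
    rewrite addnS visitsS -ih 1?ltnW// -[LHS]addn0; congr addn.
    apply/esym/eqP; rewrite eqb0; apply/negP => Xu.
    have := hi (i + l).+1; rewrite Xu andbT.
    rewrite -[X in (_ < X)%N]jE ltnS ltn_add2l hl => /(_ isT).
    by rewrite ltnNge leq_addr.
  move=> [i ij [[hv Xi] [hz hX]]].
  have jE : (i + (j - i.+1)).+1 = j by rewrite -addSn subnKC.
  rewrite jE in hX; split => //.
  rewrite -jE; have : (j - i.+1 <= j - i.+1)%N by [].
  elim: {1 3}(j - i.+1)%N => [|l ih] hl; first by rewrite addn0 visitsS Xi eqxx addn1 hv.
  rewrite addnS visitsS ih 1?ltnW// -[RHS]addn0; congr addn.
  apply/eqP; rewrite eqb0; apply/negP => /eqP; apply: hz.
  by rewrite ltnS leq_addr ltn_add2l.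
- move=> w i i' ij ij' [[hv Xi] [hz hX]] [[hv' Xi'] [hz' hX']].
  have jE : (i + (j - i.+1)).+1 = j by rewrite -addSn subnKC.
  have jE' : (i' + (j - i'.+1)).+1 = j by rewrite -addSn subnKC.
  have [h|h|//] := ltngtP i i'.
    by exfalso; apply: (hz i') => //; rewrite h -ltnS jE.
  by exfalso; apply: (hz' i) => //; rewrite h -ltnS jE'.
Qed.

Lemma renewal_event0 j : fine (P (renewal_event 0 j)) = (j == 0%N)%:R.
Proof.
have P0 : P [set w | X 0%N w = 0%N] = 1%E := HX.1.
case: j => [|j].
  rewrite /= (_ : renewal_event 0 0 = [set w | X 0%N w = 0%N]) ?P0//.
  by apply/seteqP; split => w /= [] //; rewrite /renewal_event/= /visits big_ord0.
have m0 := measurable_state 0 0.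
have : P (~` [set w | X 0%N w = 0%N]) = 0%E by rewrite probability_setC// P0 subee.
move=> h0; rewrite /= (@subset_measure0 _ _ _ P _ _ _ _ _ h0)//.
- exact: measurable_renewal_event.
- exact: measurableC.
- move=> w /= [+ _] X0; by rewrite /visits big_ord_recl /= X0 eqxx.
Qed.

(** More than [m] visits before time [n] means T_m < n; the value of T_m is unique because each
    visit raises the counter. *)
Lemma visits_gt_prob n m :
  measurable [set w | (m < visits X n w)%N] /\
  fine (P [set w | (m < visits X n w)%N]) = \sum_(j < n) fine (P (renewal_event m j)).
Proof.
apply: prob_disjoint_ord => [i|w|w i j _ _].
- exact: measurable_renewal_event.
- elim: n => [|n ih]; first by rewrite /= /visits big_ord0; split => // -[].
  split.
    rewrite /= visitsS; case: (eqVneq (X n w) 0%N) => [Xn|Xn].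
      rewrite addn1 ltnS leq_eqVlt => /orP[/eqP mE|h]; first by exists n.
      by have /ih[i ni h'] : (m < visits X n w)%N by []; exists i => //; exact: ltnW.
    rewrite addn0 => h.
    by have /ih[i ni h'] : (m < visits X n w)%N by []; exists i => //; exact: ltnW.
  move=> [j]; rewrite ltnS leq_eqVlt => /orP[/eqP ->|nj] h.
    by rewrite /= visitsS h.1 h.2 addn1.
  have /ih h' : exists2 i, (i < n)%N & renewal_event m i w by exists j.
  by rewrite /= visitsS (leq_trans h')// leq_addr.
- have mono a b : (a <= b)%N -> (visits X a w <= visits X b w)%N.
    move=> ab; rewrite -(subnK ab); elim: (b - a)%N => // l ih.
    by rewrite addSn visitsS (leq_trans ih)// leq_addr.
  move=> [h1 h2] [h3 h4]; have [h|h|//] := ltngtP i j.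
    by have := mono _ _ h; rewrite visitsS h1 h2 h3 addn1 ltnn.
  by have := mono _ _ h; rewrite visitsS h1 h4 h3 addn1 ltnn.
Qed.

Variable D : probability (measurableTypeR R) R.
Hypothesis Hf : prob_sequence f.
Hypothesis HD : forall j : nat, D [set j.+1%:R] = (f j)%:E.

(** T_m and the m-fold sum have the same mass function, by the common recursion and the common start
    at 0; the event is T_m <= n. *)
Lemma visits_sum_law n m :
  fine (P [set w | (m < visits X n.+1 w)%N]) =
  fine (sum_law D m [set x : measurableTypeR R | `|x : R| <= n%:R]).
Proof.
rewrite (visits_gt_prob _ _).2 (sum_law_le Hf HD); apply: eq_bigr => j _.
elim: m (nat_of_ord j) => [|m ih] {}j; first by rewrite renewal_event0 sum_law0.
rewrite renewal_event_succ (sum_law_pmf Hf HD); apply: eq_bigr => i _.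
by rewrite ih.
Qed.

End RenewalVisits.

(** * Regular variation *)

Section UniformConvergence.
Context {R : realType}.
Local Notation leb := (@lebesgue_measure R).

Definition translate (s : R) (x : measurableTypeR R) : measurableTypeR R := (x : R) - s.

Lemma measurable_translate s : measurable_fun setT (translate s).
Proof. by apply: measurable_funB. Qed.

HB.instance Definition _ s :=
  isMeasurableFun.Build _ _ _ _ (translate s) (measurable_translate s).

Lemma lebesgue_measure_translate (s : R) (A : set R) : measurable A ->
  leb (translate s @^-1` A) = leb A.
Proof.
move=> mA; apply/esym.
apply: (@lebesgue_measure_unique _ (pushforward leb (translate s))) => //= _ [[a b]] _ <-.
rewrite /pushforward (_ : translate s @^-1` _ = `]a + s, b + s]%classic); last first.
  by apply/seteqP; split => x /=; rewrite /translate !in_itv/= ltrBrDr lerBlDr.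
by rewrite !lebesgue_measure_itv/= !lte_fin ltrD2r -!EFinB opprD addrACA subrr addr0.
Qed.

Variable h : R -> R.
Hypothesis mh : measurable_fun setT h.
Hypothesis hs : forall s, h (u + s) - h u @[u --> +oo] --> (0 : R).

(** Quantifying over all later indices makes these sets increase with [n]; the pointwise convergence
    [hs] says that they exhaust [0, K] when [v] tends to infinity. *)
Definition stable_set (v : nat -> R) (K e : R) (n : nat) : set R :=
  `[0, K]%classic `&` [set y | forall m, (n <= m)%N -> `|h (v m + y) - h (v m)| <= e].

Lemma measurable_stable_set v K e n : measurable (stable_set v K e n).
Proof.
apply: measurableI; first exact: measurable_itv.
rewrite (_ : [set _ | _] = \bigcap_(m in [set m | (n <= m)%N]) [set y | `|h (v m + y) - h (v m)| <= e]).
  apply: bigcap_measurable => [|m _]; first by exists n => /=.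
  apply: measurable_norm_le; apply: measurable_funB => //.
  by apply: (measurableT_comp mh); exact: measurable_funD.
by apply/seteqP; split => y /= H m; exact: H.
Qed.

Lemma stable_set_large v K e : v n @[n --> \oo] --> +oo -> 0 < K -> 0 < e ->
  \forall n \near \oo, ((3 / 4 * K)%:E < leb (stable_set v K e n))%E.
Proof.
move=> hv K0 e0.
have mV := measurable_stable_set v K e.
have UV : \bigcup_n stable_set v K e n = `[0, K]%classic.
  apply/seteqP; split => [y [n _ []]//|y yK].
  have [N _ HN] : \forall n \near \oo, `|h (v n + y) - h (v n)| <= e.
    have hvy := @cvg_comp _ _ _ _ (fun u => h (u + y) - h u) _ _ _ hv (hs y).
    move/cvgrPdist_le : hvy => /(_ e e0); apply: filterS => n.
    by rewrite sub0r normrN.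
  by exists N => //; split.
have nd : nondecreasing_seq (stable_set v K e).
  apply/nondecreasing_seqP => n; apply/subsetPset => y [yK h1]; split => // m nm.
  by apply: h1; exact: ltnW.
have mU : measurable (\bigcup_n stable_set v K e n).
  by rewrite UV; exact: measurable_itv.
have lK : leb `[0, K]%classic = K%:E by rewrite lebesgue_measure_itv/= lte_fin K0 sube0.
have H : leb (stable_set v K e n) @[n --> \oo] --> K%:E.
  have := @nondecreasing_cvg_mu _ _ _ leb _ mV mU nd.
  by rewrite UV => H; rewrite -lK; exact: H.
have /fine_cvgP[fin Hf] := H.
have H2 := cvgr_gt _ Hf.
near=> n; have nf : leb (stable_set v K e n) \is a fin_num by near: n.
rewrite -(fineK nf) lte_fin; near: n; apply: H2 => /=; lra.
Unshelve. all: by end_near. Qed.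

(* Steinhaus: the stable sets along [u] and [u + s] have measure more than 3K
   each, and the first one and a translate of the second one both lie in an
   interval of length 6K, so they meet. *)
Lemma slow_uniform (u s : nat -> R) (K : R) : 0 < K ->
  u n @[n --> \oo] --> +oo -> (forall n, `|s n| <= K) ->
  h (u n + s n) - h (u n) @[n --> \oo] --> (0 : R).
Proof.
move=> K0 hu sK.
have hus : u n + s n @[n --> \oo] --> +oo.
  apply/cvgryPge => A; have /cvgryPge/(_ (A + K)) := hu.
  apply: filterS => n; have := sK n; rewrite ler_norml => /andP[h1 _] h2.
  lra.
apply/cvgrPdist_le => e e0.
have e2 : 0 < e / 2 by rewrite divr_gt0.
have K4 : 0 < 4 * K by rewrite mulr_gt0.
have HV := stable_set_large hu K4 e2; have HW := stable_set_large hus K4 e2.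
near=> n.
have hV : ((3 / 4 * (4 * K))%:E < leb (stable_set u (4 * K) (e / 2) n))%E by near: n; exact: HV.
have hW : ((3 / 4 * (4 * K))%:E < leb (stable_set (fun n => u n + s n)%R (4 * K) (e / 2) n))%E by near: n; exact: HW.
set Vn := stable_set u _ _ n in hV; set Wn := stable_set _ _ _ n in hW.
have mV : measurable Vn by exact: measurable_stable_set.
have mW : measurable Wn by exact: measurable_stable_set.
rewrite -(lebesgue_measure_translate (s n) mW) in hW.
have mW' : measurable (translate (s n) @^-1` Wn).
  by rewrite -[X in measurable X]setTI; exact: measurable_translate.
have [y [Vy Wy]] : exists y, Vn y /\ (translate (s n) @^-1` Wn) y.
  apply: contrapT => nex.
  have dis : Vn `&` (translate (s n) @^-1` Wn) = set0.
    by rewrite -subset0 => y [h1 h2]; apply: nex; exists y.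
  have := measureU leb mV mW' dis.
  have sub : Vn `|` translate (s n) @^-1` Wn `<=` `[(- K), 5 * K]%classic.
    have := sK n; rewrite ler_norml => /andP[s1 s2] y.
    case=> [[+ _]|[+ _]]; rewrite /translate /= !in_itv/= => /andP[h1 h2]; apply/andP; split; lra.
  have := @le_measure _ _ _ leb _ _ (mem_set (measurableU _ _ mV mW')) (mem_set (measurable_itv `[(- K), 5 * K])) sub.
  rewrite [leRHS]lebesgue_measure_itv/= lte_fin => + E; rewrite E.
  have -> : - K < 5 * K by lra.
  rewrite -EFinB => le6; have := lteD hV hW; rewrite -EFinD.
  move=> /lt_le_trans /(_ le6); rewrite lte_fin; lra.
(* At a common point both displacements lead to u + y, so h (u) and h (u + s) are each within e / 2
   of h (u + y). *)
have := Vy.2 n (leqnn n); have := Wy.2 n (leqnn n).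
rewrite /translate /= (_ : u n + s n + (y - s n) = u n + y); last by ring.
rewrite !ler_norml => /andP[a1 a2] /andP[b1 b2].
by apply/andP; split; lra.
Unshelve. all: by end_near. Qed.

End UniformConvergence.

Section RegularVariation.
Context {R : realType}.
Variables (alpha : R) (l1 : R -> R).
Hypothesis alpha_gt0 : 0 < alpha.
Hypothesis alpha_lt1 : alpha < 1.
Hypothesis Hl1 : slowly_varying l1.

Let l1_gt0 x : 0 < x -> 0 < l1 x. Proof. by case: Hl1 => _ + _; exact. Qed.

Lemma expR_pinfty : @expR R u @[u --> +oo] --> +oo.
Proof.
apply/cvgryPge => A; near=> u.
apply: le_trans (expR_ge1Dx u); rewrite -lerBlDl; near: u; apply: nbhs_pinfty_ge; exact: num_real.
Unshelve. all: by end_near. Qed.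

(** A failure along sequences y_n, t_n contradicts [slow_uniform] in logarithmic coordinates: h = ln
    o l1 o exp turns slow variation into vanishing increments, and ln t_n stays bounded. *)
Lemma slowly_varying_uniform (lo hi e : R) : 0 < lo -> 0 < e ->
  exists Y : R, forall y t, Y <= y -> lo <= t <= hi -> `|l1 (t * y) / l1 y - 1| <= e.
Proof.
move=> lo0 e0; apply: contrapT => nY.
have H n : exists yt : R * R, [/\ n%:R <= yt.1, 1 <= yt.1, lo <= yt.2 <= hi &
    e < `|l1 (yt.2 * yt.1) / l1 yt.1 - 1| ].
  apply: contrapT => h; apply: nY; exists (Num.max n%:R 1) => y t.
  rewrite ge_max => /andP[ny y1] tb; rewrite leNgt; apply/negP => lt.
  by apply: h; exists (y, t).
have [yt Hyt] := choice H.
pose y n := (yt n).1; pose t n := (yt n).2.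
have y0 n : 0 < y n by have [_ h _ _] := Hyt n; exact: (lt_le_trans (@ltr01 R) h).
have t0 n : 0 < t n by have [_ _ /andP[h _] _] := Hyt n; exact: (lt_le_trans lo0 h).
pose h u := ln (l1 (expR u)).
have mh : measurable_fun setT h.
  apply: measurableT_comp; first exact: measurable_ln.
  have [ml _ _] := Hl1.
  apply: (measurable_comp _ _ ml) => //.
  - rewrite (_ : [set x | 0 < x] = `]0, +oo[%classic); first exact: measurable_itv.
    by apply/seteqP; split => x /=; rewrite in_itv/= andbT.
  - by move=> _ [u _ <-] /=; exact: expR_gt0.
have hs s : h (u + s) - h u @[u --> +oo] --> (0 : R).
  have [_ _ /(_ (expR s) (expR_gt0 s)) hl] := Hl1.
  have h1 := @cvg_comp _ _ _ _ (fun x => l1 (expR s * x) / l1 x) _ _ _ expR_pinfty hl.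
  have h2 := @cvg_comp _ _ _ _ (@ln R) _ _ _ h1 (continuous_ln (@ltr01 R)).
  rewrite ln1 in h2; apply: cvg_trans h2; apply: near_eq_cvg; near=> u.
  rewrite /= /h ln_div ?posrE ?l1_gt0 ?mulr_gt0 ?expR_gt0//.
  by rewrite expRD mulrC.
have hy : ln (y n) @[n --> \oo] --> +oo.
  apply/cvgryPge => A; near=> n.
  rewrite -ler_expR lnK ?posrE//; have [h1 _ _ _] := Hyt n; apply: le_trans h1.
  near: n; exact: nbhs_infty_ger.
have K0 : 0 < `|ln lo| + `|ln hi| + 1 by rewrite ltr_wpDl// addr_ge0.
have sK n : `|ln (t n)| <= `|ln lo| + `|ln hi| + 1.
  have [_ _ /andP[h1 h2] _] := Hyt n.
  have h3 : ln lo <= ln (t n) by rewrite ler_ln// posrE.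
  have h4 : ln (t n) <= ln hi by rewrite ler_ln ?posrE// (lt_le_trans (t0 n)).
  have a1 := ler_norm (ln hi); have a2 := ler_norm (- ln lo); rewrite normrN in a2.
  have a3 := normr_ge0 (ln hi); have a4 := normr_ge0 (ln lo).
  by clear -h3 h4 a1 a2 a3 a4; rewrite ler_norml; apply/andP; split; lra.
have := slow_uniform mh hs K0 hy sK.
move=> h1; have h2 := @cvg_comp _ _ _ _ (@expR R) _ _ _ h1 (@continuous_expR R 0).
rewrite expR0 in h2; move/cvgrPdist_lt : h2 => /(_ e e0) [N _ /(_ N (leqnn N))] /=.
have -> : expR (h (ln (y N) + ln (t N)) - h (ln (y N))) = l1 (t N * y N) / l1 (y N).
  have -> : h (ln (y N) + ln (t N)) = ln (l1 (t N * y N)).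
    by rewrite /h expRD [t N * _]mulrC !lnK// posrE.
  have -> : h (ln (y N)) = ln (l1 (y N)) by rewrite /h lnK// posrE.
  by rewrite expRB !lnK// posrE l1_gt0// mulr_gt0.
have [_ _ _ h3] := Hyt N; rewrite distrC => h4.
by have := lt_trans h3 h4; rewrite ltxx.
Unshelve. all: by end_near. Qed.

(** [norming] at real arguments; the asymptotic inverse is that of this function. *)
Definition reg_fun (y : R) : R := y `^ alpha^-1 * l1 y.
Local Notation B := reg_fun.

Lemma reg_fun_gt0 y : 0 < y -> 0 < B y.
Proof. by move=> y0; rewrite mulr_gt0 ?powR_gt0// l1_gt0. Qed.

Lemma reg_funM t y : 0 < t -> 0 < y -> B (t * y) = t `^ alpha^-1 * (l1 (t * y) / l1 y) * B y.
Proof.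
move=> t0 y0; have l0 : l1 y != 0 by rewrite gt_eqF// l1_gt0.
rewrite /B powRM ?(ltW t0) ?(ltW y0)//; field; exact: l0.
Qed.

(** The factor t_n moves, so slow variation is used uniformly on [s/2, 2 s]. *)
Lemma reg_fun_ratio (x_ t_ : nat -> R) (s : R) : 0 < s ->
  x_ n @[n --> \oo] --> +oo -> t_ n @[n --> \oo] --> s ->
  B (t_ n * x_ n) / B (x_ n) @[n --> \oo] --> s `^ alpha^-1.
Proof.
move=> s0 hx ht.
have t0 : \forall n \near \oo, 0 < t_ n by exact: (cvgr_gt _ ht).
have x0 : \forall n \near \oo, 0 < x_ n by exact: (cvgryPgt _).1 hx 0.
have lim : l1 (t_ n * x_ n) / l1 (x_ n) @[n --> \oo] --> (1 : R).
  apply/cvgrPdist_le => e e0.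
  have s2 : 0 < s / 2 by rewrite divr_gt0.
  have [Y HY] := slowly_varying_uniform (2 * s) s2 e0.
  near=> n; rewrite distrC; apply: HY; first by near: n; exact: (cvgryPge _).1 hx Y.
  apply/andP; split; near: n.
    apply: (cvgr_ge _ ht); lra.
  apply: (cvgr_le _ ht); lra.
have hp := @cvg_comp _ _ _ _ (fun y => y `^ alpha^-1) _ _ _ ht (powR_continuous (a := alpha^-1) s0).
have hL : t_ n `^ alpha^-1 * (l1 (t_ n * x_ n) / l1 (x_ n)) @[n --> \oo] --> s `^ alpha^-1 * 1.
  by apply: cvgM lim; exact: hp.
rewrite mulr1 in hL; apply: cvg_trans hL; apply: near_eq_cvg; near=> n.
have xn : 0 < x_ n by near: n.
have tn : 0 < t_ n by near: n.
by rewrite reg_funM// mulfK// gt_eqF// reg_fun_gt0.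
Unshelve. all: by end_near. Qed.

(** [B] need not be monotone. Since 1 / alpha >= 1, a factor t in [1, 2] multiplies it by at least
    (1 - e) t, and for t = 2 this is at least 1 as e <= 1/2. Hence doublings cost nothing, and only
    the last partial step loses a factor 1 - e. *)
Lemma reg_fun_almost_mono (eta : R) : 0 < eta ->
  exists2 Y : R, 0 < Y & forall y y', Y <= y -> y <= y' -> (1 - eta) * B y <= B y'.
Proof.
move=> eta0; pose e := Num.min eta (1 / 2).
have e0 : 0 < e by rewrite lt_min eta0/=; lra.
have e2 : e <= 1 / 2 by rewrite ge_min lexx orbT.
have [Y0 HY0] := slowly_varying_uniform 2 ltr01 e0.
pose Y := Num.max Y0 1.
have Y1 : 1 <= Y by rewrite le_max lexx orbT.
have YY0 : Y0 <= Y by rewrite le_max lexx.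
have step y t : Y <= y -> 1 <= t <= 2 -> (1 - e) * t * B y <= B (t * y).
  move=> Yy tb; have /andP[t1 t2] := tb.
  have y0 : 0 < y by apply: lt_le_trans Yy; exact: lt_le_trans Y1.
  have tt : 0 < t by exact: lt_le_trans t1.
  rewrite reg_funM// ler_wpM2r ?(ltW (reg_fun_gt0 _))//.
  have := HY0 y t (le_trans YY0 Yy) tb; rewrite ler_norml => /andP[h1 _].
  rewrite mulrC ler_pM ?(ltW tt)//.
  - by rewrite subr_ge0 (le_trans e2)//; lra.
  - rewrite -{1}(powRr1 (ltW tt)); apply: ler_powR => //.
    by rewrite invf_ge1// ltW.
  - by rewrite lerBrDr addrC in h1.
have dbl y k : Y <= y -> B y <= B (2 ^+ k * y).
  move=> Yy; elim: k => [|k ih]; first by rewrite expr0 mul1r.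
  have y0 : 0 <= y := le_trans ler01 (le_trans Y1 Yy).
  have Yk : Y <= 2 ^+ k * y by rewrite (le_trans Yy)// ler_peMl ?exprn_ege1 ?ler1n.
  have h2 : 1 <= (2 : R) <= 2 by rewrite lexx ler1n.
  rewrite exprS -mulrA; apply: le_trans (step _ _ Yk h2).
  apply: (le_trans ih); rewrite ler_peMl ?(ltW (reg_fun_gt0 _))//.
    by apply: lt_le_trans Yk; exact: lt_le_trans Y1.
  lra.
exists Y => [|y y' Yy yy']; first exact: lt_le_trans Y1.
have y0 : 0 < y by apply: lt_le_trans Yy; exact: lt_le_trans Y1.
have [k /andP[k1 k2]] : exists k, 2 ^+ k <= y' / y < 2 ^+ k.+1.
  have r1 : 1 <= y' / y by rewrite ler_pdivlMr// mul1r.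
  have ex : exists k, y' / y < 2 ^+ k.+1.
    pose n := Num.truncn (y' / y); exists n.
    have : y' / y < n.+1%:R by apply: truncnS_gt.
    move=> /lt_le_trans; apply; rewrite -natrX ler_nat; exact: ltnW (ltn_expl _ _).
  case: (ex_minnP ex) => k hk mk; exists k; rewrite hk andbT.
  case: k hk mk => [//|k] hk mk; rewrite leNgt; apply/negP => /mk; by rewrite ltnn.
pose t := y' / (2 ^+ k * y).
have p0 : 0 < 2 ^+ k * y by rewrite mulr_gt0// exprn_gt0.
have tE : y' = t * (2 ^+ k * y) by rewrite /t divfK// gt_eqF.
have t12 : 1 <= t <= 2.
  rewrite /t ler_pdivlMr// mul1r -ler_pdivlMr// k1/= ler_pdivrMr// mulrA -exprS.
  by rewrite -ler_pdivrMr// ltW.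
have Yk : Y <= 2 ^+ k * y.
  by rewrite (le_trans Yy)// ler_peMl ?exprn_ege1 ?ler1n// ltW.
rewrite tE; apply: le_trans (step _ _ Yk t12).
have /andP[t1 _] := t12.
apply: (@le_trans _ _ ((1 - e) * B (2 ^+ k * y))).
  apply: (@le_trans _ _ ((1 - e) * B y)).
    rewrite ler_wpM2r ?(ltW (reg_fun_gt0 _))// lerD2l lerN2.
    by rewrite ge_min lexx.
  rewrite ler_wpM2l ?dbl//; lra.
rewrite ler_wpM2r ?(ltW (reg_fun_gt0 _))// ler_peMr//; lra.
Qed.

End RegularVariation.

(** * The asymptotic inverse of a regularly varying function *)

Section AsymptoticInverse.
Context {R : realType}.
Variables (alpha : R) (l1 : R -> R).
Hypothesis alpha_gt0 : 0 < alpha.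
Hypothesis alpha_lt1 : alpha < 1.
Hypothesis Hl1 : slowly_varying l1.
Local Notation B := (reg_fun alpha l1).

Let B_gt0 y : 0 < y -> 0 < B y := @reg_fun_gt0 _ alpha _ Hl1 y.

(** Each doubling multiplies [B] by at least 3/2 = 2 (1 - 1/4), and almost monotonicity covers the
    arguments between the dyadic ones. *)
Lemma reg_fun_pinfty : B y @[y --> +oo] --> +oo.
Proof.
have e4 : (0 : R) < 4^-1 by rewrite invr_gt0.
have [Y0 HY0] := slowly_varying_uniform Hl1 2 (@ltr01 R) e4.
have e2 : (0 : R) < 2^-1 by rewrite invr_gt0.
have [Y1 Y10 HY1] := reg_fun_almost_mono alpha_gt0 alpha_lt1 Hl1 e2.
pose Y := Num.max Y0 Y1.
have Yp : 0 < Y by rewrite lt_max Y10 orbT.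
have YY0 : Y0 <= Y by rewrite le_max lexx.
have YY1 : Y1 <= Y by rewrite le_max lexx orbT.
have dbl k : (1 + 2^-1) ^+ k * B Y <= B (2 ^+ k * Y) /\ Y <= 2 ^+ k * Y.
  elim: k => [|k [ih Yk]]; first by rewrite !expr0 !mul1r.
  have k0 : 0 < 2 ^+ k * Y by exact: lt_le_trans Yk.
  split; last by rewrite ler_peMl ?exprn_ege1 ?ler1n// ltW.
  rewrite !exprS -!mulrA reg_funM//.
  have g1 : (0 : R) <= 1 + 2^-1 by lra.
  have g2 : 0 <= (1 + 2^-1) ^+ k * B Y by rewrite mulr_ge0 ?exprn_ge0 ?(ltW (B_gt0 _)).
  apply: (ler_pM g1 g2 _ ih).
  have := HY0 (2 ^+ k * Y) 2 (le_trans YY0 Yk); rewrite lexx ler1n => /(_ isT).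
  rewrite ler_norml => /andP[h _].
  have p2 : 2 <= 2 `^ alpha^-1 :> R.
    rewrite -{1}(powRr1 (ler0n R 2)); apply: ler_powR; first by rewrite ler1n.
    by rewrite invf_ge1// ltW.
  apply: (@le_trans _ _ (2 * (1 - 4^-1))); first lra.
  apply: ler_pM => //; first lra.
  by rewrite lerBrDr addrC in h.
apply/cvgryPge => A.
have [k hk] : exists k, `|A| * 2 / B Y < 1 + k%:R * 2^-1.
  exists (Num.truncn (`|A| * 2 / B Y * 2)).+1.
  have := truncnS_gt (`|A| * 2 / B Y * 2); set u := `|A| * 2 / B Y; set N := _.+1%:R.
  move=> h; lra.
near=> y.
have yk : 2 ^+ k * Y <= y by near: y; apply: nbhs_pinfty_ge; exact: num_real.
have [d1 d2] := dbl k.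
apply: le_trans (HY1 _ _ (le_trans YY1 d2) yk).
have bk : 1 + k%:R * 2^-1 <= (1 + 2^-1) ^+ k :> R by apply: bernoulli_ge; lra.
have : `|A| * 2 <= B (2 ^+ k * Y).
  apply: le_trans d1; rewrite -ler_pdivrMr ?B_gt0//; apply: le_trans bk; exact: ltW.
have := ler_norm A; lra.
Unshelve. all: by end_near. Qed.

Definition inv_set (x : R) : set R := [set t : R | 0 < t /\ x < t `^ (- alpha^-1) * l1 t^-1].
(* [x `^ alpha / ell alpha l1 x]; it is [0] when [inv_set x] is unbounded. *)
Definition asym_inv (x : R) : R := (sup (inv_set x))^-1.

Lemma inv_setE x t : 0 < t -> inv_set x t <-> x < B t^-1.
Proof.
move=> t0; rewrite /inv_set /= /reg_fun.
have -> : t^-1 `^ alpha^-1 = t `^ (- alpha^-1) by rewrite -(powR_inv1 (ltW t0)) -powRrM mulN1r.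
by split => [[]|].
Qed.

Lemma inv_set_nonempty x : exists2 t, 0 < t & inv_set x t.
Proof.
have [y [y0 By]] : exists y, 0 < y /\ x < B y.
  have h : \forall y \near +oo, 0 < y /\ x < B y.
    near=> y; split; near: y; first by apply: nbhs_pinfty_gt; exact: num_real.
    exact: (cvgryPgt _).1 reg_fun_pinfty x.
  have [N [_ HN]] := h; exists (N + 1); apply: HN; lra.
by exists y^-1; [rewrite invr_gt0|apply/inv_setE; rewrite ?invr_gt0 ?invrK].
Unshelve. all: by end_near. Qed.

Lemma sup_inv_set_gt0 x : has_ubound (inv_set x) -> 0 < sup (inv_set x).
Proof.
move=> ub; have [t t0 ht] := inv_set_nonempty x.
by apply: (lt_le_trans t0); apply: ub_le_sup.
Qed.

Lemma asym_inv_gt0 x : has_ubound (inv_set x) -> 0 < asym_inv x.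
Proof. by move=> ub; rewrite invr_gt0 sup_inv_set_gt0. Qed.

(** With y = 1 / t the supremum becomes an infimum: [asym_inv x] is the greatest lower bound of the
    y > 0 with x < B y. The other half is [asym_inv_approx]. *)
Lemma asym_inv_le x y : has_ubound (inv_set x) -> 0 < y -> x < B y -> asym_inv x <= y.
Proof.
move=> ub y0 xy; rewrite /asym_inv -[y]invrK lef_pV2 ?posrE ?invr_gt0 ?sup_inv_set_gt0//.
by apply: ub_le_sup => //; apply/inv_setE; rewrite ?invr_gt0 ?invrK.
Qed.

Lemma asym_inv_approx x u : has_ubound (inv_set x) -> asym_inv x < u ->
  exists y, [/\ asym_inv x <= y, y < u & x < B y].
Proof.
move=> ub au; have s0 := sup_inv_set_gt0 ub; have a0 := asym_inv_gt0 ub.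
have [t0 _ ht0] := inv_set_nonempty x.
have lt : u^-1 < sup (inv_set x).
  by rewrite -[sup _]invrK ltf_pV2 ?posrE ?invr_gt0// (lt_trans a0).
have [t ht ut] := sup_gt (ex_intro _ t0 ht0) lt.
have t_0 : 0 < t := ht.1.
exists t^-1; split; last by apply/inv_setE.
  by rewrite /asym_inv lef_pV2 ?posrE//; exact: ub_le_sup.
rewrite -[u]invrK ltf_pV2 ?posrE ?invr_gt0 //; exact: lt_trans au.
Qed.

Lemma asym_inv_mono x x' : has_ubound (inv_set x) -> has_ubound (inv_set x') ->
  x <= x' -> asym_inv x <= asym_inv x'.
Proof.
move=> ub ub' xx'; rewrite leNgt; apply/negP => /(asym_inv_approx ub')[y [y1 y2 y3]].
have := asym_inv_le ub (lt_le_trans (asym_inv_gt0 ub') y1) (le_lt_trans xx' y3).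
by rewrite leNgt y2.
Qed.

Variable X0 : R.
Hypothesis bounded_inv : forall x, X0 <= x -> has_ubound (inv_set x).
Hypothesis asym_inv_pinfty : asym_inv x @[x --> +oo] --> +oo.

(** The upper bound holds as soon as x < B (s' q). The lower bound must exclude every y < s' q with
    x < B y although [B] is not monotone; almost monotonicity from y to s' q does it, and applies
    because y >= [asym_inv x] is large. *)
Lemma asym_inv_ratio (q_ x_ : nat -> R) (s : R) : 0 < s ->
  q_ n @[n --> \oo] --> +oo -> x_ n / B (q_ n) @[n --> \oo] --> s `^ alpha^-1 ->
  asym_inv (x_ n) / q_ n @[n --> \oo] --> s.
Proof.
move=> s0 hq hx.
have q0 : \forall n \near \oo, 0 < q_ n by exact: (cvgryPgt _).1 hq 0.
have ai0 : 0 < alpha^-1 by rewrite invr_gt0.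
have hxoo : x_ n @[n --> \oo] --> +oo.
  have hB := @cvg_comp _ _ _ _ B _ _ _ hq reg_fun_pinfty.
  pose s2 := s `^ alpha^-1 / 2.
  have s20 : 0 < s2 by rewrite divr_gt0 ?powR_gt0.
  have hx2 : \forall n \near \oo, s2 <= x_ n / B (q_ n).
    by apply: (cvgr_ge _ hx); rewrite /s2; have := powR_gt0 alpha^-1 s0; lra.
  apply/cvgryPge => A.
  have hBA : \forall n \near \oo, `|A| / s2 <= B (q_ n) by exact: (cvgryPge _).1 hB _.
  near=> n.
  have qn : 0 < q_ n by near: n.
  have h1 : s2 <= x_ n / B (q_ n) by near: n.
  have h2 : `|A| / s2 <= B (q_ n) by near: n.
  rewrite ler_pdivlMr ?B_gt0// in h1; apply: le_trans h1.
  by rewrite ler_pdivrMr// mulrC in h2; apply: le_trans h2; exact: ler_norm.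
have xX : \forall n \near \oo, X0 <= x_ n by exact: (cvgryPge _).1 hxoo _.
have hA := @cvg_comp _ _ _ _ asym_inv _ _ _ hxoo asym_inv_pinfty.
have ratio t : 0 < t -> B (t * q_ n) / B (q_ n) @[n --> \oo] --> t `^ alpha^-1.
  by move=> t0; apply: (reg_fun_ratio Hl1 t0 hq); exact: cvg_cst.
have up s' : s < s' -> \forall n \near \oo, asym_inv (x_ n) / q_ n <= s'.
  move=> ss'; have s'0 := lt_trans s0 ss'.
  have pl : s `^ alpha^-1 < s' `^ alpha^-1 by apply: gt0_ltr_powR => //; rewrite nnegrE ltW.
  pose mid := (s `^ alpha^-1 + s' `^ alpha^-1) / 2.
  have h1 : \forall n \near \oo, x_ n / B (q_ n) < mid.
    by apply: (cvgr_lt _ hx); rewrite /mid; move: pl; set u := _ `^ _; set v := _ `^ _; lra.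
  have h2 : \forall n \near \oo, mid < B (s' * q_ n) / B (q_ n).
    by apply: (cvgr_gt _ (ratio _ s'0)); rewrite /mid; move: pl; set u := _ `^ _; set v := _ `^ _; lra.
  near=> n.
  have qn : 0 < q_ n by near: n.
  rewrite ler_pdivrMr//; apply: asym_inv_le.
  - by apply: bounded_inv; near: n.
  - by rewrite mulr_gt0.
  - have a1 : x_ n / B (q_ n) < mid by near: n.
    have a2 : mid < B (s' * q_ n) / B (q_ n) by near: n.
    by have := lt_trans a1 a2; rewrite ltr_pM2r// invr_gt0 B_gt0.
have lo s' : 0 < s' -> s' < s -> \forall n \near \oo, s' <= asym_inv (x_ n) / q_ n.
  move=> s'0 ss'.
  have pl : s' `^ alpha^-1 < s `^ alpha^-1 by apply: gt0_ltr_powR => //; rewrite nnegrE ltW.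
  have p0 : 0 < s `^ alpha^-1 by exact: powR_gt0.
  have p0' : 0 < s' `^ alpha^-1 by exact: powR_gt0.
  pose r := s' `^ alpha^-1 / s `^ alpha^-1.
  have r1 : r < 1 by rewrite /r ltr_pdivrMr// mul1r.
  have r0 : 0 < r by rewrite divr_gt0.
  (* Then 1 - eta = (1 + r) / 2 still exceeds [r], the ratio of the two powers. *)
  pose eta := (1 - r) / 2.
  have eta0 : 0 < eta by rewrite /eta; lra.
  have [Y Y_0 HY] := reg_fun_almost_mono alpha_gt0 alpha_lt1 Hl1 eta0.
  have rE : s' `^ alpha^-1 = r * s `^ alpha^-1 by rewrite /r divfK// gt_eqF.
  have pl2 : s' `^ alpha^-1 < (1 - eta) * s `^ alpha^-1.
    by rewrite rE ltr_pM2r// /eta; lra.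
  pose mid := (s' `^ alpha^-1 + (1 - eta) * s `^ alpha^-1) / 2.
  have h1 : \forall n \near \oo, mid < (1 - eta) * (x_ n / B (q_ n)).
    have h : (1 - eta) * (x_ n / B (q_ n)) @[n --> \oo] --> (1 - eta) * s `^ alpha^-1.
      by apply: cvgM => //; exact: cvg_cst.
    by apply: (cvgr_gt _ h); rewrite /mid; move: pl2; set u := _ * _; set v := _ `^ _; lra.
  have h2 : \forall n \near \oo, B (s' * q_ n) / B (q_ n) < mid.
    apply: (cvgr_lt _ (ratio _ s'0)); rewrite /mid; move: pl2.
    by set v := s' `^ _; set u := _ * _; lra.
  have h3 : \forall n \near \oo, Y <= asym_inv (x_ n) by exact: (cvgryPge _).1 hA _.
  near=> n.
  have qn : 0 < q_ n by near: n.
  have a3 : Y <= asym_inv (x_ n) by near: n.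
  have ub : has_ubound (inv_set (x_ n)) by apply: bounded_inv; near: n.
  rewrite ler_pdivlMr// leNgt; apply/negP => /(asym_inv_approx ub)[y [y1 y2 y3]].
  have a1 : mid < (1 - eta) * (x_ n / B (q_ n)) by near: n.
  have a2 : B (s' * q_ n) / B (q_ n) < mid by near: n.
  have := lt_trans a2 a1; rewrite mulrA ltr_pM2r ?invr_gt0 ?B_gt0//.
  have := HY _ _ (le_trans a3 y1) (ltW y2) => h4 h5.
  have : (1 - eta) * B y < (1 - eta) * x_ n by exact: le_lt_trans h5.
  rewrite ltr_pM2l; last by rewrite /eta; lra.
  by move=> h6; have := lt_trans h6 y3; rewrite ltxx.
apply/cvgrPdist_le => e e0.
pose e' := Num.min e (s / 2).
have e'0 : 0 < e' by rewrite lt_min e0 divr_gt0.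
have e'e : e' <= e by rewrite ge_min lexx.
have e's : e' < s by rewrite gt_min; apply/orP; right; lra.
have H1 := up (s + e'); have H2 := lo (s - e').
have {}H1 : \forall n \near \oo, asym_inv (x_ n) / q_ n <= s + e' by apply: H1; lra.
have {}H2 : \forall n \near \oo, s - e' <= asym_inv (x_ n) / q_ n by apply: H2; lra.
near=> n.
have a1 : asym_inv (x_ n) / q_ n <= s + e' by near: n.
have a2 : s - e' <= asym_inv (x_ n) / q_ n by near: n.
by rewrite ler_norml; apply/andP; split; lra.
Unshelve. all: by end_near. Qed.

(** [asym_inv] is monotone, and at w B(q) it is asymptotic to w^alpha q by [asym_inv_ratio]; so x
    can be compared with w B(q) for w on either side of s^(1/alpha). *)
Lemma asym_inv_ratio_inv (q_ x_ : nat -> R) (s : R) : 0 < s ->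
  q_ n @[n --> \oo] --> +oo -> x_ n @[n --> \oo] --> +oo ->
  asym_inv (x_ n) / q_ n @[n --> \oo] --> s ->
  x_ n / B (q_ n) @[n --> \oo] --> s `^ alpha^-1.
Proof.
move=> s0 hq hx ha.
have q0 : \forall n \near \oo, 0 < q_ n by exact: (cvgryPgt _).1 hq 0.
have xX : \forall n \near \oo, X0 <= x_ n by exact: (cvgryPge _).1 hx _.
have ai0 : 0 < alpha^-1 by rewrite invr_gt0.
have hB := @cvg_comp _ _ _ _ B _ _ _ hq reg_fun_pinfty.
have key w : 0 < w -> asym_inv (w * B (q_ n)) / q_ n @[n --> \oo] --> w `^ alpha.
  move=> w0; apply: asym_inv_ratio => //; first exact: powR_gt0.
  rewrite -powRrM mulfV ?gt_eqF// powRr1 ?(ltW w0)//.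
  apply: (@cvg_trans _ (w @[n --> \oo])); last exact: cvg_cst.
  apply: near_eq_cvg; near=> n.
  by rewrite mulfK// gt_eqF// B_gt0//; near: n.
have wX w : 0 < w -> \forall n \near \oo, X0 <= w * B (q_ n).
  move=> w0; have h : \forall n \near \oo, X0 / w <= B (q_ n) by exact: (cvgryPge _).1 hB _.
  by apply: filterS h => n; rewrite ler_pdivrMr// mulrC.
have sE : (s `^ alpha^-1) `^ alpha = s by rewrite -powRrM mulVf ?gt_eqF// powRr1// ltW.
have p0 : 0 < s `^ alpha^-1 by exact: powR_gt0.
have up w : s `^ alpha^-1 < w -> \forall n \near \oo, x_ n / B (q_ n) <= w.
  move=> sw; have w0 := lt_trans p0 sw.
  have sw' : s < w `^ alpha by rewrite -[ltLHS]sE; apply: gt0_ltr_powR => //; rewrite nnegrE ltW.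
  pose mid := (s + w `^ alpha) / 2.
  have h1 : \forall n \near \oo, asym_inv (x_ n) / q_ n < mid.
    by apply: (cvgr_lt _ ha); rewrite /mid; move: sw'; set u := _ `^ _; lra.
  have h2 : \forall n \near \oo, mid < asym_inv (w * B (q_ n)) / q_ n.
    by apply: (cvgr_gt _ (key _ w0)); rewrite /mid; move: sw'; set u := _ `^ _; lra.
  have h3 := wX _ w0.
  near=> n.
  have qn : 0 < q_ n by near: n.
  rewrite ler_pdivrMr ?B_gt0// leNgt; apply/negP => lt.
  have a1 : asym_inv (x_ n) / q_ n < mid by near: n.
  have a2 : mid < asym_inv (w * B (q_ n)) / q_ n by near: n.
  have := lt_trans a1 a2; rewrite ltr_pM2r ?invr_gt0// ltNge asym_inv_mono// ?(ltW lt)//.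
    by apply: bounded_inv; near: n.
  by apply: bounded_inv; near: n.
have lo w : 0 < w -> w < s `^ alpha^-1 -> \forall n \near \oo, w <= x_ n / B (q_ n).
  move=> w0 sw.
  have sw' : w `^ alpha < s by rewrite -[ltRHS]sE; apply: gt0_ltr_powR => //; rewrite nnegrE ltW.
  pose mid := (s + w `^ alpha) / 2.
  have h1 : \forall n \near \oo, mid < asym_inv (x_ n) / q_ n.
    by apply: (cvgr_gt _ ha); rewrite /mid; move: sw'; set u := _ `^ _; lra.
  have h2 : \forall n \near \oo, asym_inv (w * B (q_ n)) / q_ n < mid.
    by apply: (cvgr_lt _ (key _ w0)); rewrite /mid; move: sw'; set u := _ `^ _; lra.
  have h3 := wX _ w0.
  near=> n.
  have qn : 0 < q_ n by near: n.
  rewrite ler_pdivlMr ?B_gt0// leNgt; apply/negP => lt.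
  have a1 : mid < asym_inv (x_ n) / q_ n by near: n.
  have a2 : asym_inv (w * B (q_ n)) / q_ n < mid by near: n.
  have := lt_trans a2 a1; rewrite ltr_pM2r ?invr_gt0// ltNge asym_inv_mono// ?(ltW lt)//.
    by apply: bounded_inv; near: n.
  by apply: bounded_inv; near: n.
apply/cvgrPdist_le => e e0.
pose e' := Num.min e (s `^ alpha^-1 / 2).
have e'0 : 0 < e' by rewrite lt_min e0 divr_gt0.
have e'e : e' <= e by rewrite ge_min lexx.
have e's : e' < s `^ alpha^-1 by rewrite gt_min; apply/orP; right; move: p0; set u := _ `^ _; lra.
move: e's up lo; set u := s `^ _ => e's up lo.
have H1 : \forall n \near \oo, x_ n / B (q_ n) <= u + e' by apply: up; lra.
have H2 : \forall n \near \oo, u - e' <= x_ n / B (q_ n) by apply: lo; lra.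
near=> n.
have a1 : x_ n / B (q_ n) <= u + e' by near: n.
have a2 : u - e' <= x_ n / B (q_ n) by near: n.
by rewrite ler_norml; apply/andP; split; lra.
Unshelve. all: by end_near. Qed.

End AsymptoticInverse.

(** * Asymptotics and domination of the tail of the return time *)

Section Tails.
Context {R : realType}.
Variables (alpha c : R) (M : R -> R).
Hypothesis alpha_gt0 : 0 < alpha.
Hypothesis alpha_lt1 : alpha < 1.
Hypothesis c_gt1 : 1 < c.
Hypothesis HM : semistable_modulus alpha c M.
Variable k : nat -> nat.
Hypothesis k_gt0 : forall n, (0 < k n)%N.
Hypothesis k_incr : forall n, (k n < k n.+1)%N.
Hypothesis k_ratio : ((k n.+1)%:R / (k n)%:R : R) @[n --> \oo] --> c.
Variable l1 : R -> R.
Hypothesis Hl1 : slowly_varying l1.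
Variable delta : R -> R.
Hypothesis Hdelta : delta_function (fun n => norming alpha l1 (k n)) delta.
Variables (h Fb : R -> R).
Hypothesis h_lim : forall x : R, 0 < x -> {for x, continuous M} ->
     h (norming alpha l1 (k n) * x) @[n --> \oo] --> 0.
Hypothesis Htail : \forall x \near +oo,
   Fb x = ell alpha l1 x / x `^ alpha * (M (delta x) + h x).
Hypothesis Fb_ge0 : forall x, 0 <= Fb x.
Hypothesis Fb_le1 : forall x, Fb x <= 1.
Hypothesis Fb_le : forall x y, x <= y -> Fb y <= Fb x.
Hypothesis Fb_cvg0 : Fb x @[x --> +oo] --> 0.
Hypothesis Fb_gt0 : ~ \forall x \near +oo, Fb x = 0.

Local Notation B := (reg_fun alpha l1).
Local Notation p := (c `^ alpha^-1).
Definition index_scale (n : nat) : R := B (k n)%:R.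
Local Notation A := index_scale.
Local Notation iset := (inv_set alpha l1).
Local Notation ainv := (asym_inv alpha l1).

Lemma index_ge n : (n <= k n)%N.
Proof. by elim: n => // n ih; exact: leq_ltn_trans ih (k_incr n). Qed.

Lemma index_pinfty : (k n)%:R @[n --> \oo] --> (+oo : set_system R).
Proof.
apply/cvgryPge => a; near=> n.
have : a <= n%:R by near: n; exact: nbhs_infty_ger.
by move=> /le_trans; apply; rewrite ler_nat index_ge.
Unshelve. all: by end_near. Qed.

Lemma index_gt0 n : 0 < (k n)%:R :> R. Proof. by rewrite ltr0n. Qed.

Lemma index_scale_gt0 n : 0 < A n. Proof. exact/reg_fun_gt0/index_gt0. Qed.

Lemma index_scale_pinfty : A n @[n --> \oo] --> +oo.
Proof. exact: (@cvg_comp _ _ _ _ B _ _ _ index_pinfty (reg_fun_pinfty alpha_gt0 alpha_lt1 Hl1)). Qed.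

Lemma index_scale_ratio m : A (n + m)%N / A n @[n --> \oo] --> p ^+ m.
Proof.
have c0 : 0 < c := lt_trans ltr01 c_gt1.
have h1 : A n.+1 / A n @[n --> \oo] --> p.
  have := reg_fun_ratio (alpha := alpha) Hl1 c0 index_pinfty k_ratio.
  apply: cvg_trans; apply: near_eq_cvg; apply: nearW => n.
  by rewrite divfK// gt_eqF// index_gt0.
elim: m => [|m ih].
  rewrite expr0; apply: (@cvg_trans _ (1 @[n --> \oo])); last exact: cvg_cst.
  by apply: near_eq_cvg; apply: nearW => n; rewrite addn0 divff// gt_eqF// index_scale_gt0.
rewrite exprS.
have h2 : A (n + m).+1 / A (n + m)%N @[n --> \oo] --> p.
  by rewrite -(cvg_shiftn m) in h1; exact: h1.
have h3 : (A (n + m).+1 / A (n + m)%N) * (A (n + m)%N / A n) @[n --> \oo] --> p * p ^+ m.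
  exact: cvgM.
apply: cvg_trans h3; apply: near_eq_cvg; apply: nearW => n.
by rewrite addnS mulrA divfK// gt_eqF// index_scale_gt0.
Qed.

Lemma tail_asym_inv : \forall x \near +oo, Fb x = (M (delta x) + h x) / ainv x.
Proof.
near=> x; have -> : Fb x = ell alpha l1 x / x `^ alpha * (M (delta x) + h x) by near: x.
have x0 : 0 < x by near: x; apply: nbhs_pinfty_gt; exact: num_real.
rewrite /asym_inv invrK mulrC; congr (_ * _).
by rewrite /ell mulrAC divff ?mul1r// gt_eqF// powR_gt0.
Unshelve. all: by end_near. Qed.

(** These sets shrink as x grows, so otherwise all of them are unbounded, [sup] is 0 by convention,
    and [Fb] vanishes near infinity. *)
Lemma bounded_inv_set : exists X0, forall x, X0 <= x -> has_ubound (iset x).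
Proof.
apply: contrapT => nX; apply: Fb_gt0.
have ub x : ~ has_ubound (iset x).
  move=> [y Hy]; apply: nX; exists x => x' xx'; exists y => t [t0 ht]; apply: Hy.
  by split => //; exact: le_lt_trans ht.
near=> x; have -> : Fb x = (M (delta x) + h x) / ainv x by near: x; exact: tail_asym_inv.
have s0 : sup (iset x) = 0 by apply: sup_out => -[_]; exact: ub.
by rewrite /asym_inv s0 !invr0 mulr0.
Unshelve. all: by end_near. Qed.

Lemma delta_bracket x : A 0%N <= x -> exists n, A n <= x < A n.+1.
Proof.
move=> x0; have ex : exists n, x < A n.+1.
  have /cvgryPgt /(_ x) [N _ HN] := index_scale_pinfty.
  by exists N; apply: HN => /=; exact: leqnSn.
case: (ex_minnP ex) => n hn mn; exists n; rewrite hn andbT.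
case: n hn mn => [//|n] hn mn; rewrite leNgt; apply/negP => /mn; by rewrite ltnn.
Qed.

(** The discontinuities are countable, hence of Lebesgue measure 0, and cannot fill an interval. *)
Lemma exists_continuity_point (a b : R) : 0 < a -> a < b ->
  exists x, [/\ a < x, x < b & {for x, continuous M}].
Proof.
move=> a0 ab; apply: contrapT => nx.
have : countable (`]a, b[ : set R).
  apply: sub_countable (countable_discontinuity HM).
  apply: subset_card_le => x /=; rewrite in_itv/= => /andP[ax xb].
  split; first exact: lt_trans ax.
  by move=> cx; apply: nx; exists x.
move=> /countable_lebesgue_measure0; rewrite lebesgue_measure_itv/= lte_fin ab => /eqP.
by rewrite -EFinB eqe subr_eq0 gt_eqF.
Qed.

(* If [asym_inv] stayed bounded then [Fb (A n * z)] would stay away from 0,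
   because [M] is bounded below. *)
Lemma asym_inv_cvg : ainv x @[x --> +oo] --> +oo.
Proof.
have [X0 HX0] := bounded_inv_set.
have mono x x' : X0 <= x -> x <= x' -> ainv x <= ainv x'.
  move=> Xx xx'; apply: (asym_inv_mono alpha_gt0 alpha_lt1 Hl1) => //; apply: HX0 => //.
  exact: le_trans xx'.
apply/cvgryPge => L; apply: contrapT => nL.
have bd x : X0 <= x -> ainv x <= L.
  move=> Xx; rewrite leNgt; apply/negP => Lx; apply: nL.
  exists x; split; first exact: num_real.
  by move=> y xy; apply: (le_trans (ltW Lx)); apply: mono => //; exact: ltW.
have [m0 [m1 [m00 hM]]] := modulus_bounds alpha_gt0 c_gt1 HM.
have [z [z1 _ cz]] := exists_continuity_point ltr01 (ltr1n R 2 : 1 < 2).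
have z0 : 0 < z := lt_trans ltr01 z1.
have hz := h_lim z0 cz.
have Az : A n * z @[n --> \oo] --> +oo.
  apply/cvgryPge => a; have /cvgryPge/(_ `|a|) := index_scale_pinfty; apply: filterS => n ha.
  apply: (le_trans (ler_norm a)); apply: (le_trans ha).
  by rewrite ler_peMr ?(ltW z1)// ltW// index_scale_gt0.
have FA := @cvg_comp _ _ _ _ Fb _ _ _ Az Fb_cvg0.
have TA : \forall n \near \oo, Fb (A n * z) = (M (delta (A n * z)) + h (A n * z)) / ainv (A n * z).
  exact: (Az _ tail_asym_inv).
have DA : \forall n \near \oo, forall j, A j <= A n * z -> A n * z < A j.+1 -> delta (A n * z) = A n * z / A j.
  exact: (Az _ Hdelta).
have XA : \forall n \near \oo, X0 <= A n * z by exact: (cvgryPge _).1 Az _.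
have XB : \forall n \near \oo, A 0%N <= A n * z by exact: (cvgryPge _).1 Az _.
have L0 : 0 < L.
  have X00 : X0 <= X0 by [].
  by apply: lt_le_trans (bd _ X00); apply: (asym_inv_gt0 alpha_gt0 alpha_lt1 Hl1); exact: HX0.
have HA : \forall n \near \oo, - (m0 / 2) < h (A n * z).
  by apply: (cvgr_gt _ hz); rewrite oppr_lt0 divr_gt0.
have FA2 : \forall n \near \oo, Fb (A n * z) < m0 / 2 / L.
  by apply: (cvgr_lt _ FA); rewrite !divr_gt0.
have : \forall n \near \oo, False.
  near=> n.
  have e1 : Fb (A n * z) = (M (delta (A n * z)) + h (A n * z)) / ainv (A n * z) by near: n.
  have e2 : - (m0 / 2) < h (A n * z) by near: n.
  have e3 : Fb (A n * z) < m0 / 2 / L by near: n.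
  have e4 : X0 <= A n * z by near: n.
  have e5 : forall j, A j <= A n * z -> A n * z < A j.+1 -> delta (A n * z) = A n * z / A j by near: n.
  have [j /andP[j1 j2]] : exists j, A j <= A n * z < A j.+1.
    by apply: delta_bracket; near: n.
  have d0 : 0 < delta (A n * z).
    rewrite (e5 j j1 j2); apply: divr_gt0; last exact: index_scale_gt0.
    by apply: mulr_gt0 => //; exact: index_scale_gt0.
  have /andP[m0d _] := hM _ d0.
  have a0 : 0 < ainv (A n * z) by apply: (asym_inv_gt0 alpha_gt0 alpha_lt1 Hl1); exact: HX0.
  have : m0 / 2 / L <= Fb (A n * z).
    rewrite e1; apply: ler_pM; rewrite ?divr_ge0 ?invr_ge0 ?(ltW L0) ?(ltW m00)//.
      move: m0d e2; set u := M _; set v := h _; lra.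
    by rewrite lef_pV2 ?posrE// bd.
  by rewrite leNgt e3.
by move=> /filter_ex[].
Unshelve. all: by end_near. Qed.

(** Moving the index by [L] makes both exponents natural numbers: A_(n+L) z then lies eventually
    between A_(n+m) and A_(n+m+2). *)
Lemma position_shift z : 0 < z -> exists L m : nat, p ^+ m.+1 <= p ^+ L * z < p ^+ m.+2.
Proof.
move=> z0; have p1 := period_gt1 alpha_gt0 c_gt1; have p0 : 0 < p := lt_trans ltr01 p1.
have [z1] := period_bracket alpha_gt0 c_gt1 z0.
case: z1 => a.
  move=> /andP[h1 h2]; exists a.+1, 0%N; rewrite [p ^+ a.+1]exprS -mulrA expr1 expr2.
  by rewrite ler_peMr ?(ltW p0)//= ltr_pM2l.
rewrite NegzE -exprnN mulrC => /andP[h1 h2]; exists 0%N, a; rewrite expr0 mul1r.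
rewrite ler_pdivlMr ?exprn_gt0// mul1r in h1; rewrite h1/=.
by rewrite ltr_pdivrMr ?exprn_gt0// -exprS in h2.
Qed.

(** Eventually only the brackets starting at A_(n+m) and A_(n+m+1) can contain A_(n+L) z; which of
    them may depend on n when z is a power of p. For either choice the quotient tends to z times an
    integral power of p, where [M] has the value [M z]. *)
Lemma modulus_position z : 0 < z -> {for z, continuous M} ->
  M (delta (A n * z)) @[n --> \oo] --> M z.
Proof.
move=> z0 cz.
have p1 := period_gt1 alpha_gt0 c_gt1; have p0 : 0 < p := lt_trans ltr01 p1.
have [L [m /andP[b1 b2]]] := position_shift z0.
rewrite -(cvg_shiftn L).
have shift l : A (n + L)%N * z / A (n + l)%N @[n --> \oo] --> p ^+ L * z / p ^+ l.
  have h1 : (A (n + L)%N / A n) * z / (A (n + l)%N / A n) @[n --> \oo] --> p ^+ L * z / p ^+ l.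
    apply: cvgM; first by apply: cvgM; [exact: index_scale_ratio|exact: cvg_cst].
    by apply: cvgV; [rewrite gt_eqF// exprn_gt0|exact: index_scale_ratio].
  apply: cvg_trans h1; apply: near_eq_cvg; apply: nearW => n.
  have a0 : A n != 0 by rewrite gt_eqF// index_scale_gt0.
  have a1 : A (n + l)%N != 0 by rewrite gt_eqF// index_scale_gt0.
  by field; rewrite a0 a1.
have Mlim l : M (A (n + L)%N * z / A (n + l)%N) @[n --> \oo] --> M z.
  have h1 : (p ^+ l / p ^+ L) * (A (n + L)%N * z / A (n + l)%N) @[n --> \oo] --> z.
    rewrite [X in _ --> X](_ : z = (p ^+ l / p ^+ L) * (p ^+ L * z / p ^+ l)).
      by apply: cvgM; [exact: cvg_cst|exact: shift].
    have l0 : p ^+ l != 0 by rewrite gt_eqF// exprn_gt0.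
    have L0 : p ^+ L != 0 by rewrite gt_eqF// exprn_gt0.
    by move: l0 L0; set u := p ^+ l; set v := p ^+ L => l0 L0; field; rewrite l0 L0.
  have := @cvg_comp _ _ _ _ M _ _ _ h1 cz.
  apply: cvg_trans; apply: near_eq_cvg; apply: nearW => n /=.
  have -> : p ^+ l / p ^+ L = p ^ (l%:Z - L%:Z) by rewrite expfzDr ?gt_eqF// -exprnN.
  rewrite (modulus_periodz alpha_gt0 c_gt1 HM)//; apply: divr_gt0; last exact: index_scale_gt0.
  by apply: mulr_gt0 => //; exact: index_scale_gt0.
have Az : A (n + L)%N * z @[n --> \oo] --> +oo.
  apply/cvgryPge => a; have /cvgryPge/(_ (`|a| / z)) := index_scale_pinfty.
  move=> [N _ HN]; exists N => // n /= Nn.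
  have := HN (n + L)%N (leq_trans Nn (leq_addr _ _)); rewrite ler_pdivrMr//.
  by apply: le_trans; exact: ler_norm.
have DA : \forall n \near \oo, forall j, A j <= A (n + L)%N * z -> A (n + L)%N * z < A j.+1 ->
    delta (A (n + L)%N * z) = A (n + L)%N * z / A j.
  exact: (Az _ Hdelta).
have lo : \forall n \near \oo, 1 < A (n + L)%N * z / A (n + m)%N.
  apply: (cvgr_gt _ (shift m)); rewrite ltr_pdivlMr ?exprn_gt0// mul1r.
  by apply: lt_le_trans b1; rewrite exprS ltr_pMl// exprn_gt0.
have hi : \forall n \near \oo, A (n + L)%N * z / A (n + m.+2)%N < 1.
  by apply: (cvgr_lt _ (shift m.+2)); rewrite ltr_pdivrMr ?exprn_gt0// mul1r.
apply/cvgrPdist_le => e e0.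
have E1 : \forall n \near \oo, `|M z - M (A (n + L)%N * z / A (n + m)%N)| <= e.
  by have /cvgrPdist_le := Mlim m; exact.
have E2 : \forall n \near \oo, `|M z - M (A (n + L)%N * z / A (n + m.+1)%N)| <= e.
  by have /cvgrPdist_le := Mlim m.+1; exact.
near=> n; rewrite /=.
have dn : forall j, A j <= A (n + L)%N * z -> A (n + L)%N * z < A j.+1 ->
    delta (A (n + L)%N * z) = A (n + L)%N * z / A j by near: n.
have l1' : 1 < A (n + L)%N * z / A (n + m)%N by near: n.
have l2' : A (n + L)%N * z / A (n + m.+2)%N < 1 by near: n.
rewrite ltr_pdivlMr ?index_scale_gt0// mul1r in l1'; rewrite ltr_pdivrMr ?index_scale_gt0// mul1r in l2'.
have [h1|h1] := leP (A (n + m.+1)%N) (A (n + L)%N * z).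
  by rewrite (dn (n + m.+1)%N) -?addnS//; near: n.
by rewrite (dn (n + m)%N) -?addnS ?(ltW l1')//; near: n.
Unshelve. all: by end_near. Qed.

(** Since A_n = B (k_n), the asymptotic inverse at A_n z is asymptotic to z^alpha k_n, and the
    numerator tends to [M z]. *)
Lemma tail_cvg z : 0 < z -> {for z, continuous M} ->
  (k n)%:R * Fb (A n * z) @[n --> \oo] --> ltail alpha M z.
Proof.
move=> z0 cz; have [X0 HX0] := bounded_inv_set.
have Az : A n * z @[n --> \oo] --> +oo.
  apply/cvgryPge => a; have /cvgryPge/(_ (`|a| / z)) := index_scale_pinfty.
  by apply: filterS => n; rewrite ler_pdivrMr//; apply: le_trans; exact: ler_norm.
have TA : \forall n \near \oo, Fb (A n * z) = (M (delta (A n * z)) + h (A n * z)) / ainv (A n * z).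
  exact: (Az _ tail_asym_inv).
have za : 0 < z `^ alpha by exact: powR_gt0.
have ra : ainv (A n * z) / (k n)%:R @[n --> \oo] --> z `^ alpha.
  apply: (asym_inv_ratio alpha_gt0 alpha_lt1 Hl1 HX0 asym_inv_cvg za index_pinfty).
  rewrite -powRrM mulfV ?gt_eqF// powRr1 ?(ltW z0)//.
  apply: (@cvg_trans _ (z @[n --> \oo])); last exact: cvg_cst.
  by apply: near_eq_cvg; apply: nearW => n; rewrite mulrAC divff ?mul1r// gt_eqF// index_scale_gt0.
have lim : (M (delta (A n * z)) + h (A n * z)) * (ainv (A n * z) / (k n)%:R)^-1 @[n --> \oo]
    --> (M z + 0) * (z `^ alpha)^-1.
  apply: cvgM; first by apply: cvgD; [exact: modulus_position|exact: h_lim].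
  by apply: cvgV => //; rewrite gt_eqF.
rewrite addr0 -powRN in lim.
apply: cvg_trans lim; apply: near_eq_cvg; near=> n.
have -> : Fb (A n * z) = (M (delta (A n * z)) + h (A n * z)) / ainv (A n * z) by near: n.
by rewrite invf_div mulrCA.
Unshelve. all: by end_near. Qed.

(* By induction on [j], starting where [k_(j+1) / k_j <= (A_(j+1) / A_j) ^ b]
   holds: the left side tends to [c] and the right side to [c ^ (b / alpha)]. *)
Lemma tail_dominated : exists b C J, [/\ 0 <= b < 1, 0 <= C &
  forall j x, (J <= j)%N -> 0 < x -> (k j)%:R * Fb (A j * x) <= C * (1 + x `^ (- b))].
Proof.
(* Any exponent strictly between alpha and 1 would do: b > alpha gives c < p^b, and b < 1 keeps s^-b
   integrable at 0. *)
pose b := (alpha + 1) / 2.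
have b01 : 0 <= b < 1.
  by have h1 := alpha_gt0; have h2 := alpha_lt1; apply/andP; rewrite /b; split; lra.
have ab : alpha < b by have h2 := alpha_lt1; rewrite /b; lra.
have b0 : 0 < b := lt_trans alpha_gt0 ab.
have c0 : 0 < c := lt_trans ltr01 c_gt1.
have h2 : (0 : R) < 1 / 2 by lra.
(* As z < 1, monotonicity carries the bound at [A j * z] over to every argument [A j * x] with x >=
   1. *)
have [z [z1 z2 cz]] : exists x, [/\ 1 / 2 < x, x < 1 & {for x, continuous M}].
  by apply: exists_continuity_point => //; lra.
have z0 : 0 < z := lt_trans h2 z1.
have T := tail_cvg z0 cz; set G := ltail alpha M z in T.
have G0 : 0 <= G by apply: (ltail_ge0 HM).
have [J1 _ HJ1] : \forall n \near \oo, (k n)%:R * Fb (A n * z) < G + 1.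
  by apply: (cvgr_lt _ T); rewrite ltrDl.
have hA : (A n.+1 / A n) `^ b @[n --> \oo] --> p `^ b.
  have h1 : A (n + 1)%N / A n @[n --> \oo] --> p by rewrite -[X in _ --> X]expr1; exact: index_scale_ratio.
  have h3 : A n.+1 / A n @[n --> \oo] --> p.
    by apply: cvg_trans h1; apply: near_eq_cvg; apply: nearW => n; rewrite addn1.
  have p0 : 0 < p by rewrite powR_gt0.
  exact: (@cvg_comp _ _ _ _ (fun y => y `^ b) _ _ _ h3 (powR_continuous (a := b) p0)).
have cb : c < p `^ b.
  rewrite -powRrM -{1}(powRr1 (ltW c0)) /powR gt_eqF// ltr_expR ltr_pM2r ?ln_gt0//.
  by rewrite mulrC ltr_pdivlMr// mul1r.
pose mid := (c + p `^ b) / 2.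
have [J2 _ HJ2] : \forall n \near \oo, (k n.+1)%:R / (k n)%:R < mid.
  by apply: (cvgr_lt _ k_ratio); rewrite /mid; move: cb; set u := _ `^ b; lra.
have [J3 _ HJ3] : \forall n \near \oo, mid < (A n.+1 / A n) `^ b.
  by apply: (cvgr_gt _ hA); rewrite /mid; move: cb; set u := _ `^ b; lra.
pose J := maxn J1 (maxn J2 J3).
have mid0 : 0 < mid by rewrite /mid; move: cb; set u := _ `^ b; lra.
(* The three terms cover an induction step that leaves ]0, 1[, the arguments x >= 1, and the start j
   = J, where the tail is bounded by 1. *)
pose K := Num.max (Num.max (mid * (G + 1)) (G + 1)) (k J)%:R.
have K1 : mid * (G + 1) <= K by rewrite !le_max lexx.
have K2 : G + 1 <= K by rewrite !le_max lexx orbT.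
have K3 : (k J)%:R <= K by rewrite !le_max lexx orbT.
have K0 : 0 <= K := le_trans (ler0n _ _) K3.
have one j x : (J <= j)%N -> 1 <= x -> (k j)%:R * Fb (A j * x) <= G + 1.
  move=> Jj x1; apply: le_trans (ltW (HJ1 j _)) => /=.
    rewrite ler_wpM2l// Fb_le// (ler_pM2l (index_scale_gt0 j)); exact: le_trans (ltW z2) x1.
  by apply: leq_trans Jj; rewrite leq_maxl.
have main j x : (J <= j)%N -> 0 < x -> x < 1 -> (k j)%:R * Fb (A j * x) <= K * x `^ (- b).
  move=> Jj; rewrite -(subnKC Jj); move: (j - J)%N => {j Jj} i.
  have ge1 y : 0 < y -> y < 1 -> 1 <= y `^ (- b).
    move=> y0 y1; have : y `^ b <= 1 `^ b.
      by apply: ge0_ler_powR; rewrite ?nnegrE ?(ltW b0) ?(ltW y0) ?(ltW y1).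
    by rewrite powR1 powRN invf_ge1// powR_gt0.
  elim: i x => [|i ih] x x0 x1.
    rewrite addn0; apply: (@le_trans _ _ (k J)%:R); first by rewrite ler_piMr ?Fb_le1.
    by apply: (le_trans K3); rewrite ler_peMr ?ge1.
  rewrite addnS; set j := (J + i)%N.
  have kj : (k j.+1)%:R / (k j)%:R < mid.
    by apply: HJ2 => /=; rewrite (leq_trans _ (leq_addr _ _))// /J !leq_max leqnn orbT.
  have Aj : mid < (A j.+1 / A j) `^ b.
    by apply: HJ3 => /=; rewrite (leq_trans _ (leq_addr _ _))// /J !leq_max leqnn !orbT.
  pose rho := A j.+1 / A j.
  have rho0 : 0 < rho by rewrite divr_gt0 ?index_scale_gt0.
  have AE : A j.+1 * x = A j * (x * rho).
    by rewrite /rho [RHS]mulrCA [A j * (_ / _)]mulrC divfK 1?[RHS]mulrC// gt_eqF// index_scale_gt0.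
  have kE : (k j.+1)%:R <= mid * (k j)%:R by rewrite -ler_pdivrMr ?index_gt0// ltW.
  rewrite AE.
  apply: (@le_trans _ _ (mid * ((k j)%:R * Fb (A j * (x * rho))))).
    by rewrite mulrA ler_wpM2r.
  have [y1|y1] := leP 1 (x * rho).
    apply: (@le_trans _ _ (mid * (G + 1))).
      by rewrite ler_pM2l// one// leq_addr.
    by apply: (le_trans K1); rewrite ler_peMr ?ge1.
  have y0 : 0 < x * rho by rewrite mulr_gt0.
  apply: (@le_trans _ _ (mid * (K * (x * rho) `^ (- b)))).
    by rewrite ler_pM2l// ih.
  rewrite powRM ?(ltW x0) ?(ltW rho0)// mulrCA ler_wpM2l// mulrCA.
  rewrite ler_piMr ?powR_ge0// powRN ler_pdivrMr ?powR_gt0// mul1r; exact: ltW.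
exists b, K, J; split => // j x Jj x0.
have [x1|x1] := leP 1 x.
  apply: (le_trans (one _ _ Jj x1)); apply: (le_trans K2).
  by rewrite ler_peMr// lerDl powR_ge0.
apply: (le_trans (main _ _ Jj x0 x1)).
by rewrite ler_wpM2l// lerDr.
Qed.

End Tails.

(** * Limit laws *)

Section SumLawLimit.
Context {R : realType}.
Variables (alpha c : R) (M : R -> R).
Hypothesis alpha_gt0 : 0 < alpha.
Hypothesis alpha_lt1 : alpha < 1.
Hypothesis c_gt1 : 1 < c.
Hypothesis HM : semistable_modulus alpha c M.
Context dV (TV : measurableType dV) (Q : probability TV R) (V : R -> {RV Q >-> R}).
Hypothesis HV : forall lambda : R, 0 < lambda -> semistable_rv alpha M lambda (V lambda).
Local Notation RR := (measurableTypeR R).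
Variables (f : nat -> R) (D : probability RR R).
Hypothesis Hf : prob_sequence f.
Hypothesis HD : forall j : nat, D [set j.+1%:R] = (f j)%:E.

Definition tail_prob (x : R) : R := fine (D [set y : RR | x < y]).
Local Notation Fb := tail_prob.

Lemma measurable_gt (x : R) : measurable ([set y : RR | x < y] : set RR).
Proof.
rewrite (_ : [set y | _] = `]x, +oo[%classic); first exact: measurable_itv.
by apply/seteqP; split => y /=; rewrite in_itv/= andbT.
Qed.

Lemma tail_probK x : (Fb x)%:E = D [set y : RR | x < y].
Proof. by rewrite /Fb fineK// fin_num_measure//; exact: measurable_gt. Qed.

Lemma tail_prob_ge0 x : 0 <= Fb x.
Proof. by rewrite -lee_fin tail_probK. Qed.

Lemma tail_prob_le1 x : Fb x <= 1.
Proof. by rewrite -lee_fin tail_probK probability_le1//; exact: measurable_gt. Qed.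

Lemma tail_prob_le x y : x <= y -> Fb y <= Fb x.
Proof.
move=> xy; rewrite -lee_fin !tail_probK; apply: le_measure; rewrite ?inE.
- exact: measurable_gt.
- exact: measurable_gt.
- by move=> z /=; exact: le_lt_trans.
Qed.

(** [m] times the law of tau / N in the role of a Levy measure: on cos (t x) - 1 and sin (t x) it
    gives the parts of m (phi - 1), the first-order exponent of the power phi^m of the
    characteristic function. *)
Definition sum_functional (m N : nat) (g : R -> R) : R :=
  m%:R * \int[D]_y g (Num.max (y / N%:R) 0).

Lemma measurable_scaled (N : nat) : measurable_fun setT (fun y : RR => (y : R) / N%:R).
Proof. by apply: measurable_funM. Qed.

Lemma sum_functional_levy m N : (0 < N)%N ->
  levy_functional (sum_functional m N) (fun s => m%:R * Fb (N%:R * s)).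
Proof.
move=> N0; have N0' : 0 < N%:R :> R by rewrite ltr0n.
apply: (@levy_functional_measure _ _ _ D (fun y => y / N%:R) (fun s => Fb (N%:R * s)) 1 0) => //.
- exact: measurable_scaled.
- move=> s s0; rewrite tail_probK; congr (D _); apply/seteqP; split => y /=;
  by rewrite ltr_pdivlMr// mulrC.
- by rewrite lexx ltr01.
- by move=> s s0; rewrite mul1r (le_trans (tail_prob_le1 _))// lerDl powR_ge0.
Qed.

(** The law [D] lives on the positive integers, so the truncation at 0 changes nothing. *)
Lemma sum_functional_cos_sin m N t : (0 < N)%N ->
  sum_functional m N (fun x => cos (t * x) - 1) =
    m%:R * (\int[D]_y cos (t / N%:R * y) - 1) /\
  sum_functional m N (fun x => sin (t * x)) = m%:R * \int[D]_y sin (t / N%:R * y).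
Proof.
move=> N0; have N0' : 0 < N%:R :> R by rewrite ltr0n.
have mp := @measurable_pos_nats R; have np := pos_nats_full Hf HD.
have mc (s : R) : measurable_fun setT (fun y : RR => cos (s * y)) by exact: measurable_cosM.
have ms (s : R) : measurable_fun setT (fun y : RR => sin (s * y)).
  by apply: (measurableT_comp measurable_sin); exact: measurable_funM.
have mm : measurable_fun setT (fun y : RR => Num.max ((y : R) / N%:R) 0).
  by apply: measurable_maxr; [exact: measurable_scaled|exact: measurable_cst].
have maxE (y : RR) : y \in pos_nats -> t * Num.max ((y : R) / N%:R) 0 = t / N%:R * y.
  rewrite inE => -[j _ ->]; rewrite max_l ?divr_ge0//.
  by rewrite mulrA mulrAC.
split; congr (_ * _).
  transitivity (\int[D]_y (1 * cos (t / N%:R * y) + (- 1) * cst 1 y)).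
    apply: (Rintegral_eq_on mp np).
    - apply: measurable_funB => //; exact: (measurableT_comp (mc t) mm).
    - by apply: measurable_funD; apply: measurable_funM.
    - by move=> y yp; rewrite maxE// mul1r mulr1.
  rewrite (@Rintegral_lin _ _ _ D _ _ 1 (-1) 1)//.
  - by rewrite Rintegral_prob_cst !mul1r mulr1.
  - by move=> y; exact: normr_cos_le1.
  - by move=> y; rewrite normr1.
apply: (Rintegral_eq_on mp np) => //.
- exact: (measurableT_comp (ms t) mm).
- by move=> y yp; rewrite maxE.
Qed.

Variables (k : nat -> nat) (A : nat -> R).
Hypothesis k_gt0 : forall n, (0 < k n)%N.
Hypothesis A_gt0 : forall n, 0 < A n.
Hypothesis k_pinfty : (k n)%:R @[n --> \oo] --> (+oo : set_system R).
Hypothesis tail_lim : forall z, 0 < z -> {for z, continuous M} ->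
  (k n)%:R * Fb (A n * z) @[n --> \oo] --> ltail alpha M z.
Hypothesis tail_dom : exists b C J, [/\ 0 <= b < 1, 0 <= C &
  forall j x, (J <= j)%N -> 0 < x -> (k j)%:R * Fb (A j * x) <= C * (1 + x `^ (- b))].

(** Monotonicity of the tail squeezes the value at z_n between those at fixed continuity points z1 <
    z < z2 where [ltail] is close to its value at z. *)
Lemma tail_lim_moving (j_ : nat -> nat) (z_ : nat -> R) z :
  j_ n @[n --> \oo] --> \oo -> 0 < z -> {for z, continuous M} ->
  z_ n @[n --> \oo] --> z ->
  (k (j_ n))%:R * Fb (A (j_ n) * z_ n) @[n --> \oo] --> ltail alpha M z.
Proof.
move=> hj z0 cz hz; apply/cvgrPdist_le => e e0.
have cG : {for z, continuous (ltail alpha M)} by exact: ltail_continuous.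
have e2 : 0 < e / 2 by rewrite divr_gt0.
have [d /= d0 hd] : \forall y \near z, `|ltail alpha M z - ltail alpha M y| <= e / 2.
  by move/cvgrPdist_le : cG => /(_ _ e2).
pose d' := Num.min d (z / 2).
have d'0 : 0 < d' by rewrite lt_min d0 divr_gt0.
have d'd : d' <= d by rewrite ge_min lexx.
have d'z : d' < z by rewrite gt_min; apply/orP; right; lra.
have [z1 [z1a z1b c1]] : exists x, [/\ z - d' < x, x < z & {for x, continuous M}].
  by apply: (exists_continuity_point HM); lra.
have [z2 [z2a z2b c2]] : exists x, [/\ z < x, x < z + d' & {for x, continuous M}].
  by apply: (exists_continuity_point HM); lra.
have G1 : `|ltail alpha M z - ltail alpha M z1| <= e / 2.
  apply: hd => /=; rewrite ger0_norm; lra.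
have G2 : `|ltail alpha M z - ltail alpha M z2| <= e / 2.
  apply: hd => /=; rewrite ler0_norm; lra.
have z10 : 0 < z1 by lra.
have z20 : 0 < z2 by lra.
have L1 : \forall n \near \oo, `|ltail alpha M z1 - (k (j_ n))%:R * Fb (A (j_ n) * z1)| <= e / 2.
  have := @cvg_comp _ _ _ _ (fun n => (k n)%:R * Fb (A n * z1)) _ _ _ hj (tail_lim z10 c1).
  by move/cvgrPdist_le => /(_ _ e2).
have L2 : \forall n \near \oo, `|ltail alpha M z2 - (k (j_ n))%:R * Fb (A (j_ n) * z2)| <= e / 2.
  have := @cvg_comp _ _ _ _ (fun n => (k n)%:R * Fb (A n * z2)) _ _ _ hj (tail_lim z20 c2).
  by move/cvgrPdist_le => /(_ _ e2).
have Z1 : \forall n \near \oo, z1 <= z_ n by apply: (cvgr_ge _ hz).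
have Z2 : \forall n \near \oo, z_ n <= z2 by apply: (cvgr_le _ hz).
near=> n.
have l1 : `|ltail alpha M z1 - (k (j_ n))%:R * Fb (A (j_ n) * z1)| <= e / 2 by near: n.
have l2 : `|ltail alpha M z2 - (k (j_ n))%:R * Fb (A (j_ n) * z2)| <= e / 2 by near: n.
have y1 : z1 <= z_ n by near: n.
have y2 : z_ n <= z2 by near: n.
have m1 : (k (j_ n))%:R * Fb (A (j_ n) * z_ n) <= (k (j_ n))%:R * Fb (A (j_ n) * z1).
  by rewrite ler_wpM2l// tail_prob_le// (ler_pM2l (A_gt0 _)).
have m2 : (k (j_ n))%:R * Fb (A (j_ n) * z2) <= (k (j_ n))%:R * Fb (A (j_ n) * z_ n).
  by rewrite ler_wpM2l// tail_prob_le// (ler_pM2l (A_gt0 _)).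
move: G1 G2 l1 l2 m1 m2; rewrite !ler_norml.
set g := ltail _ _ z; set g1 := ltail _ _ z1; set g2 := ltail _ _ z2.
set u := (k _)%:R * Fb (A _ * z1); set v := (k _)%:R * Fb (A _ * z2); set w := (k _)%:R * Fb (A _ * z_ n).
clear => /andP[a1 a2] /andP[a3 a4] /andP[a5 a6] /andP[a7 a8] a9 a10.
by apply/andP; split; lra.
Unshelve. all: by end_near. Qed.

(** When m ~ lambda k_j and N ~ w A_j, the quantity m P(tau > N s) tends to lambda [ltail] (w s).
    This is the Levy tail of V_lambda / y exactly when lambda^(1/alpha) y = w, which explains the
    argument of [vcdf]. *)
Lemma sum_law_limit (m_ N_ j_ : nat -> nat) (lambda w : R) :
  j_ n @[n --> \oo] --> \oo -> 0 < lambda -> 0 < w ->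
  (m_ n)%:R / (k (j_ n))%:R @[n --> \oo] --> lambda ->
  (N_ n)%:R / A (j_ n) @[n --> \oo] --> w ->
  fine (sum_law D (m_ n) [set x : RR | `|x : R| <= (N_ n)%:R]) @[n --> \oo] -->
  vcdf V lambda (lambda `^ (- alpha^-1) * w).
Proof.
move=> hj l0 w0 hm hN.
have [b [C [J [b01 C0 hdom]]]] := tail_dom.
(* The sequences are shifted by [r0] because the limit theorem asks for its tail bound at every
   index. *)
have [r0 _ Hr0] : \forall n \near \oo, [/\ (J <= j_ n)%N,
    (m_ n)%:R / (k (j_ n))%:R <= 2 * lambda, w / 2 <= (N_ n)%:R / A (j_ n) & (0 < N_ n)%N].
  have h1 : \forall n \near \oo, (J <= j_ n)%N by exact: (hj _ (nbhs_infty_ge J)).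
  have h2 : \forall n \near \oo, (m_ n)%:R / (k (j_ n))%:R <= 2 * lambda.
    by apply: (cvgr_le _ hm); lra.
  have h3 : \forall n \near \oo, w / 2 <= (N_ n)%:R / A (j_ n).
    by apply: (cvgr_ge _ hN); lra.
  near=> n; have h4 : w / 2 <= (N_ n)%:R / A (j_ n) by near: n.
  split; [by near: n|by near: n|by []|].
  rewrite lt0n; apply/eqP => N0; move: h4; rewrite N0 mul0r leNgt divr_gt0//.
rewrite -(cvg_shiftn r0).
pose m n := m_ (n + r0)%N; pose N n := N_ (n + r0)%N; pose j n := j_ (n + r0)%N.
have {hj}hj : j n @[n --> \oo] --> \oo.
  move=> S hS; have [n0 _ Hn0] := hj _ hS; exists n0 => // n /= nn; apply: Hn0 => /=.
  by rewrite (leq_trans nn)// leq_addr.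
have {hm}hm : (m n)%:R / (k (j n))%:R @[n --> \oo] --> lambda.
  by rewrite -(cvg_shiftn r0) in hm; exact: hm.
have {hN}hN : (N n)%:R / A (j n) @[n --> \oo] --> w.
  by rewrite -(cvg_shiftn r0) in hN; exact: hN.
have {Hr0}H n : [/\ (J <= j n)%N, (m n)%:R / (k (j n))%:R <= 2 * lambda,
    w / 2 <= (N n)%:R / A (j n) & (0 < N n)%N].
  by apply: Hr0 => /=; rewrite leq_addl.
have k0 n : 0 < (k (j n))%:R :> R by rewrite ltr0n.
have N0 n : 0 < (N n)%:R :> R by rewrite ltr0n; have [] := H n.
have hkj := @cvg_comp _ _ _ _ (fun n => (k n)%:R : R) _ _ _ hj k_pinfty.
have hmoo : (m n)%:R @[n --> \oo] --> (+oo : set_system R).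
  have h2 : \forall n \near \oo, lambda / 2 <= (m n)%:R / (k (j n))%:R.
    by apply: (cvgr_ge _ hm); lra.
  apply/cvgryPge => a.
  have h3 : \forall n \near \oo, `|a| / (lambda / 2) <= (k (j n))%:R by exact: (cvgryPge _).1 hkj _.
  near=> n.
  have g2 : lambda / 2 <= (m n)%:R / (k (j n))%:R by near: n.
  have g3 : `|a| / (lambda / 2) <= (k (j n))%:R by near: n.
  rewrite ler_pdivlMr// in g2; apply: le_trans g2; rewrite ler_pdivrMr ?divr_gt0// mulrC in g3.
  exact: le_trans (ler_norm a) g3.
set y := lambda `^ _ * w.
have y0 : 0 < y by rewrite mulr_gt0// powR_gt0.
have ly : lambda `^ alpha^-1 * y = w.
  by rewrite /y mulrA powRN mulfV ?mul1r// gt_eqF// powR_gt0.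
have fE n : fine (sum_law D (m n) [set x : RR | `|x : R| <= (N n)%:R]) =
   fine (sum_law D (m n) [set x : RR | `|(x : R) / (N n)%:R| <= 1]).
  congr (fine (sum_law D (m n) _)); apply/seteqP; split => x /=;
  by rewrite normrM normfV (ger0_norm (ltW (N0 n))) ler_pdivrMr// mul1r.
apply: (@cvg_trans _ (fine (sum_law D (m n) [set x : RR | `|(x : R) / (N n)%:R| <= 1]) @[n --> \oo])).
  by apply: near_eq_cvg; apply: nearW => n; rewrite -fE.
pose C' := 2 * lambda * C * (1 + (w / 2) `^ (- b)).
apply: (@semistable_limit _ _ _ _ alpha_gt0 alpha_lt1 c_gt1 HM _ _ _ _ HV _ _ _ _
  (fun n => sum_functional (m n) (N n)) (fun n s => (m n)%:R * Fb ((N n)%:R * s)) C' b _ _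
  [set s | 0 < s /\ ~ {for w * s, continuous M}]) => //.
- by move=> n; exact: measurable_scaled.
- by move=> n; apply: sum_functional_levy; have [] := H n.
- move=> n s s0; have [Jj hm2 hw2 _] := H n.
  have E : (m n)%:R * Fb ((N n)%:R * s) =
     (m n)%:R / (k (j n))%:R * ((k (j n))%:R * Fb (A (j n) * ((N n)%:R / A (j n) * s))).
    by rewrite mulrA divfK ?gt_eqF// mulrA [A _ * _]mulrC divfK// gt_eqF.
  rewrite E (_ : C' * _ = (2 * lambda) * (C * ((1 + (w / 2) `^ (- b)) * (1 + s `^ (- b))))); last first.
    by rewrite /C' !mulrA.
  have w2 : 0 < w / 2 by rewrite divr_gt0.
  apply: ler_pM => //; first by rewrite mulr_ge0 ?tail_prob_ge0.
  apply: (@le_trans _ _ ((k (j n))%:R * Fb (A (j n) * (w / 2 * s)))).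
    by rewrite ler_wpM2l// tail_prob_le// (ler_pM2l (A_gt0 _)) ler_wpM2r// ltW.
  apply: (le_trans (hdom _ _ Jj (mulr_gt0 w2 s0))).
  rewrite (powRM (- b) (ltW w2) (ltW s0)) ler_wpM2l//.
  set u := (w / 2) `^ _; set v := s `^ _.
  have -> : (1 + u) * (1 + v) = 1 + u * v + (u + v) by ring.
  by rewrite lerDl addr_ge0 ?powR_ge0.
- exact: (countable_stail_discontinuity HM w0).
- move=> s s0 hs.
  have cs : {for w * s, continuous M} by apply: contrapT => h; apply: hs.
  have ws0 : 0 < w * s by rewrite mulr_gt0.
  have -> : stail alpha M lambda y s = lambda * ltail alpha M (w * s).
    by rewrite /stail mulrA ly (rtail_continuous HM ws0 cs).1.
  have hz : (N n)%:R / A (j n) * s @[n --> \oo] --> w * s.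
    by apply: cvgM => //; exact: cvg_cst.
  have lim : (m n)%:R / (k (j n))%:R * ((k (j n))%:R * Fb (A (j n) * ((N n)%:R / A (j n) * s)))
      @[n --> \oo] --> lambda * ltail alpha M (w * s).
    by apply: cvgM => //; exact: tail_lim_moving.
  apply: cvg_trans lim; apply: near_eq_cvg; apply: nearW => n.
  by rewrite mulrA divfK ?gt_eqF// mulrA [A _ * _]mulrC divfK// gt_eqF.
- move=> t p q.
  have N0' n : (0 < N n)%N by have [] := H n.
  under eq_fun do rewrite (sum_functional_cos_sin _ t (N0' _)).1; move=> hp.
  under eq_fun do rewrite (sum_functional_cos_sin _ t (N0' _)).2; move=> hq.
  have lim := cs_pow_cvg hmoo hp hq.
  apply: cvg_trans lim; apply: near_eq_cvg; apply: nearW => n.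
  rewrite -(sum_law_cos_sin D (t / (N n)%:R) (m n)) /=.
  by apply: eq_Rintegral => x _; rewrite mulrA mulrAC.
Unshelve. all: by end_near. Qed.

End SumLawLimit.

(** * Convergence along subsequences *)

Section Subsequences.
Context {R : realType}.

Lemma increasing_seq_cvg (phi : nat -> nat) : increasing_seq phi -> phi n @[n --> \oo] --> \oo.
Proof.
move=> ip; have ge n : (n <= phi n)%N.
  elim: n => // n ih; apply: (leq_ltn_trans ih).
  by rewrite ltnNge; apply/negP; rewrite -[(_ <= _)%N]/(phi n.+1 <= phi n)%O ip ltnn.
move=> S [N _ HN]; exists N => // n /= Nn; apply: HN => /=; exact: leq_trans (ge n).
Qed.

Lemma subseq_bounded_cvg (g : nat -> R) (lo hi : R) : (forall n, lo <= g n <= hi) ->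
  exists (phi : nat -> nat) s, [/\ phi n @[n --> \oo] --> \oo,
    g (phi n) @[n --> \oo] --> s & lo <= s <= hi].
Proof.
move=> gb; have bg : bounded_fun g.
  exists (`|lo| + `|hi|); split; first exact: num_real.
  move=> x xl n _ /=; apply: le_trans (ltW xl).
  have /andP[h1 h2] := gb n; have a1 := ler_norm hi; have a2 := ler_norm (- lo).
  rewrite normrN in a2; have a3 := normr_ge0 lo; have a4 := normr_ge0 hi.
  by clear -h1 h2 a1 a2 a3 a4; rewrite ler_norml; apply/andP; split; lra.
have [phi ip cp] := bolzano_weierstrass bg.
have [s hs] : exists s : R, g (phi n) @[n --> \oo] --> s by exists (limn (g \o phi)); exact: cp.
exists phi, s; split => //; first exact: increasing_seq_cvg.
have N1 : \forall n \near \oo, lo <= g (phi n) by apply: nearW => n; have /andP[] := gb (phi n).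
have N2 : \forall n \near \oo, g (phi n) <= hi by apply: nearW => n; have /andP[] := gb (phi n).
by apply/andP; split; [exact: (cvgr_to_ge hs N1)|exact: (cvgr_to_le hs N2)].
Qed.

(** Only subsequences along which a bounded auxiliary sequence converges need to be treated; [g]
    will be a position parameter. *)
Lemma cvg_by_subseq (u g : nat -> R) (L lo hi : R) : (forall n, lo <= g n <= hi) ->
  (forall (phi : nat -> nat) s, phi n @[n --> \oo] --> \oo -> lo <= s <= hi ->
     g (phi n) @[n --> \oo] --> s -> u (phi n) @[n --> \oo] --> L) ->
  u n @[n --> \oo] --> L.
Proof.
move=> gb hu; apply/cvgrPdist_le => e e0; apply: contrapT => nh.
have H N : exists m, (N <= m)%N /\ e < `|L - u m|.
  apply: contrapT => h; apply: nh; exists N => // n /= Nn; rewrite leNgt; apply/negP => lt.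
  by apply: h; exists n.
have [psi hpsi] := choice H.
have [phi [s [hphi hs sb]]] := subseq_bounded_cvg (fun n => gb (psi n)).
have hc : psi (phi n) @[n --> \oo] --> \oo.
  move=> S [N _ HN]; have [N' _ HN'] := hphi _ (nbhs_infty_ge N).
  exists N' => // n /= h; apply: HN => /=; apply: leq_trans (hpsi (phi n)).1.
  exact: HN'.
have /cvgrPdist_le/(_ e e0)[N _ /(_ N (leqnn N))] := hu _ _ hc sb hs.
by move=> /= h; have := (hpsi (phi N)).2; rewrite ltNge h.
Qed.

End Subsequences.

(** * Distribution functions of the limit laws *)

Section LimitCdf.
Context {R : realType}.
Variables (alpha c : R) (M : R -> R).
Hypothesis alpha_gt0 : 0 < alpha.
Hypothesis alpha_lt1 : alpha < 1.
Hypothesis c_gt1 : 1 < c.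
Hypothesis HM : semistable_modulus alpha c M.
Context dV (TV : measurableType dV) (Q : probability TV R) (V : R -> {RV Q >-> R}).
Hypothesis HV : forall lambda : R, 0 < lambda -> semistable_rv alpha M lambda (V lambda).

Lemma measurable_vle l y : measurable [set v | V l v <= y].
Proof.
have := (@measurable_funPTI _ _ _ _ (V l)) `]-oo, y]%classic (measurable_itv _).
by congr measurable; apply/seteqP; split => v /=; rewrite in_itv.
Qed.

Lemma vcdfK l y : (vcdf V l y)%:E = Q [set v | V l v <= y].
Proof. by rewrite /vcdf fineK// fin_num_measure//; exact: measurable_vle. Qed.

Lemma vcdf_ge0 l y : 0 <= vcdf V l y.
Proof. by rewrite -lee_fin vcdfK. Qed.

Lemma vcdf_le1 l y : vcdf V l y <= 1.
Proof. by rewrite -lee_fin vcdfK probability_le1//; exact: measurable_vle. Qed.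

Lemma vcdf_le l y y' : y <= y' -> vcdf V l y <= vcdf V l y'.
Proof.
move=> yy'; rewrite -lee_fin !vcdfK; apply: le_measure; rewrite ?inE.
- exact: measurable_vle.
- exact: measurable_vle.
- by move=> v /= h; exact: le_trans yy'.
Qed.

Lemma vcdfE l y : (vcdf V l y)%:E = cdf (V l) y.
Proof.
by rewrite vcdfK /cdf /distribution /pushforward; congr (Q _).
Qed.

(** Both values are the limit of one constant sequence in [vcdf_cvg]. *)
Lemma vcdf_scale l y (z : int) : 0 < l -> 0 < y -> vcdf V (c ^ z * l) y = vcdf V l y.
Proof.
move=> l0 y0.
have h z' : vcdf V l y @[n --> \oo] --> vcdf V (c ^ z' * l) y.
  apply: (vcdf_cvg alpha_gt0 alpha_lt1 c_gt1 HM HV (l_ := fun=> l) (y_ := fun=> y)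
    (z := z') l0 y0 (erefl _) y0) => //; exact: cvg_cst.
exact: (cvg_unique _ (h z) (cvg_cst _)).
Qed.

Lemma vcdf_cvg_same (l_ y_ : nat -> R) (l y : R) : 0 < l -> 0 < y ->
  (forall n, 0 < l_ n) -> (forall n, 0 < y_ n) ->
  l_ n @[n --> \oo] --> l -> y_ n @[n --> \oo] --> y ->
  vcdf V (l_ n) (y_ n) @[n --> \oo] --> vcdf V l y.
Proof.
move=> l0 y0 l_0 y_0 hl hy.
have y2 : 0 < y / 2 by rewrite divr_gt0.
have [N _ HN] : \forall n \near \oo, y / 2 <= y_ n by apply: (cvgr_ge _ hy); lra.
rewrite -(cvg_shiftn N); rewrite -(cvg_shiftn N) in hl; rewrite -(cvg_shiftn N) in hy.
apply: (vcdf_cvg alpha_gt0 alpha_lt1 c_gt1 HM HV (l_ := fun n => l_ (n + N)%N)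
  (y_ := fun n => y_ (n + N)%N) (z := 0) l0 y0 _ y2) => //.
- by rewrite expr0z mul1r.
- by move=> n; apply: HN => /=; rewrite leq_addl.
Qed.

Lemma vcdf_cvg1 l : vcdf V l y @[y --> +oo] --> (1 : R).
Proof.
have h : (vcdf V l y)%:E @[y --> +oo] --> 1%E.
  have := @cvg_cdfy1 _ _ _ _ (V l); apply: cvg_trans; apply: near_eq_cvg.
  by apply: nearW => y; rewrite vcdfE.
by have /fine_cvgP[_] := h.
Qed.

(** V_l is nonnegative without atom at 0, so its distribution function vanishes at 0, where it is
    right-continuous. *)
Lemma vcdf_cvg0 l : 0 < l -> vcdf V l (n.+1%:R^-1) @[n --> \oo] --> (0 : R).
Proof.
move=> l0.
have h0 : vcdf V l 0 = 0.
  apply/EFin_inj; rewrite vcdfK.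
  apply: (eq_trans _ (semistable_no_atom alpha_gt0 alpha_lt1 c_gt1 HM l0 (HV l0) 0)); congr (Q _).
  apply/seteqP; split => v /= => [v0|->//].
  by apply/eqP; rewrite eq_le v0 (HV l0).1.
have hr : vcdf V l y @[y --> 0^'+] --> (0 : R).
  have h : (vcdf V l y)%:E @[y --> 0^'+] --> 0%:E.
    have hc : cdf (V l) 0 = 0%:E by rewrite -vcdfE h0.
    have h : cdf (V l) y @[y --> 0^'+] --> 0%:E.
      by rewrite -hc; exact: cdf_right_continuous.
    by apply: cvg_trans h; apply: near_eq_cvg; apply: nearW => y; rewrite vcdfE.
  by have /fine_cvgP[_] := h.
have hi : n.+1%:R^-1 @[n --> \oo] --> (0 : R)^'+.
  move=> S [d /= d0 hS]; have /cvgrPdist_lt/(_ d d0) := @cvg_harmonic R.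
  apply: filterS => n hn; apply: hS => //=.
exact: (@cvg_comp _ _ _ _ (vcdf V l) _ _ _ hi hr).
Qed.

(** By compactness of [lo, 1], a sequence of failures has positions converging to some l; continuity
    in the position would keep the distribution function of V_l at most 1 - e at every positive
    integer. *)
Lemma vcdf_uniform_hi (lo e : R) : 0 < lo -> 0 < e ->
  exists2 K, 0 < K & forall l y, lo <= l <= 1 -> K <= y -> 1 - e <= vcdf V l y.
Proof.
move=> lo0 e0; apply: contrapT => nh.
have H n : exists ly : R * R, [/\ lo <= ly.1 <= 1, n.+1%:R <= ly.2 & vcdf V ly.1 ly.2 < 1 - e].
  apply: contrapT => h; apply: nh; exists n.+1%:R => // l y lb ny; rewrite leNgt.
  by apply/negP => lt; apply: h; exists (l, y).
have [ly hly] := choice H.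
have lb n : lo <= (ly n).1 <= 1 by have [] := hly n.
have [phi [l [hphi hl /andP[ll _]]]] := subseq_bounded_cvg lb.
have l0 : 0 < l := lt_le_trans lo0 ll.
have bd (K : nat) : vcdf V l K.+1%:R <= 1 - e.
  have lim : vcdf V (ly (phi n)).1 K.+1%:R @[n --> \oo] --> vcdf V l K.+1%:R.
    apply: (vcdf_cvg_same (y_ := fun=> K.+1%:R)) => //; last exact: cvg_cst.
    by move=> n; have [/andP[h _] _ _] := hly (phi n); exact: lt_le_trans h.
  apply: (cvgr_to_le lim).
  have [N _ HN] := hphi _ (nbhs_infty_ge K).
  exists N => // n /= Nn; have [_ h1 h2] := hly (phi n).
  apply: le_trans (ltW h2); apply: vcdf_le; apply: le_trans h1.
  by rewrite ler_nat ltnS; exact: HN.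
have [x0 [_ hx]] : \forall y \near +oo, 1 - e < vcdf V l y.
  by apply: (cvgr_gt _ (vcdf_cvg1 l)); rewrite gtrBl.
have := bd (Num.truncn x0).+1; rewrite leNgt => /negP; apply; apply: hx.
by apply: (lt_trans (truncnS_gt x0)); rewrite ltr_nat.
Qed.

Lemma vcdf_uniform_lo (lo e : R) : 0 < lo -> 0 < e ->
  exists2 K, 0 < K & forall l y, lo <= l <= 1 -> y <= K -> vcdf V l y <= e.
Proof.
move=> lo0 e0; apply: contrapT => nh.
have H n : exists ly : R * R, [/\ lo <= ly.1 <= 1, ly.2 <= n.+1%:R^-1 & e < vcdf V ly.1 ly.2].
  apply: contrapT => h; apply: nh; exists n.+1%:R^-1 => // l y lb ny; rewrite leNgt.
  by apply/negP => lt; apply: h; exists (l, y).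
have [ly hly] := choice H.
have lb n : lo <= (ly n).1 <= 1 by have [] := hly n.
have [phi [l [hphi hl /andP[ll _]]]] := subseq_bounded_cvg lb.
have l0 : 0 < l := lt_le_trans lo0 ll.
have bd (K : nat) : e <= vcdf V l K.+1%:R^-1.
  have lim : vcdf V (ly (phi n)).1 K.+1%:R^-1 @[n --> \oo] --> vcdf V l K.+1%:R^-1.
    apply: (vcdf_cvg_same (y_ := fun=> K.+1%:R^-1)) => //; last exact: cvg_cst.
    by move=> n; have [/andP[h _] _ _] := hly (phi n); exact: lt_le_trans h.
  apply: (cvgr_to_ge lim).
  have [N _ HN] := hphi _ (nbhs_infty_ge K).
  exists N => // n /= Nn; have [_ h1 h2] := hly (phi n).
  apply: le_trans (ltW h2) _; apply: vcdf_le; apply: le_trans h1 _.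
  by rewrite lef_pV2 ?posrE// ler_nat ltnS; exact: HN.
have [N _ HN] : \forall n \near \oo, vcdf V l (n.+1%:R^-1) < e.
  by apply: (cvgr_lt _ (vcdf_cvg0 l0)).
by have := HN N (leqnn N); rewrite /= ltNge bd.
Qed.

Lemma semistable_power_cdf l x : 0 < l -> 0 < x ->
  Q [set v | V l v `^ (- alpha) <= x] = (1 - vcdf V l (x `^ (- alpha^-1)))%:E.
Proof.
move=> l0 x0; set y := x `^ _.
have y0 : 0 < y by exact: powR_gt0.
have a0 : - alpha != 0 by rewrite oppr_eq0 gt_eqF.
have V0 := (HV l0).1.
have mV : measurable_fun setT (V l) by exact: measurable_funPT.
have mE (z : R) : measurable [set v | V l v = z].
  have := (@measurable_funPTI _ _ _ _ (V l)) [set z] (measurable_set1 _).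
  by congr measurable.
have mp : measurable [set v | V l v `^ (- alpha) <= x].
  have h := measurableT_comp (@measurable_powR R (- alpha)) mV.
  have := h measurableT _ (measurable_itv `]-oo, x]); rewrite setTI.
  by congr measurable; apply/seteqP; split => v /=; rewrite in_itv.
(* Two null events are removed: V = 0, where the power is 0 by convention instead of infinite, and V
   = y, where <= and < differ. *)
pose S := ~` ([set v | V l v = 0] `|` [set v | V l v = y]).
have mS : measurable S by apply: measurableC; apply: measurableU; exact: mE.
have nS : Q (~` S) = 0%E.
  rewrite setCK; apply/negligibleP; first by apply: measurableU; exact: mE.
  by apply: negligibleU; apply/negligibleP; rewrite ?(mE _)//;
    exact: (semistable_no_atom alpha_gt0 alpha_lt1 c_gt1 HM l0 (HV l0)).
rewrite EFinB vcdfK -probability_setC; last exact: measurable_vle.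
apply: (prob_eq_on mS nS) => //; first by apply: measurableC; exact: measurable_vle.
have yx : y `^ (- alpha) = x by rewrite /y -powRrM mulrNN mulVf ?gt_eqF// powRr1// ltW.
apply/seteqP; split => v [/= h1 h2]; split => //.
  apply/negP; rewrite -ltNge lt_neqAle; apply/andP; split.
    by apply/eqP => yV; apply: h2; right.
  rewrite leNgt; apply/negP => Vy.
  have Vp : 0 < V l v.
    by rewrite lt_neqAle V0 andbT; apply/eqP => V00; apply: h2; left.
  move: h1; rewrite -yx leNgt => /negP; apply.
  rewrite !powRN ltf_pV2 ?posrE ?powR_gt0//.
  by apply: gt0_ltr_powR; rewrite ?nnegrE ?(ltW y0).
move/negP : h1; rewrite -ltNge => h1.
have Vp : 0 < V l v := lt_trans y0 h1.
rewrite -yx !powRN lef_pV2 ?posrE ?powR_gt0//.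
by apply: ge0_ler_powR; rewrite ?nnegrE ?(ltW y0) ?(ltW alpha_gt0) ?(ltW h1) ?(ltW Vp).
Qed.

End LimitCdf.

(** [u] and [v] are the two terms of the merging statement at a small x, [u'] and [v'] those at a
    cut-off, where they are known to be close; only the first term is monotone in x. *)
Lemma dist_le_near1 {R : realType} (e u v u' v' : R) : `|0 - (u' - v')| <= e / 2 ->
  u' <= u <= 1 -> 1 - e / 2 <= v <= 1 -> 1 - e / 2 <= v' -> `|u - v| <= e.
Proof.
rewrite sub0r normrN !ler_norml => /andP[a1 a2] /andP[a3 a4] /andP[a5 a6] a7.
by apply/andP; split; lra.
Qed.

Lemma dist_le_near0 {R : realType} (e u v u' v' : R) : `|0 - (u' - v')| <= e / 2 ->
  0 <= u <= u' -> 0 <= v <= e / 2 -> v' <= e / 2 -> `|u - v| <= e.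
Proof.
rewrite sub0r normrN !ler_norml => /andP[a1 a2] /andP[a3 a4] /andP[a5 a6] a7.
by apply/andP; split; lra.
Qed.

(** * Limits for the number of visits of the chain *)

Section RenewalLimit.
Context {R : realType}.
Variables (alpha c : R) (M : R -> R).
Hypothesis alpha_gt0 : 0 < alpha.
Hypothesis alpha_lt1 : alpha < 1.
Hypothesis c_gt1 : 1 < c.
Hypothesis HM : semistable_modulus alpha c M.
Context dV (TV : measurableType dV) (Q : probability TV R) (V : R -> {RV Q >-> R}).
Hypothesis HV : forall lambda : R, 0 < lambda -> semistable_rv alpha M lambda (V lambda).
Variable k : nat -> nat.
Hypothesis k_gt0 : forall n, (0 < k n)%N.
Hypothesis k_incr : forall n, (k n < k n.+1)%N.
Hypothesis k_ratio : ((k n.+1)%:R / (k n)%:R : R) @[n --> \oo] --> c.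
Variable gamma : R -> R.
Hypothesis Hgamma : position_parameter c k gamma.
Variable l1 : R -> R.
Hypothesis Hl1 : slowly_varying l1.
Variable delta : R -> R.
Hypothesis Hdelta : delta_function (fun n => norming alpha l1 (k n)) delta.
Variable f : nat -> R.
Hypothesis Hf : prob_sequence f.
Hypothesis f_mean : (\sum_(0 <= j <oo) (j%:R * f j)%:E = +oo)%E.
Context d (T : measurableType d) (P : probability T R).
Variable X : nat -> {RV P >-> nat}.
Hypothesis HX : markov_chain_from 0 (renewal_transition f) X.
Context dtau (Ttau : measurableType dtau) (Ptau : probability Ttau R).
Variable tau : {RV Ptau >-> R}.
Hypothesis Htau : forall j : nat, Ptau [set w | tau w = j.+1%:R] = (f j)%:E.
Variable h : R -> R.
Hypothesis h_lim : forall x : R, 0 < x -> {for x, continuous M} ->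
  h (norming alpha l1 (k n) * x) @[n --> \oo] --> 0.
Hypothesis Htail : \forall x \near +oo,
  (1 - cdf tau x)%E = (ell alpha l1 x / x `^ alpha * (M (delta x) + h x))%:E.

Local Notation RR := (measurableTypeR R).
Definition return_time : Ttau -> RR := tau.

Lemma measurable_return_time : measurable_fun setT return_time.
Proof. by move=> _ A mA; exact: (@measurable_funPT _ _ _ _ tau measurableT A mA). Qed.

HB.instance Definition _ :=
  isMeasurableFun.Build _ _ _ _ return_time measurable_return_time.

Definition return_law : probability RR R := distribution Ptau return_time.
Local Notation D := return_law.
Local Notation Fb := (tail_prob D).
Local Notation a := (a_seq alpha l1).

Lemma return_law_pt (j : nat) : D [set j.+1%:R] = (f j)%:E.
Proof. exact: Htau. Qed.

Lemma return_tailE x : (Fb x)%:E = (1 - cdf tau x)%E.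
Proof.
rewrite tail_probK (_ : [set y : RR | x < y] = ~` `]-oo, x]%classic).
  by rewrite probability_setC//; exact: measurable_itv.
apply/seteqP; split => y /=; rewrite in_itv/=; first by rewrite ltNge => /negP.
by move/negP; rewrite -ltNge.
Qed.

Lemma return_tail_cvg0 : Fb x @[x --> +oo] --> 0.
Proof.
have h1 : (1 - cdf tau x)%E @[x --> +oo] --> (1 - 1)%E.
  by apply: cvgeB => //; [exact: cvg_cst|exact: cvg_cdfy1].
rewrite subee// in h1.
have h2 : (Fb x)%:E @[x --> +oo] --> 0%:E.
  by apply: cvg_trans h1; apply: near_eq_cvg; apply: nearW => x; rewrite return_tailE.
by have /fine_cvgP[_] := h2.
Qed.

(** A tail that vanishes eventually leaves finitely many nonzero f_j and thus a finite mean, against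
    [f_mean]. *)
Lemma return_tail_gt0 : ~ \forall x \near +oo, Fb x = 0.
Proof.
move=> [x0 [_ hx0]].
pose N := (Num.truncn x0).+2.
have f0 j : (N <= j)%N -> f j = 0.
  move=> Nj; apply/eqP; rewrite eq_le Hf.1 andbT.
  have jx : x0 < j%:R by apply: (lt_le_trans (truncnS_gt x0)); rewrite ler_nat ltnW.
  rewrite -(hx0 _ jx) -lee_fin tail_probK -return_law_pt; apply: le_measure; rewrite ?inE.
  - exact: measurable_pt.
  - exact: measurable_gt.
  - by move=> y /= ->; rewrite ltr_nat.
have := f_mean; rewrite (nneseries_split 0 N); last first.
  by move=> j _; rewrite lee_fin mulr_ge0 ?Hf.1.
rewrite add0n [X in (_ + X)%E]eseries0; last first.
  by move=> i Ni _; rewrite f0// mulr0.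
by rewrite adde0 sumEFin.
Qed.

Lemma return_tail_ell : \forall x \near +oo,
  Fb x = ell alpha l1 x / x `^ alpha * (M (delta x) + h x).
Proof.
by apply: filterS Htail => x hx; apply/EFin_inj; rewrite return_tailE hx.
Qed.

Local Notation A := (index_scale alpha k l1).

Let X0E := bounded_inv_set return_tail_ell return_tail_gt0.

Lemma a_seqE n : (0 < n)%N -> a n = asym_inv alpha l1 n%:R.
Proof.
move=> n0; have p0 : n%:R `^ alpha != 0 :> R by rewrite gt_eqF//; apply: powR_gt0; rewrite ltr0n.
by rewrite /a_seq /ell /asym_inv invfM mulrA mulfV// mul1r.
Qed.

Lemma asym_inv_cvg_return : asym_inv alpha l1 x @[x --> +oo] --> +oo.
Proof.
exact: (asym_inv_cvg alpha_gt0 alpha_lt1 c_gt1 HM k_gt0 k_incr Hl1 Hdelta h_lim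
  return_tail_ell return_tail_cvg0 return_tail_gt0).
Qed.

Lemma nat_pinfty (n_ : nat -> nat) : n_ r @[r --> \oo] --> \oo ->
  (n_ r)%:R @[r --> \oo] --> (+oo : set_system R).
Proof.
move=> hn; apply/cvgryPge => y.
exact: (hn _ (nbhs_infty_ger y)).
Qed.

Lemma nat_infty_ge (n_ : nat -> nat) N : n_ r @[r --> \oo] --> \oo ->
  \forall r \near \oo, (N <= n_ r)%N.
Proof. by move=> hn; exact: (hn _ (nbhs_infty_ge N)). Qed.

Lemma a_seq_pinfty (n_ : nat -> nat) : n_ r @[r --> \oo] --> \oo ->
  a (n_ r) @[r --> \oo] --> +oo.
Proof.
move=> hn; have lim := @cvg_comp _ _ _ _ (asym_inv alpha l1) _ _ _ (nat_pinfty hn) asym_inv_cvg_return.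
have n0 : \forall r \near \oo, (0 < n_ r)%N by exact: nat_infty_ge.
apply: cvg_trans lim; apply: near_eq_cvg; near=> r; rewrite /= a_seqE//.
by near: r.
Unshelve. all: by end_near. Qed.

(** S_n > m means T_m <= n - 1. Through the asymptotic inverse, a_n ~ s k_J becomes n ~ s^(1/alpha)
    A_J, so the limit law of the sums applies with w = s^(1/alpha). *)
Lemma visits_limit (n_ m_ J_ : nat -> nat) (lambda s : R) :
  n_ r @[r --> \oo] --> \oo -> J_ r @[r --> \oo] --> \oo -> 0 < lambda -> 0 < s ->
  (m_ r)%:R / (k (J_ r))%:R @[r --> \oo] --> lambda ->
  a (n_ r) / (k (J_ r))%:R @[r --> \oo] --> s ->
  fine (P [set w | (m_ r < visits X (n_ r) w)%N]) @[r --> \oo] -->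
  vcdf V lambda ((s / lambda) `^ alpha^-1).
Proof.
move=> hn hJ l0 s0 hm ha.
have [X0 HX0] := X0E.
have n0 : \forall r \near \oo, (0 < n_ r)%N by exact: nat_infty_ge.
have kJ : (k (J_ r))%:R @[r --> \oo] --> (+oo : set_system R).
  exact: (@cvg_comp _ _ _ _ (fun n => (k n)%:R : R) _ _ _ hJ (index_pinfty k_incr)).
have ha' : asym_inv alpha l1 (n_ r)%:R / (k (J_ r))%:R @[r --> \oo] --> s.
  by apply: cvg_trans ha; apply: near_eq_cvg; near=> r; rewrite a_seqE//; near: r.
have hnA := asym_inv_ratio_inv alpha_gt0 alpha_lt1 Hl1 HX0 asym_inv_cvg_return s0 kJ
  (nat_pinfty hn) ha'.
have sp : 0 < s `^ alpha^-1 by exact: powR_gt0.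
have hA0 : (A (J_ r))^-1 @[r --> \oo] --> (0 : R).
  have hA := @cvg_comp _ _ _ _ A _ _ _ hJ (index_scale_pinfty alpha_gt0 alpha_lt1 k_incr Hl1).
  apply: (gtr0_cvgV0 (f := fun r => A (J_ r)) _).2 hA.
  by apply: nearW => r; exact: (index_scale_gt0 _ k_gt0 Hl1).
(* Replacing n by n - 1 is harmless because A tends to infinity. *)
have hN : ((n_ r).-1)%:R / A (J_ r) @[r --> \oo] --> s `^ alpha^-1.
  have h1 : (n_ r)%:R / A (J_ r) - (A (J_ r))^-1 @[r --> \oo] --> s `^ alpha^-1 - 0.
    by apply: cvgB => //; exact: hnA.
  rewrite subr0 in h1; apply: cvg_trans h1; apply: near_eq_cvg; near=> r.
  have nr : (0 < n_ r)%N by near: r.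
  by rewrite -subn1 natrB// mulrBl mul1r.
have tl z := @tail_cvg _ _ _ _ alpha_gt0 alpha_lt1 c_gt1 HM _ k_gt0 k_incr k_ratio _ Hl1 _ Hdelta _ _
  h_lim return_tail_ell return_tail_cvg0 return_tail_gt0 z.
have td := tail_dominated alpha_gt0 alpha_lt1 c_gt1 HM k_gt0 k_incr k_ratio Hl1 Hdelta
  h_lim return_tail_ell (tail_prob_ge0 D) (tail_prob_le1 D) (@tail_prob_le _ D) return_tail_cvg0 return_tail_gt0.
have lim := @sum_law_limit _ _ _ _ alpha_gt0 alpha_lt1 c_gt1 HM _ _ _ _ HV _ _ Hf return_law_pt _ _
  k_gt0 (index_scale_gt0 _ k_gt0 Hl1) (index_pinfty k_incr) tl td m_ _ J_ _ _ hJ l0 sp hm hN.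
have yE : lambda `^ (- alpha^-1) * s `^ alpha^-1 = (s / lambda) `^ alpha^-1.
  rewrite powRM ?(ltW s0) ?invr_ge0 ?(ltW l0)// mulrC; congr (_ * _).
  by rewrite -(powR_inv1 (ltW l0)) -powRrM mulN1r.
rewrite yE in lim; apply: cvg_trans lim; apply: near_eq_cvg; near=> r.
have nr : (0 < n_ r)%N by near: r.
by rewrite -(visits_sum_law HX Hf return_law_pt) prednK.
Unshelve. all: by end_near. Qed.

(** The ratios k_(n+1) / k_n tend to c but may exceed it, so c^-1 alone is no lower bound; a bound
    on all the ratios takes over. *)
Lemma position_bound : exists2 lo, 0 < lo & forall x, 0 < x -> lo <= gamma x <= 1.
Proof.
have [g1 g2] := Hgamma.
have c0 : 0 < c := lt_trans ltr01 c_gt1.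
have [B hB] : exists B, forall n, (k n.+1)%:R / (k n)%:R <= B :> R.
  have /cvg_seq_bounded [B [_ hB]] : cvgn (fun n => (k n.+1)%:R / (k n)%:R : R).
    by apply/cvg_ex; exists c.
  exists (B + 1) => n; apply: le_trans (ler_norm _) _.
  by apply: hB => //; rewrite ltrDl.
have kp n : 0 < (k n)%:R :> R by rewrite ltr0n.
have B0 : 0 < B by apply: lt_le_trans (hB 0%N); rewrite divr_gt0.
exists (Num.min c^-1 B^-1); first by rewrite lt_min !invr_gt0 c0 B0.
move=> x x0; have [x1|x1] := leP x (k 0%N)%:R.
  by have [h1 ->] := g2 _ x0 x1; rewrite andbT ge_min (ltW h1).
have ex : exists n, x <= (k n.+1)%:R.
  have /cvgryPge /(_ x) [N _ HN] := @index_pinfty R _ k_incr.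
  by exists N; apply: HN => /=; exact: leqnSn.
case: (ex_minnP ex) => n hn mn.
have kx : (k n)%:R < x.
  case: n hn mn => [//|n] hn mn; rewrite ltNge; apply/negP => /mn; by rewrite ltnn.
rewrite (g1 n)// ler_pdivrMr// mul1r hn andbT ge_min; apply/orP; right.
rewrite ler_pdivlMr//; apply: le_trans (ltW kx).
by rewrite mulrC ler_pdivrMr// mulrC -ler_pdivrMr// hB.
Qed.

(** [J_] picks the index with k_(J-1) < p <= k_J from the definition of [gamma]; it tends to
    infinity because p does and k is increasing. *)
Lemma position_index (p_ : nat -> R) : p_ r @[r --> \oo] --> +oo ->
  exists2 J_ : nat -> nat, J_ r @[r --> \oo] --> \oo &
    \forall r \near \oo, gamma (p_ r) = p_ r / (k (J_ r))%:R.
Proof.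
move=> hp; have [g1 _] := Hgamma.
have H r : exists J, (k 0%N)%:R < p_ r -> p_ r <= (k J)%:R /\ gamma (p_ r) = p_ r / (k J)%:R.
  have [x1|x1] := leP (p_ r) (k 0%N)%:R; first by exists 0%N.
  have ex : exists n, p_ r <= (k n.+1)%:R.
    have /cvgryPge /(_ (p_ r)) [N _ HN] := @index_pinfty R _ k_incr.
    by exists N; apply: HN => /=; exact: leqnSn.
  case: (ex_minnP ex) => n hn mn.
  have kx : (k n)%:R < p_ r.
    case: n hn mn => [//|n] hn mn; rewrite ltNge; apply/negP => /mn; by rewrite ltnn.
  by exists n.+1 => _; split => //; exact: g1.
have [J_ HJ] := choice H.
have p0 : \forall r \near \oo, (k 0%N)%:R < p_ r by exact: (cvgryPgt _).1 hp _.
exists J_; last by apply: filterS p0 => r /HJ[].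
move=> S [N _ HN].
have pN : \forall r \near \oo, (k N)%:R < p_ r by exact: (cvgryPgt _).1 hp _.
suff : \forall r \near \oo, (N <= J_ r)%N by apply: filterS => r; exact: HN.
near=> r.
have pr : (k 0%N)%:R < p_ r by near: r.
have prN : (k N)%:R < p_ r by near: r.
have := lt_le_trans prN (HJ _ pr).1; rewrite ltr_nat => h1.
rewrite leqNgt; apply/negP => h2.
have mono m n : (m <= n)%N -> (k m <= k n)%N.
  move=> mn; rewrite -(subnK mn); elim: (n - m)%N => // i ih.
  by rewrite addSn (leq_trans ih)// ltnW.
by have := mono _ _ (ltnW h2); rewrite leqNgt h1.
Unshelve. all: by end_near. Qed.

Lemma near_ratio (m_ p_ q_ : nat -> R) (l : R) : (\forall r \near \oo, `|p_ r - m_ r| <= 1) ->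
  q_ r @[r --> \oo] --> +oo -> p_ r / q_ r @[r --> \oo] --> l -> m_ r / q_ r @[r --> \oo] --> l.
Proof.
move=> hpm hq hl.
have q0 : \forall r \near \oo, 0 < q_ r by exact: (cvgryPgt _).1 hq 0.
have qi : (q_ r)^-1 @[r --> \oo] --> (0 : R) by exact: (gtr0_cvgV0 q0).2 hq.
have h0 : (p_ r - m_ r) / q_ r @[r --> \oo] --> (0 : R).
  apply/cvgrPdist_le => e e0.
  have qe : \forall r \near \oo, `|0 - (q_ r)^-1| <= e by have /cvgrPdist_le/(_ e e0) := qi.
  near=> r; rewrite sub0r normrN normrM.
  have qr : `|0 - (q_ r)^-1| <= e by near: r.
  rewrite sub0r normrN in qr; apply: le_trans qr; rewrite ler_piMl//.
  by near: r.
have lim : p_ r / q_ r - (p_ r - m_ r) / q_ r @[r --> \oo] --> l - 0 by exact: cvgB.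
rewrite subr0 in lim; apply: cvg_trans lim; apply: near_eq_cvg; apply: nearW => r.
by rewrite mulrBl opprB addrC subrK.
Unshelve. all: by end_near. Qed.

Lemma pred_nat_exists (p : R) : 0 < p -> exists m : nat, m%:R < p <= m.+1%:R.
Proof.
move=> p0; have ex : exists m, p <= m.+1%:R.
  by exists (Num.truncn p); exact: ltW (truncnS_gt p).
case: (ex_minnP ex) => m hm mn; exists m; rewrite hm andbT.
case: m hm mn => [//|m] hm mn; rewrite ltNge; apply/negP => /mn; by rewrite ltnn.
Qed.

Lemma visits_geE (m n : nat) (p : R) : m%:R < p <= m.+1%:R ->
  [set w | p <= (visits X n w)%:R] = [set w | (m < visits X n w)%N].
Proof.
move=> /andP[h1 h2]; apply/seteqP; split => w /= hw.
  by have := lt_le_trans h1 hw; rewrite ltr_nat.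
by apply: (le_trans h2); rewrite ler_nat.
Qed.

Lemma limit_point_subseq (g : nat -> R) (phi : nat -> nat) (s : R) :
  phi n @[n --> \oo] --> \oo -> g (phi n) @[n --> \oo] --> s -> limit_points g s.
Proof.
move=> hphi hs S B hS hB.
have h1 : \forall n \near \oo, S (g (phi n)) by exact: (hphi _ hS).
have h2 : \forall n \near \oo, B (g (phi n)) by exact: (hs _ hB).
have [n1 _ H1] := h1; have [n2 _ H2] := h2.
exists (g (phi (maxn n1 n2))); split; first by apply: H1 => /=; exact: leq_maxl.
by apply: H2 => /=; exact: leq_maxr.
Qed.

(** The bounds on [gamma] are available at positive arguments only; clipping enforces them at every
    index and changes nothing from some index on. *)
Definition clip (lo x : R) : R := Num.max lo (Num.min 1 x).

Lemma clip_bounds lo x : lo <= 1 -> lo <= clip lo x <= 1.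
Proof. by move=> l1'; rewrite /clip le_max lexx ge_max l1' ge_min lexx. Qed.

Lemma clip_id lo x : lo <= x <= 1 -> clip lo x = x.
Proof. by move=> /andP[h1 h2]; rewrite /clip min_r// max_r. Qed.

Lemma cvg_pinfty_subseq (phi : nat -> nat) (p_ : nat -> R) :
  phi n @[n --> \oo] --> \oo -> p_ r @[r --> \oo] --> +oo -> p_ (phi r) @[r --> \oo] --> +oo.
Proof. by move=> hphi hp; exact: (@cvg_comp _ _ _ _ p_ _ _ _ hphi hp). Qed.

(** Along a subsequence where the position tends to s, both m and a_n x_n are asymptotic to s k_J,
    hence a_n ~ (s / x) k_J, and the first term tends to the distribution function of V_s at (s / x
    / s)^(1/alpha) = x^(-1/alpha). The second term has the same limit by continuity. *)
Lemma merging_interior (n_ : nat -> nat) (x_ : nat -> R) (x : R) :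
  n_ r @[r --> \oo] --> \oo -> 0 < x -> (forall r, 0 < x_ r) -> x_ r @[r --> \oo] --> x ->
  fine (P [set w | a (n_ r) * x_ r <= (visits X (n_ r) w)%:R])
    - vcdf V (gamma (a (n_ r) * x_ r)) (x_ r `^ (- alpha^-1)) @[r --> \oo] --> 0.
Proof.
move=> hn x0 x_0 hx.
have [lo lo0 hlo] := position_bound.
have lo1 : lo <= 1 by have /andP[h1 h2] := hlo 1 ltr01; exact: le_trans h2.
have ha := a_seq_pinfty hn.
pose p_ r := a (n_ r) * x_ r.
have x2 : \forall r \near \oo, x / 2 <= x_ r by apply: (cvgr_ge _ hx); lra.
have hp : p_ r @[r --> \oo] --> +oo.
  apply/cvgryPge => y.
  have hy : \forall r \near \oo, `|y| / (x / 2) <= a (n_ r) by exact: (cvgryPge _).1 ha _.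
  near=> r; have g1 : x / 2 <= x_ r by near: r.
  have g2 : `|y| / (x / 2) <= a (n_ r) by near: r.
  have g2p : 0 <= a (n_ r) by apply: le_trans g2; rewrite divr_ge0// divr_ge0// ltW.
  apply: (le_trans (ler_norm y)); rewrite ler_pdivrMr ?divr_gt0// in g2; apply: (le_trans g2).
  by rewrite ler_wpM2l.
have p0 : \forall r \near \oo, 0 < p_ r by exact: (cvgryPgt _).1 hp 0.
have [J_ hJ gJ] := position_index hp.
have Hm r : exists m : nat, 0 < p_ r -> m%:R < p_ r <= m.+1%:R.
  have [h1|h1] := ltP 0 (p_ r); last by exists 0%N.
  by have [m hm] := pred_nat_exists h1; exists m.
have [m_ hm] := choice Hm.
apply: (@cvg_by_subseq _ _ (fun r => clip lo (gamma (p_ r))) _ lo 1) => [r|phi s hphi /andP[s_lo _] hs].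
  exact: clip_bounds.
have s0 : 0 < s := lt_le_trans lo0 s_lo.
have sub (E : nat -> Prop) : (\forall r \near \oo, E r) -> \forall r \near \oo, E (phi r) by move=> hE; exact: (hphi _ hE).
have pp := sub _ p0; have gg := sub _ gJ; have xx := sub _ x2.
have hkJ : (k (J_ (phi r)))%:R @[r --> \oo] --> (+oo : set_system R).
  exact: (cvg_pinfty_subseq hphi (@cvg_comp _ _ _ _ (fun n => (k n)%:R : R) _ _ _ hJ (index_pinfty k_incr))).
have hgs : gamma (p_ (phi r)) @[r --> \oo] --> s.
  apply: cvg_trans hs; apply: near_eq_cvg; near=> r; rewrite clip_id// hlo//.
  by near: r.
have hps : p_ (phi r) / (k (J_ (phi r)))%:R @[r --> \oo] --> s.
  apply: cvg_trans hgs; apply: near_eq_cvg; near=> r.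
  by have -> : gamma (p_ (phi r)) = p_ (phi r) / (k (J_ (phi r)))%:R by near: r.
have hms : (m_ (phi r))%:R / (k (J_ (phi r)))%:R @[r --> \oo] --> s.
  apply: near_ratio hps => //; near=> r.
  have pr : 0 < p_ (phi r) by near: r.
  have /andP[h1 h2] := hm _ pr; rewrite ger0_norm ?subr_ge0 ?(ltW h1)//.
  by rewrite lerBlDl natr1.
have hxphi : x_ (phi r) @[r --> \oo] --> x by exact: (@cvg_comp _ _ _ _ x_ _ _ _ hphi hx).
have has : a (n_ (phi r)) / (k (J_ (phi r)))%:R @[r --> \oo] --> s / x.
  have lim : p_ (phi r) / (k (J_ (phi r)))%:R / x_ (phi r) @[r --> \oo] --> s / x.
    by apply: cvgM => //; apply: cvgV => //; rewrite gt_eqF.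
  apply: cvg_trans lim; apply: near_eq_cvg; apply: nearW => r.
  by rewrite /p_ mulrAC mulfK// gt_eqF.
have hnphi : n_ (phi r) @[r --> \oo] --> \oo by exact: (@cvg_comp _ _ _ _ n_ _ _ _ hphi hn).
have hJphi : J_ (phi r) @[r --> \oo] --> \oo by exact: (@cvg_comp _ _ _ _ J_ _ _ _ hphi hJ).
have L1 := visits_limit hnphi hJphi s0 (divr_gt0 s0 x0) hms has.
have yE : (s / x / s) `^ alpha^-1 = x `^ (- alpha^-1).
  by rewrite mulrAC divff ?gt_eqF// mul1r -(powR_inv1 (ltW x0)) -powRrM mulN1r.
rewrite yE in L1.
have hy : x_ (phi r) `^ (- alpha^-1) @[r --> \oo] --> x `^ (- alpha^-1).
  exact: (@cvg_comp _ _ _ _ (fun y => y `^ (- alpha^-1)) _ _ _ hxphi (powR_continuous (a := - alpha^-1) x0)).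
have L2 : vcdf V (clip lo (gamma (p_ (phi r)))) (x_ (phi r) `^ (- alpha^-1)) @[r --> \oo] -->
    vcdf V s (x `^ (- alpha^-1)).
  apply: (vcdf_cvg_same alpha_gt0 alpha_lt1 c_gt1 HM HV s0 _ _ _ hs hy).
  - exact: powR_gt0.
  - by move=> r; have /andP[h1 _] := clip_bounds (gamma (p_ (phi r))) lo1; exact: lt_le_trans h1.
  - by move=> r; exact: powR_gt0.
have L : fine (P [set w | (m_ (phi r) < visits X (n_ (phi r)) w)%N]) -
    vcdf V (clip lo (gamma (p_ (phi r)))) (x_ (phi r) `^ (- alpha^-1)) @[r --> \oo] --> (0 : R).
  by rewrite -[X in _ --> X](subrr (vcdf V s (x `^ (- alpha^-1)))); exact: cvgB.
apply: cvg_trans L; apply: near_eq_cvg; near=> r.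
have pr : 0 < p_ (phi r) by near: r.
by rewrite (visits_geE _ (hm _ pr)) clip_id// hlo.
Unshelve. all: by end_near. Qed.

(** The second term need not be monotone in x, because its position varies with x. Beyond the
    cut-offs [d1] and [d2] it is controlled by bounds uniform in the position, while the first term
    is compared with its value at the cut-off. *)
Lemma merging_uniform (e : R) : 0 < e ->
  \forall n \near \oo, forall x, 0 < x ->
  `|fine (P [set w | a n * x <= (visits X n w)%:R])
    - vcdf V (gamma (a n * x)) (x `^ (- alpha^-1))| <= e.
Proof.
move=> e0; have e2 : 0 < e / 2 by rewrite divr_gt0.
have [lo lo0 hlo] := position_bound.
have [K K0 HK] := vcdf_uniform_hi alpha_gt0 alpha_lt1 c_gt1 HM HV lo0 e2.
have [k0 k00 Hk] := vcdf_uniform_lo alpha_gt0 alpha_lt1 c_gt1 HM HV lo0 e2.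
pose G n x := fine (P [set w | a n * x <= (visits X n w)%:R]).
pose W n x := vcdf V (gamma (a n * x)) (x `^ (- alpha^-1)).
have powK (y : R) : 0 < y -> (y `^ (- alpha)) `^ (- alpha^-1) = y.
  by move=> y0; rewrite -powRrM mulrNN mulfV ?gt_eqF// powRr1// ltW.
have pow_le (x y : R) : 0 < x -> x <= y -> y `^ (- alpha^-1) <= x `^ (- alpha^-1).
  move=> x0 xy; have y0 := lt_le_trans x0 xy.
  rewrite !powRN lef_pV2 ?posrE ?powR_gt0//; apply: ge0_ler_powR => //.
  - by rewrite invr_ge0 ltW.
  - by rewrite nnegrE ltW.
  - by rewrite nnegrE ltW.
(* Chosen so that d1^(-1/alpha) = K and d2^(-1/alpha) = k0, the arguments beyond which the uniform
   bounds hold. *)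
pose d1 := K `^ (- alpha); pose d2 := k0 `^ (- alpha).
have d10 : 0 < d1 by exact: powR_gt0.
have d20 : 0 < d2 by exact: powR_gt0.
have idn : (fun r : nat => r) r @[r --> \oo] --> \oo by [].
have N1 : \forall n \near \oo, `|0 - (G n d1 - W n d1)| <= e / 2.
  have lim : G n d1 - W n d1 @[n --> \oo] --> (0 : R).
    exact: (merging_interior (x_ := fun=> d1) idn d10 (fun=> d10) (cvg_cst _)).
  by have /cvgrPdist_le/(_ _ e2) := lim.
have N2 : \forall n \near \oo, `|0 - (G n d2 - W n d2)| <= e / 2.
  have lim : G n d2 - W n d2 @[n --> \oo] --> (0 : R).
    exact: (merging_interior (x_ := fun=> d2) idn d20 (fun=> d20) (cvg_cst _)).
  by have /cvgrPdist_le/(_ _ e2) := lim.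
have N3 : \forall n \near \oo, 0 < a n by exact: (cvgryPgt _).1 (a_seq_pinfty idn) 0.
have mono n x y : 0 < a n -> 0 < x -> x <= y -> G n y <= G n x.
  move=> an x0 xy; have y0 := lt_le_trans x0 xy.
  have [m hm] := pred_nat_exists (mulr_gt0 an x0).
  have [m' hm'] := pred_nat_exists (mulr_gt0 an y0).
  have axy : a n * x <= a n * y by rewrite ler_wpM2l// ltW.
  have mE q := (visits_gt_prob HX n q).1.
  rewrite /G (visits_geE _ hm) (visits_geE _ hm') fine_le ?fin_num_measure//.
  apply: le_measure; rewrite ?inE// => w /= h1.
  have /andP[a1 a2] := hm; have /andP[a3 a4] := hm'.
  have : m%:R < m'.+1%:R :> R by exact: lt_le_trans a1 (le_trans axy a4).
  by rewrite ltr_nat ltnS => /leq_ltn_trans; apply.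
have G01 n x : 0 < a n -> 0 < x -> 0 <= G n x <= 1.
  move=> an x0; have [m hm] := pred_nat_exists (mulr_gt0 an x0).
  have mE := (visits_gt_prob HX n m).1.
  rewrite /G (visits_geE _ hm) fine_ge0//=.
  by rewrite -lee_fin fineK ?fin_num_measure// probability_le1.
have N4 : \forall n \near \oo, forall x, d1 <= x <= d2 -> `|G n x - W n x| <= e.
  apply: contrapT => nh.
  have H N : exists nx : nat * R, [/\ (N <= nx.1)%N, d1 <= nx.2 <= d2 & e < `|G nx.1 nx.2 - W nx.1 nx.2|].
    apply: contrapT => h'; apply: nh; exists N => // n /= Nn x xd; rewrite leNgt; apply/negP => lt.
    by apply: h'; exists (n, x).
  have [nx hnx] := choice H.
  have xb r : d1 <= (nx r).2 <= d2 by have [] := hnx r.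
  have [phi [x [hphi hx /andP[xd _]]]] := subseq_bounded_cvg xb.
  have x0 : 0 < x := lt_le_trans d10 xd.
  have hn : (nx (phi r)).1 @[r --> \oo] --> \oo.
    move=> S [N _ HN]; have [N' _ HN'] := hphi _ (nbhs_infty_ge N).
    exists N' => // r /= hr; apply: HN => /=; have [h1 _ _] := hnx (phi r).
    by apply: leq_trans h1; exact: HN'.
  have xp r : 0 < (nx (phi r)).2 by have /andP[h1 _] := xb (phi r); exact: lt_le_trans h1.
  have lim : G (nx (phi r)).1 (nx (phi r)).2 - W (nx (phi r)).1 (nx (phi r)).2 @[r --> \oo] --> (0 : R).
    exact: (merging_interior hn x0 xp hx).
  have /cvgrPdist_le/(_ _ e0)[N _ /(_ N (leqnn N))] /= := lim.
  have [_ _] := hnx (phi N); rewrite sub0r normrN => h1 h2.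
  by move: h1; rewrite ltNge h2.
have [A1 _ B1] := N1; have [A2 _ B2] := N2; have [A3 _ B3] := N3; have [A4 _ B4] := N4.
exists (maxn (maxn A1 A2) (maxn A3 A4)) => // n /=.
rewrite !geq_max => /andP[/andP[/B1 n1 /B2 n2] /andP[/B3 an /B4 n4]] x x0.
rewrite /= in n1 n2 an n4.
rewrite -/(G n x) -/(W n x).
have /andP[G0 G1] := G01 _ _ an x0.
have W0 := vcdf_ge0 V (gamma (a n * x)) (x `^ (- alpha^-1)).
have W1 := vcdf_le1 V (gamma (a n * x)) (x `^ (- alpha^-1)).
rewrite -/(W n x) in W0 W1.
have gb y : 0 < y -> lo <= gamma (a n * y) <= 1 by move=> y0; apply: hlo; rewrite mulr_gt0.
have [xd1|xd1] := leP x d1.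
  have g1 := mono _ _ _ an x0 xd1.
  have w1 : 1 - e / 2 <= W n x.
    by apply: HK; [exact: gb|rewrite -[leLHS]powK//; exact: pow_le].
  have w2 : 1 - e / 2 <= W n d1 by apply: HK; [exact: gb|rewrite /d1 powK].
  by apply: (dist_le_near1 n1) => //; apply/andP; split.
have [xd2|xd2] := leP d2 x.
  have g1 := mono _ _ _ an d20 xd2.
  have w1 : W n x <= e / 2.
    by apply: Hk; [exact: gb|rewrite -[leRHS]powK//; exact: pow_le].
  have w2 : W n d2 <= e / 2 by apply: Hk; [exact: gb|rewrite /d2 powK].
  by apply: (dist_le_near0 n2) => //; apply/andP; split.
by apply: n4; rewrite !ltW.
Unshelve. all: by end_near. Qed.

(** Every subsequential limit s of the position equals c^z lambda, where z = -1 occurs when lambda =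
    1 and s = c^-1. The corresponding limit has position s x, which differs from
    [h_position c lambda x] by a power of c, so all subsequences agree. *)
Lemma circular_limit (n_ : nat -> nat) (lambda x : R) :
  n_ r @[r --> \oo] --> \oo -> 0 < lambda -> 0 < x ->
  cvg_circular c (fun r => gamma (a (n_ r))) lambda ->
  fine (P [set w | (Num.truncn (a (n_ r) * x) < visits X (n_ r) w)%N]) @[r --> \oo] -->
  vcdf V (h_position c lambda x) (x `^ (- alpha^-1)).
Proof.
move=> hn l0 x0 hcir.
have c0 : 0 < c := lt_trans ltr01 c_gt1.
have [lo lo0 hlo] := position_bound.
have lo1 : lo <= 1 by have /andP[h1 h2] := hlo 1 ltr01; exact: le_trans h2.
have hp := a_seq_pinfty hn.
have p0 : \forall r \near \oo, 0 < a (n_ r) by exact: (cvgryPgt _).1 hp 0.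
have [J_ hJ gJ] := position_index hp.
have xp : 0 < x `^ (- alpha^-1) by exact: powR_gt0.
apply: (@cvg_by_subseq _ _ (fun r => clip lo (gamma (a (n_ r)))) _ lo 1) => [r|phi s hphi /andP[s_lo _] hs].
  exact: clip_bounds.
have s0 : 0 < s := lt_le_trans lo0 s_lo.
have sub (E : nat -> Prop) : (\forall r \near \oo, E r) -> \forall r \near \oo, E (phi r) by move=> hE; exact: (hphi _ hE).
have pp := sub _ p0; have gg := sub _ gJ.
have hkJ : (k (J_ (phi r)))%:R @[r --> \oo] --> (+oo : set_system R).
  exact: (cvg_pinfty_subseq hphi (@cvg_comp _ _ _ _ (fun n => (k n)%:R : R) _ _ _ hJ (index_pinfty k_incr))).
have hgs : gamma (a (n_ (phi r))) @[r --> \oo] --> s.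
  apply: cvg_trans hs; apply: near_eq_cvg; near=> r; rewrite clip_id// hlo//.
  by near: r.
have [z sE] : exists z : int, s = c ^ z * lambda.
  have cl := limit_point_subseq (g := fun r => gamma (a (n_ r))) hphi hgs.
  case: hcir => [[_ [_ hl]]|[lE hl]].
    exists 0; rewrite expr0z mul1r.
    exact: (cvg_unique _ hgs (@cvg_comp _ _ _ _ (fun r => gamma (a (n_ r))) _ _ _ hphi hl)).
  have : s = 1 \/ s = c^-1.
    by case: hl => hl; rewrite hl /= in cl; [left|right|].
  by case=> ->; [exists 0|exists (-1)]; rewrite lE mulr1 ?expr0z ?exprN1.
have has : a (n_ (phi r)) / (k (J_ (phi r)))%:R @[r --> \oo] --> s.
  apply: cvg_trans hgs; apply: near_eq_cvg; near=> r.
  by have -> : gamma (a (n_ (phi r))) = a (n_ (phi r)) / (k (J_ (phi r)))%:R by near: r.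
have hms : (Num.truncn (a (n_ (phi r)) * x))%:R / (k (J_ (phi r)))%:R @[r --> \oo] --> s * x.
  have lim : a (n_ (phi r)) * x / (k (J_ (phi r)))%:R @[r --> \oo] --> s * x.
    have h1 : a (n_ (phi r)) / (k (J_ (phi r)))%:R * x @[r --> \oo] --> s * x.
      by apply: cvgM => //; exact: cvg_cst.
    by apply: cvg_trans h1; apply: near_eq_cvg; apply: nearW => r; rewrite mulrAC.
  apply: near_ratio lim => //; near=> r.
  have pr : 0 < a (n_ (phi r)) by near: r.
  have t0 : 0 <= a (n_ (phi r)) * x by rewrite mulr_ge0 ?ltW.
  have /andP[t1 t2] := truncn_itv t0.
  by rewrite ger0_norm ?subr_ge0// lerBlDl natr1 ltW.
have hnphi : n_ (phi r) @[r --> \oo] --> \oo by exact: (@cvg_comp _ _ _ _ n_ _ _ _ hphi hn).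
have hJphi : J_ (phi r) @[r --> \oo] --> \oo by exact: (@cvg_comp _ _ _ _ J_ _ _ _ hphi hJ).
have L1 := visits_limit hnphi hJphi (mulr_gt0 s0 x0) s0 hms has.
have yE : (s / (s * x)) `^ alpha^-1 = x `^ (- alpha^-1).
  by rewrite invfM mulrA divff ?gt_eqF// mul1r -(powR_inv1 (ltW x0)) -powRrM mulN1r.
rewrite yE in L1.
have lx0 : 0 < lambda * x by rewrite mulr_gt0.
have hE : vcdf V (h_position c lambda x) (x `^ (- alpha^-1)) = vcdf V (s * x) (x `^ (- alpha^-1)).
  rewrite sE -mulrA (vcdf_scale alpha_gt0 alpha_lt1 c_gt1 HM HV z lx0 xp).
  rewrite /h_position mulrC invr_expz.
  exact: (vcdf_scale alpha_gt0 alpha_lt1 c_gt1 HM HV _ lx0 xp).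
by rewrite hE.
Unshelve. all: by end_near. Qed.

End RenewalLimit.

Theorem theorem3p1 (R : realType) (alpha c : R) (M : R -> R)
  (alpha_gt0 : 0 < alpha) (alpha_lt1 : alpha < 1) (c_gt1 : 1 < c)
  (HM : semistable_modulus alpha c M)
  (dV : measure_display) (TV : measurableType dV) (Q : probability TV R)
  (V : R -> {RV Q >-> R})
  (HV : forall lambda : R, 0 < lambda -> semistable_rv alpha M lambda (V lambda))
  (k : nat -> nat)
  (k_gt0 : forall n, (0 < k n)%N)
  (k_incr : forall n, (k n < k n.+1)%N)
  (k_ratio : ((k n.+1)%:R / (k n)%:R : R) @[n --> \oo] --> c)
  (gamma : R -> R) (Hgamma : position_parameter c k gamma)
  (l1 : R -> R) (Hl1 : slowly_varying l1)
  (delta : R -> R)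
  (Hdelta : delta_function (fun n => norming alpha l1 (k n)) delta)
  (f : nat -> R) (Hf : prob_sequence f)
  (f_mean : (\sum_(0 <= j <oo) (j%:R * f j)%:E = +oo)%E)
  (d : measure_display) (T : measurableType d) (P : probability T R)
  (X : nat -> {RV P >-> nat})
  (HX : markov_chain_from 0 (renewal_transition f) X)
  (dtau : measure_display) (Ttau : measurableType dtau)
  (Ptau : probability Ttau R) (tau : {RV Ptau >-> R})
  (Htau : forall j : nat, Ptau [set w | tau w = j.+1%:R] = (f j)%:E)
  (h : R -> R)
  (h_rcont : forall x : R, 0 < x -> h y @[y --> x^'+] --> h x)
  (h_lim : forall x : R, 0 < x -> {for x, continuous M} ->
     h (norming alpha l1 (k n) * x) @[n --> \oo] --> 0)
  (Htail : \forall x \near +oo,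
     (1 - cdf tau x)%E
       = (ell alpha l1 x / x `^ alpha * (M (delta x) + h x))%:E) :
  (forall (n_ : nat -> nat) (lambda : R),
     (forall r, (0 < n_ r)%N) -> (forall r, (n_ r < n_ r.+1)%N) ->
     c^-1 < lambda -> lambda <= 1 ->
     cvg_circular c (fun r => gamma (a_seq alpha l1 (n_ r))) lambda ->
     forall x : R, 0 < x ->
       P [set w | (visits X (n_ r) w)%:R / a_seq alpha l1 (n_ r) <= x]
         @[r --> \oo]
       --> Q [set v | V (h_position c lambda x) v `^ (- alpha) <= x])
  /\
  ereal_sup
    [set `|P [set w | (a_seq alpha l1 n * x <= (visits X n w)%:R)%R]
           - Q [set v | (V (gamma (a_seq alpha l1 n * x)%R) v
                          <= x `^ (- alpha^-1))%R]|%E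
    | x in [set x : R | (0 < x)%R]] @[n --> \oo] --> 0%E.
Proof.
have c0 : 0 < c := lt_trans ltr01 c_gt1.
split.
  move=> n_ lambda n_0 n_incr l_lo l_hi hcir x x0.
  have l0 : 0 < lambda by apply: lt_trans l_lo; rewrite invr_gt0.
  have hn : n_ r @[r --> \oo] --> \oo.
    move=> S [N _ HN]; exists N => // r /= Nr; apply: HN => /=; apply: leq_trans Nr _.
    by elim: r => // r ih; exact: leq_ltn_trans ih (n_incr r).
  have ha := a_seq_pinfty alpha_gt0 alpha_lt1 c_gt1 HM k_gt0 k_incr Hl1 Hdelta Hf f_mean
    Htau h_lim Htail hn.
  have lim := circular_limit alpha_gt0 alpha_lt1 c_gt1 HM HV k_gt0 k_incr k_ratio Hgamma Hl1
    Hdelta Hf f_mean HX Htau h_lim Htail hn l0 x0 hcir.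
  have hl0 : 0 < h_position c lambda x.
    by rewrite divr_gt0 ?mulr_gt0 ?exprz_gt0.
  rewrite (semistable_power_cdf alpha_gt0 alpha_lt1 c_gt1 HM HV hl0 x0).
  (* S_n / a_n <= x is the complement of floor (a_n x) < S_n, and the limit event is a complement
     too, up to a null event. *)
  pose u r := fine (P [set w | (Num.truncn (a_seq alpha l1 (n_ r) * x) < visits X (n_ r) w)%N]).
  have lim2 : (1 - u r)%:E @[r --> \oo] --> (1 - vcdf V (h_position c lambda x) (x `^ (- alpha^-1)))%:E.
    apply: cvg_EFin; first exact: nearW.
    by apply: cvgB => //; exact: cvg_cst.
  apply: cvg_trans lim2; apply: near_eq_cvg.
  have a0 : \forall r \near \oo, 0 < a_seq alpha l1 (n_ r) by exact: (cvgryPgt _).1 ha 0.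
  apply: filterS a0 => r ar.
  have mV := (visits_gt_prob HX (n_ r) (Num.truncn (a_seq alpha l1 (n_ r) * x))).1.
  rewrite /u EFinB fineK ?fin_num_measure// -probability_setC//; congr (P _).
  have t0 : 0 <= a_seq alpha l1 (n_ r) * x by rewrite mulr_ge0 ?ltW.
  have /andP[t1 t2] := truncn_itv t0.
  apply/seteqP; split => w /=.
    move/negP; rewrite -leqNgt => h1; rewrite ler_pdivrMr// mulrC.
    by apply: le_trans t1; rewrite ler_nat.
  rewrite ler_pdivrMr// mulrC => h1; apply/negP; rewrite -leqNgt -ltnS -(ltr_nat R).
  exact: le_lt_trans h1 t2.
set U := fun n => ereal_sup _.
have ha := a_seq_pinfty alpha_gt0 alpha_lt1 c_gt1 HM k_gt0 k_incr Hl1 Hdelta Hf f_mean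
    Htau h_lim Htail (n_ := fun n => n) (fun _ h => h).
have [N0 _ HN0] : \forall n \near \oo, 0 < a_seq alpha l1 n by exact: (cvgryPgt _).1 ha 0.
have bound (e : R) : 0 < e -> \forall n \near \oo, (0 <= U n <= e%:E)%E.
  move=> e0; have [N1 _ HN1] := merging_uniform alpha_gt0 alpha_lt1 c_gt1 HM HV k_gt0 k_incr k_ratio Hgamma Hl1
    Hdelta Hf f_mean HX Htau h_lim Htail e0.
  exists (maxn N0 N1) => // n /=; rewrite geq_max => /andP[/HN0/= an /HN1/= hn].
  apply/andP; split.
    (* The value at x = 1 shows that the supremum is not over an empty set, so it is at least 0. *)
    apply: le_trans (ereal_sup_ubound _); last by exists 1 => //=; exact: ltr01.
    exact: abse_ge0.
  apply: ge_ereal_sup => _ [x /= x0 <-].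
  have [m hm] := pred_nat_exists (mulr_gt0 an x0).
  have mE := (visits_gt_prob HX n m).1.
  have := hn x x0; rewrite (visits_geE _ _ hm) -vcdfK.
  by rewrite -(fineK (fin_num_measure P _ mE)) -EFinB /= lee_fin.
apply/fine_cvgP; split.
  have := bound 1 ltr01; apply: filterS => n /andP[h1 h2].
  by rewrite ge0_fin_numE// (le_lt_trans h2)// ltry.
apply/cvgrPdist_le => e e0; have := bound e e0; apply: filterS => n /andP[h1 h2] /=.
have fn : U n \is a fin_num by rewrite ge0_fin_numE// (le_lt_trans h2)// ltry.
by rewrite sub0r normrN ger0_norm ?fine_ge0// -lee_fin fineK.
Qed.
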